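(* Assume that $\alpha$ and $Q$ satisfy the standing assumptions (i) and (ii) of the context, let $u^0\in C([-1,0];\mathcal P(\mathbb R^N))$, and let $\mu=\mu(t,dx)\in C([-1,\infty);\mathcal P(\mathbb R^N))$ be the solution (in the sense of the context) of $$\partial_t u(t,dx)=\int_{S}\alpha(t,\theta)\left[u(t+\theta,dx-y)-u(t,dx)\right]Q(d\theta,dy),\ t>0,\qquad u(\theta,dx)=u^0(\theta,dx),\ \theta\in[-1,0].$$ Then there exist a vector $\mathbf K\in\mathbb R^N$ and a probability measure $\pi\in\mathcal P(\mathbb R^N)$ with zero mean value such that for all $f\in C_b(\mathbb R^N)$, $$\lim_{t\to\infty}\int_{\mathbb R^N}f\left(\frac{x-\mathbf Kt}{\sqrt t}\right)\mu(t,dx)=\int_{\mathbb R^N}f(x)\,\pi(dx).$$ The vector $\mathbf K$ is given by $$\mathbf K=\frac{1}{1+\Gamma}\int_S\alpha_\infty(\theta)\,z\,Q(d\theta,dz),\qquad \Gamma:=\int_S(-\theta)\alpha_\infty(\theta)\,Q(d\theta,dz),$$ and $\pi(dx)=\Pi(1,dx)$, where $\Pi(t,dx)\in C([0,\infty);\mathcal P(\mathbb R^N))$ is the unique (tempered distribution) solution of the heat equation $$\partial_t\Pi=\frac12\,\mathrm{div}\left(\frac{D_0}{1+\Gamma}\nabla\Pi\right)+\delta_{t=0}\otimes\delta_0(dx),$$ with $D_0$ the non-negative symmetric matrix $$D_0=\int_S\alpha_\infty(\theta)\,[z+\theta\mathbf K][z+\theta\mathbf K]^T\,Q(d\theta,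dz).$$
   Context: $N\ge1$ is an integer, $S=[-1,0]\times\mathbb R^N$, $\mathcal P(\mathbb R^N)$ is the set of Borel probability measures on $\mathbb R^N$ endowed with the narrow topology (convergence against all $f\in C_b(\mathbb R^N)$, the bounded continuous functions), and $Q$ is a Borel probability measure on $S$. Standing assumptions: (i) $\alpha:[0,\infty)\times[-1,0]\to(0,\infty)$ is bounded and continuous, and there exist $M>0$, $\beta>0$ and a continuous function $\alpha_\infty:[-1,0]\to(0,\infty)$ with $|\alpha(t,\theta)-\alpha_\infty(\theta)|\le Me^{-\beta t}$ for all $t\ge0$, $\theta\in[-1,0]$; (ii) $(\theta,x)\mapsto|x|$ belongs to $L^2(S;Q)$, $|\cdot|$ being the Euclidean norm. Solution: $\mu\in C([-1,\infty);\mathcal P(\mathbb R^N))$ is the solution with initial data $u^0$ if $\mu(\theta,\cdot)=u^0(\theta,\cdot)$ for all $\theta\in[-1,0]$ and, for every $f\in C_b(\mathbb R^N)$, the map $t\mapsto\int f\,d\mu(t,\cdot)$ is continuously differentiable on $(0,\infty)$ with, for all $t>0$, $$\frac{d}{dt}\int_{\mathbb R^N} f(x)\mu(t,dx)=\int_S\alpha(t,\theta)\left[\int_{\mathbb R^N}f(x+z)\mu(t+\theta,dx)\right]Q(d\theta,dz)-\int_{\mathbb R^N}f(x)\mu(t,dx)\int_S\alpha(t,\theta)Q(d\theta,dz).$$ Such a solution exists and is unique. Tempered distribution solution of the heat equation means: for every Schwartz function $\phi$ on $[0,\infty)\times\mathbb R^N$ (restriction of a Schwartz function on $\mathbb R\times\mathbb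 R^N$), $\int_0^\infty\int_{\mathbb R^N}\left[\partial_t\phi+\frac12\mathrm{div}\left(\frac{D_0}{1+\Gamma}\nabla\phi\right)\right]\Pi(t,dx)\,dt=-\phi(0,0)$. *)

(* Defs.v *)
From HB Require Import structures.
From mathcomp Require Import all_boot all_order all_algebra.
From mathcomp Require Import all_classical all_reals all_analysis.
From mathcomp Require Import giry.

Set Implicit Arguments.
Unset Strict Implicit.
Unset Printing Implicit Defensive.
Import Order.TTheory GRing.Theory Num.Theory.
Import numFieldNormedType.Exports.

Local Open Scope classical_set_scope.
Local Open Scope ring_scope.

(* R^N is 'rV[R]_N with its Borel sigma-algebra, generated by the open sets
   of the product topology. *)
HB.instance Definition _ (R : realType) (N : nat) :=
  @isMeasurable.Build (sigma_display (@open 'rV[R]_N)) 'rV[R]_N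
    <<s (@open 'rV[R]_N) >> (@sigma_algebra0 _ setT _) (@sigma_algebraC _ _)
    (@sigma_algebra_bigcup _ setT _).

Section narrow.
Variables (R : realType) (N : nat).
Implicit Types (f : 'rV[R]_N -> R) (m : R -> probability 'rV[R]_N R).

(* The norm that the library puts on 'rV[R]_N is the maximum norm. *)
Definition enorm (x : 'rV[R]_N) : R := Num.sqrt (\sum_i x ord0 i ^+ 2).

Definition Cb f : Prop := continuous f /\ bounded_fun f.

(* m \in C(I; P(R^N)) for the narrow topology; values of m outside I are
   irrelevant. *)
Definition narrow_continuous (I : set R) m : Prop :=
  forall f, Cb f -> {within I, continuous (fun t => \int[m t]_x f x)}.

Definition zero_mean (p : probability 'rV[R]_N R) : Prop :=
  forall i : 'I_N,
    p.-integrable setT (fun x => (x ord0 i)%:E) /\ \int[p]_x x ord0 i = 0.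

End narrow.

Section delay_equation.
Variables (R : realType) (N : nat).
Implicit Types (Q : probability (R * 'rV[R]_N)%type R).
Implicit Types (alpha : R -> R -> R) (alpha_inf : R -> R).

Definition strip : set (R * 'rV[R]_N) := `[-1, 0] `*` setT.

Definition rate_assumption alpha alpha_inf : Prop :=
  let dom : set (R * R) := `[0, +oo[ `*` `[-1, 0] in
  [/\ forall t theta : R, 0 <= t -> theta \in `[-1, 0] -> 0 < alpha t theta,
      [bounded alpha p.1 p.2 | p in dom],
      {within dom, continuous (fun p : R * R => alpha p.1 p.2)},
      (forall theta : R, theta \in `[-1, 0] -> 0 < alpha_inf theta) /\
      {within `[-1, 0], continuous alpha_inf} &
      exists M beta : R, [/\ 0 < M, 0 < beta &
        forall t theta : R, 0 <= t -> theta \in `[-1, 0] ->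
          `|alpha t theta - alpha_inf theta| <= M * expR (- beta * t)]].

(* A probability measure on S = [-1, 0] x R^N is a probability measure on
   R x R^N that gives mass 1 to S. *)
Definition jump_assumption Q : Prop :=
  Q strip = 1%E /\ (fun p : R * 'rV[R]_N => enorm p.2) \in Lfun Q 2%:E.

Definition delay_rhs alpha Q (mu : R -> probability 'rV[R]_N R)
    (f : 'rV[R]_N -> R) (t : R) : R :=
  \int[Q]_(p in strip) (alpha t p.1 * \int[mu (t + p.1)]_x f (x + p.2))
  - (\int[mu t]_x f x) * \int[Q]_(p in strip) alpha t p.1.

Definition delay_solution alpha Q (u0 mu : R -> probability 'rV[R]_N R) :
    Prop :=
  [/\ narrow_continuous `[-1, +oo[ mu,
      forall theta : R, theta \in `[-1, 0] -> mu theta ≡μ u0 theta &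
      forall f, Cb f ->
        let F := fun t => \int[mu t]_x f x in
        [/\ forall t : R, 0 < t -> derivable F t 1,
            {within `]0, +oo[, continuous derive1 F} &
            forall t : R, 0 < t -> derive1 F t = delay_rhs alpha Q mu f t]].

Definition delay_Gamma Q alpha_inf : R :=
  \int[Q]_(p in strip) (- p.1 * alpha_inf p.1).

Definition delay_drift Q alpha_inf : 'rV[R]_N :=
  (1 + delay_Gamma Q alpha_inf)^-1 *:
    \row_i \int[Q]_(p in strip) (alpha_inf p.1 * p.2 ord0 i).

(* Elements of R^N being row vectors, the matrix v v^T of the column
   convention is v^T *m v. *)
Definition delay_diffusion Q alpha_inf (K : 'rV[R]_N) : 'M[R]_N :=
  \matrix_(i, j) \int[Q]_(p in strip)
    (alpha_inf p.1 * ((p.2 + p.1 *: K)^T *m (p.2 + p.1 *: K)) i j).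

End delay_equation.

Section heat_equation.
Variables (R : realType) (N : nat).
Implicit Types (phi : R * 'rV[R]_N -> R).

(* None is the time direction, Some i the i-th space direction. *)
Definition dir (o : option 'I_N) : R * 'rV[R]_N :=
  if o is Some i then (0, delta_mx ord0 i) else (1, 0).

Definition partial (o : option 'I_N) phi : R * 'rV[R]_N -> R :=
  fun p => 'D_(dir o) phi p.

Definition iter_partial (s : seq (option 'I_N)) phi : R * 'rV[R]_N -> R :=
  foldr partial phi s.

Definition schwartz phi : Prop :=
  forall s : seq (option 'I_N),
    [/\ continuous (iter_partial s phi),
        forall o (p : R * 'rV[R]_N), derivable (iter_partial s phi) p (dir o) &
        forall k : nat, bounded_fun (fun p : R * 'rV[R]_N =>
          (1 + `|p.1| + enorm p.2) ^+ k * iter_partial s phi p)].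

Definition grad phi (p : R * 'rV[R]_N) : 'cV[R]_N :=
  \col_i partial (Some i) phi p.

Definition divergence (V : R * 'rV[R]_N -> 'cV[R]_N) (p : R * 'rV[R]_N) : R :=
  \sum_i partial (Some i) (fun q => V q i ord0) p.

(* d_t Pi = 1/2 div (A grad Pi) + delta_{t = 0} (x) delta_0 on [0, oo) x R^N,
   tested against (restrictions of) real-valued Schwartz functions. *)
Definition heat_solution (A : 'M[R]_N) (Pi : R -> probability 'rV[R]_N R) :
    Prop :=
  forall phi, schwartz phi ->
    \int[lebesgue_measure]_(t in `[0%R, +oo[)
      (\int[Pi t]_x (partial None phi (t, x)
         + 2^-1 * divergence (fun q => A *m grad phi q) (t, x)))
    = - phi (0, 0).

End heat_equation.

(* Main.v *)
(* Idea. In the frame moving with velocity K, the characteristic function of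
   mu t at frequency xi satisfies a scalar delay equation whose jumps are those
   of Q shifted by theta K. Its oscillation over unit time windows contracts
   geometrically up to an error O(|xi|), so it is nearly constant along a window
   and the functional
     J(t) = C(t) + int_Q alpha_inf(theta) int_(t + theta)^t e^(i xi (z + theta K)) C(s) ds
   is close to (1 + Gamma) C(t). The delayed terms cancel in J', which leaves
   J' = - (p(xi) + i r(xi)) C + O(e^(- beta t)), where K is chosen so that
   r(xi) = o(|xi|^2), while p(xi) ~ (xi D0 xi) / 2. With xi = eta / sqrt T this gives
   C(T) -> exp (- (eta D0 eta) / (2 (1 + Gamma))), and Levy's continuity theorem
   concludes. The heat solution is the law of sqrt t X for a Gaussian X (Stein's
   identity gives the equation); uniqueness follows from testing with Schwartz
   functions that approximate 1_[0, b](t) cos (xi x), which determines the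
   characteristic function of Pi t. *)

Require Import Defs.
From HB Require Import structures.
From mathcomp Require Import all_boot all_order all_algebra.
From mathcomp Require Import all_classical all_reals all_analysis.
From mathcomp Require Import giry measurable_realfun.
From mathcomp Require Import ring lra.

Set Implicit Arguments.
Unset Strict Implicit.
Unset Printing Implicit Defensive.
Import Order.TTheory GRing.Theory Num.Theory.
Import numFieldNormedType.Exports.

Local Open Scope classical_set_scope.
Local Open Scope ring_scope.

(** Only second moments of the jumps are available, so the estimates at a fixed frequency keep the
    integrals [E1], [pp] and [rr] as they are. These are evaluated afterwards by dominated
    convergence along a sequence [T_ k], where u^2 is a majorant of both |1 - cos u| and |sin u -
    u|.

    The final limit is double. An estimate started at time n leaves, as k tends to infinity, an
    error made of (1 - exp (- A))^n and exp (- be n); only then does n tend to infinity. The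
    contraction factor depends on the rate bound [A] alone, hence serves all frequencies at once.

    The drift satisfies (1 + Gamma) K = int alpha_inf z, which is exactly int alpha_inf (z + theta
    K) = K: the first-order term of the jumps cancels the motion of the frame. The division of D0 by
    1 + Gamma comes from J being close to (1 + Gamma) C.

    No complex numbers appear: cosines carry a free phase a, and a = - pi / 2 turns a result on
    cosines into one on sines. Gaussian vectors are handled through Stein's identity alone, which
    gives at once their characteristic function and the heat equation. *)

Section integration_tools.
Context d (T : measurableType d) (R : realType).

Lemma finite_bounded_integrable (mu : {measure set T -> \bar R}) (D : set T)
    (f : T -> R) (M : R) : measurable D -> (mu D < +oo)%E ->
  measurable_fun D f -> (forall x, D x -> `|f x| <= M) ->
  mu.-integrable D (EFin \o f).
Proof.
move=> mD fin mf fM; apply: measurable_bounded_integrable => //.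
exists M; split; first exact: num_real.
by move=> r Mr x Dx /=; rewrite (le_trans (fM _ Dx))// ltW.
Qed.

Lemma bounded_integrable (mu : {finite_measure set T -> \bar R}) (D : set T)
    (f : T -> R) (M : R) : measurable D -> measurable_fun D f ->
  (forall x, D x -> `|f x| <= M) -> mu.-integrable D (EFin \o f).
Proof.
move=> mD mf fM; apply: (@finite_bounded_integrable _ _ _ M) => //.
by rewrite -ge0_fin_numE ?fin_num_measure.
Qed.

Lemma dominated_Rintegrable (mu : {measure set T -> \bar R}) (D : set T)
    (f g : T -> R) : measurable D -> measurable_fun D f ->
  mu.-integrable D (EFin \o g) ->
  (forall x, D x -> `|f x| <= g x) -> mu.-integrable D (EFin \o f).
Proof.
move=> mD mf ig fg; apply: (le_integrable mD _ _ ig); first exact/measurable_EFinP.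
by move=> x Dx /=; rewrite lee_fin (le_trans (fg _ Dx))// ler_norm.
Qed.

Lemma Rintegral_dominated_cvg (mu : {measure set T -> \bar R}) (D : set T)
    (fs : nat -> T -> R) (f g : T -> R) : measurable D ->
  (forall n, measurable_fun D (fs n)) ->
  (forall x, D x -> fs n x @[n --> \oo] --> f x) ->
  mu.-integrable D (EFin \o g) ->
  (forall n x, D x -> `|fs n x| <= g x) ->
  \int[mu]_(x in D) fs n x @[n --> \oo] --> \int[mu]_(x in D) f x.
Proof.
move=> mD mfs fsf ig fsg.
have mf : measurable_fun D f by apply: (measurable_fun_cvg mfs).
have h1 : {ae mu, forall x, D x -> (fs n x)%:E @[n --> \oo] --> (f x)%:E}.
  by apply: aeW => x Dx; apply: cvg_EFin; [exact: nearW|exact: fsf].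
have h2 : {ae mu, forall x, forall n, D x -> (`|(fs n x)%:E| <= (g x)%:E)%E}.
  by apply: aeW => x n Dx; rewrite /= lee_fin fsg.
have [ifx _ h] := dominated_convergence mD
  (fun n => (measurable_EFinP _ _).2 (mfs n)) ((measurable_EFinP _ _).2 mf)
  h1 ig h2.
apply: fine_cvg.
by rewrite /Rintegral fineK//; exact: integrable_fin_num.
Qed.

Lemma le_normr_Rintegral_dominated (mu : {measure set T -> \bar R})
    (D : set T) (f g : T -> R) : measurable D -> measurable_fun D f ->
  mu.-integrable D (EFin \o g) -> (forall x, D x -> `|f x| <= g x) ->
  `|\int[mu]_(x in D) f x| <= \int[mu]_(x in D) g x.
Proof.
move=> mD mf ig fg.
have ifx := dominated_Rintegrable mD mf ig fg.
apply: le_trans (le_normr_Rintegral _ _) _ => //.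
apply: le_Rintegral => //; exact: integrable_norm.
Qed.

Lemma Rintegral_pcst (mu : probability T R) (M : R) : \int[mu]_x M = M.
Proof.
rewrite Rintegral_cst//; have := congr1 fine (probability_setT mu) => /= h.
by rewrite [X in _ * X]h mulr1.
Qed.

Lemma prob_norm_le (mu : probability T R) (f : T -> R) (M : R) :
  measurable_fun setT f -> (forall x, `|f x| <= M) -> `|\int[mu]_x f x| <= M.
Proof.
move=> mf fM; have -> : M = \int[mu]_x (fun=> M) x.
  by rewrite Rintegral_pcst.
apply: le_normr_Rintegral_dominated => //.
by apply: (@bounded_integrable _ _ _ `|M|).
Qed.

Lemma Rintegral_sum (mu : {measure set T -> \bar R}) (D : set T) (I : Type)
    (s : seq I) (f : I -> T -> R) : measurable D ->
  (forall i, mu.-integrable D (EFin \o f i)) ->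
  \int[mu]_(x in D) (\sum_(i <- s) f i x) =
  \sum_(i <- s) \int[mu]_(x in D) f i x.
Proof.
move=> mD fi; elim: s => [|i s ih].
  rewrite big_nil; under eq_Rintegral do rewrite big_nil.
  by rewrite Rintegral_cst// mul0r.
under eq_Rintegral do rewrite big_cons.
rewrite big_cons RintegralD//; first by rewrite ih.
have -> : EFin \o (fun x => \sum_(j <- s) f j x) =
    (fun x => \sum_(j <- s) (EFin \o f j) x)%E.
  by apply/funext => x /=; rewrite sumEFin.
by apply: integrable_sum => // j; exact: fi.
Qed.

Lemma measurable_cont_comp (D : set T) (h : R -> R) (f : T -> R) :
  continuous h -> measurable_fun D f -> measurable_fun D (fun t => h (f t)).
Proof.
move=> ch mf.
exact: (measurableT_comp (continuous_measurable_fun ch) mf).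
Qed.

End integration_tools.

(** * Image laws and Fubini's theorem for real-valued integrals *)

Section pushforward_fubini.
Context d1 d2 (T1 : measurableType d1) (T2 : measurableType d2) (R : realType).

Definition law (mu : probability T1 R) (phi : T1 -> T2)
    (mphi : measurable_fun setT phi) : probability T2 R :=
  distribution mu (mfun_Sub (mem_set mphi)).

Lemma integrable_law (mu : probability T1 R) (phi : T1 -> T2)
    (mphi : measurable_fun setT phi) (f : T2 -> R) : measurable_fun setT f ->
  mu.-integrable setT (EFin \o (f \o phi)) ->
  (law mu mphi).-integrable setT (EFin \o f).
Proof.
move=> mf fi; have := @integrable_pushforward _ _ _ _ _ _ mphi mu setT
  (EFin \o f) ((measurable_EFinP _ _).2 mf).
by apply; rewrite ?preimage_setT//.
Qed.

Lemma Rintegral_law (mu : probability T1 R) (phi : T1 -> T2)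
    (mphi : measurable_fun setT phi) (f : T2 -> R) : measurable_fun setT f ->
  mu.-integrable setT (EFin \o (f \o phi)) ->
  \int[law mu mphi]_y f y = \int[mu]_x f (phi x).
Proof.
move=> mf fi; rewrite /Rintegral; congr fine.
have := @integral_pushforward _ _ _ _ _ _ mphi mu setT
  (EFin \o f) ((measurable_EFinP _ _).2 mf).
by rewrite preimage_setT; apply.
Qed.

Variables (m1 : probability T1 R) (m2 : probability T2 R).

Lemma product_measure_lty : ((m1 \x m2)%E setT < +oo)%E.
Proof.
rewrite -setXTT product_measure1E// -ge0_fin_numE ?mule_ge0//.
by rewrite fin_numM// fin_num_measure.
Qed.

Section bounded.
Variables (f : T1 * T2 -> R) (M : R).
Hypotheses (mf : measurable_fun setT f) (fM : forall x, `|f x| <= M).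

Lemma measurable_section1 x : measurable_fun setT (fun y => f (x, y)).
Proof. by apply: (measurableT_comp mf); exact: measurable_pair1. Qed.

Lemma measurable_section2 y : measurable_fun setT (fun x => f (x, y)).
Proof. by apply: (measurableT_comp mf); exact: measurable_pair2. Qed.

End bounded.

Section integrable.
Variables (f : T1 * T2 -> R).
Hypotheses (mf : measurable_fun setT f).
Hypotheses (fi : (m1 \x m2)%E.-integrable setT (EFin \o f)).
Hypothesis (fi1 : forall x, m2.-integrable setT (fun y => (f (x, y))%:E)).
Hypothesis (fi2 : forall y, m1.-integrable setT (fun x => (f (x, y))%:E)).

(** [fi1] and [fi2] ask for integrability of every section, not of almost every one: [Rintegral]
    applies [fine] to an extended integral, and the inner integral has to be finite at each point
    for the two kinds of iterated integrals to coincide without exceptional sets. *)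
Lemma fubini_Rintegrable1 :
  m1.-integrable setT (fun x => (\int[m2]_y f (x, y))%:E).
Proof.
have := integrable_fubini_F fi; apply: eq_integrable => // x _.
by rewrite /fubini_F/= /Rintegral fineK//; exact: integrable_fin_num (fi1 x).
Qed.

Lemma fubini_Rintegrable2 :
  m2.-integrable setT (fun y => (\int[m1]_x f (x, y))%:E).
Proof.
have mF := measurable_int _ fi.
have GE : (fun y => (\int[m1]_x f (x, y))%:E) = fubini_G m1 (EFin \o f).
  apply/funext => y; rewrite /fubini_G/= /Rintegral fineK//.
  exact: integrable_fin_num (fi2 y).
have mG : measurable_fun setT (fun y => (\int[m1]_x f (x, y))%:E).
  by rewrite GE; exact: (measurable_fubini_G fi).
apply/integrableP; split => //.
apply: le_lt_trans ((integrable21ltyP m1 m2 mF).1 fi).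
have mabs : measurable_fun setT (abse \o (EFin \o f)).
  exact: measurableT_comp.
apply: ge0_le_integral => //; first exact: measurableT_comp.
  exact: (measurable_fun_fubini_tonelli_G _ mabs (fun=> abse_ge0 _)).
move=> y _ /=; rewrite EFin_normr_Rintegral//.
  by apply: le_abse_integral => //; exact: measurable_int (fi2 y).
exact: fi2.
Qed.

Lemma fubini_Rintegral1 :
  \int[(m1 \x m2)%E]_z f z = \int[m1]_x \int[m2]_y f (x, y).
Proof.
rewrite /Rintegral -(integral12_prod_meas1 fi); congr fine.
apply: eq_integral => x _; rewrite /fubini_F/= fineK//.
exact: integrable_fin_num (fi1 x).
Qed.

Lemma fubini_Rintegral2 :
  \int[(m1 \x m2)%E]_z f z = \int[m2]_y \int[m1]_x f (x, y).
Proof.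
rewrite /Rintegral -(integral21_prod_meas1 fi); congr fine.
apply: eq_integral => x _; rewrite /fubini_G/= fineK//.
exact: integrable_fin_num (fi2 x).
Qed.

End integrable.

Lemma bounded_Fubini (f : T1 * T2 -> R) (M : R) :
  measurable_fun setT f -> (forall x, `|f x| <= M) ->
  \int[m1]_x \int[m2]_y f (x, y) = \int[m2]_y \int[m1]_x f (x, y).
Proof.
move=> mf fM.
have i1 x : m2.-integrable setT (fun y => (f (x, y))%:E).
  by apply: (@bounded_integrable _ _ _ m2 setT (fun y => f (x, y)) M) => //;
    exact: measurable_section1.
have i2 y : m1.-integrable setT (fun x => (f (x, y))%:E).
  by apply: (@bounded_integrable _ _ _ m1 setT (fun x => f (x, y)) M) => //;
    exact: measurable_section2.
have i : (m1 \x m2)%E.-integrable setT (EFin \o f).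
  by apply: (finite_bounded_integrable _ product_measure_lty mf) => // x _; exact: fM.
by rewrite -fubini_Rintegral1// fubini_Rintegral2.
Qed.

Lemma bounded_fubini_measurable1 (f : T1 * T2 -> R) (M : R) :
  measurable_fun setT f -> (forall x, `|f x| <= M) ->
  measurable_fun setT (fun x => \int[m2]_y f (x, y)).
Proof.
move=> mf fM; apply/measurable_EFinP; apply: measurable_int.
apply: fubini_Rintegrable1 => //.
  by apply: (finite_bounded_integrable _ product_measure_lty mf) => // x _; exact: fM.
by move=> x; apply: (@bounded_integrable _ _ _ m2 setT (fun y => f (x, y)) M)
  => //; exact: measurable_section1.
Qed.

End pushforward_fubini.

(** * Narrow convergence and characteristic functions *)

Section borel_rV.
Context (R : realType) (N : nat).
Implicit Types (x y : 'rV[R]_N) (U : set 'rV[R]_N).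

Lemma ball_rVP x y (e : R) : 0 < e ->
  ball x e y <-> forall i, `|x ord0 i - y ord0 i| < e.
Proof.
move=> e0; split; first by move=> [_ h] i; exact: (h ord0 i).
by move=> h; split => // i j; rewrite (ord1 i); exact: h.
Qed.

Lemma ratr_rV_dense x (e : R) : 0 < e ->
  exists q : 'rV[rat]_N, forall i, `|x ord0 i - ratr (q ord0 i)| < e.
Proof.
move=> e0.
have h i : exists q : rat, `|x ord0 i - ratr q| < e.
  have /rat_in_itvoo[q] : x ord0 i - e < x ord0 i + e by lra.
  by rewrite in_itv/= => /andP[a b]; exists q; rewrite ltr_norml; lra.
exists (\row_i sval (cid (h i))) => i; rewrite mxE.
exact: (svalP (cid (h i))).
Qed.

(** A countable base of the topology, indexed by a countable type so that [pickle] can enumerate it.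
    It reduces open sets to countable unions of boxes. *)
Definition rat_ball (q : 'rV[rat]_N * nat) : set 'rV[R]_N :=
  ball (map_mx ratr q.1 : 'rV[R]_N) (q.2.+1%:R^-1).

Lemma open_rat_ball U : open U ->
  U = \bigcup_(q in [set q | rat_ball q `<=` U]) rat_ball q.
Proof.
move=> oU; apply/seteqP; split => [x Ux|x [q qU qx]]; last exact: qU.
have /nbhs_ballP[e /= e0 xeU] : nbhs x U by exact: open_nbhs_nbhs.
(* Half of [e]: a point of the small ball and [x] both lie within the radius of the rational centre,
   hence within [e] of each other. *)
have [k ke] : exists k : nat, k.+1%:R^-1 < e / 2.
  have := @near_infty_natSinv_lt R (PosNum (divr_gt0 e0 (ltr0n _ 2))).
  by move=> [k _ /(_ k (leqnn k))]; exists k.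
have k0 : 0 < k.+1%:R^-1 :> R by rewrite invr_gt0.
have [q xq] := ratr_rV_dense x k0.
have qx : rat_ball (q, k) x.
  by apply/ball_rVP => // i; rewrite mxE distrC.
exists (q, k) => //= y qy; apply: xeU; apply/ball_rVP => // i.
have := xq i; move/ball_rVP : qy => /(_ k0 i); rewrite mxE.
move: k0 ke; set r := _^-1; set a := ratr _ => r0 re h1 h2.
rewrite -(subrK a (x ord0 i)) -addrA (le_lt_trans (ler_normD _ _))//; lra.
Qed.

Lemma measurable_open_rV U : open U -> measurable U.
Proof. by move=> oU; exact: sub_sigma_algebra. Qed.

Lemma continuous_measurable_rV (f : 'rV[R]_N -> R) :
  continuous f -> measurable_fun setT f.
Proof.
move=> /continuousP cf; apply: (measurability _ (RGenOpens.measurableE R)).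
move=> _ [_ [a [b ->] <-]]; rewrite setTI; apply: measurable_open_rV.
exact/cf/interval_open.
Qed.

(** An open set is a countable union of rational balls, and a ball of the maximum norm is a finite
    intersection of conditions on single coordinates. This links the Borel structure of the whole
    space to the coordinates. *)
Lemma measurable_rV d (T : measurableType d) (f : T -> 'rV[R]_N) :
  (forall i, measurable_fun setT (fun t => f t ord0 i)) ->
  measurable_fun setT f.
Proof.
move=> mf; apply: (measurability (@open 'rV[R]_N)) => //.
move=> _ [U oU <-]; rewrite setTI (open_rat_ball oU) preimage_bigcup.
rewrite bigcup_mkcond; apply: countable_bigcupT_measurable => // -[q k].
case: ifPn => // _.
have k0 : 0 < k.+1%:R^-1 :> R by rewrite invr_gt0.
have -> : f @^-1` rat_ball (q, k) = \bigcap_(i in [set: 'I_N])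
    ((fun t => f t ord0 i) @^-1` ball (ratr (q ord0 i) : R) (k.+1%:R^-1)).
  apply/seteqP; split => t.
    move=> /ball_rVP => /(_ k0) h i _; move: (h i); rewrite !mxE /=.
    done.
  move=> h; apply/ball_rVP => // i; move: (h i I); rewrite !mxE /=.
  done.
apply: fin_bigcap_measurable => // i _.
rewrite -[X in measurable X]setTI; apply: mf => //.
exact: measurable_ball.
Qed.

End borel_rV.

Section real_continuity.
Context (R : realType) (T : topologicalType).
Implicit Types (f g : T -> R).

Lemma contD f g : continuous f -> continuous g ->
  continuous (fun t => f t + g t).
Proof. by move=> cf cg t; apply: cvgD; [exact: cf|exact: cg]. Qed.

Lemma contM f g : continuous f -> continuous g ->
  continuous (fun t => f t * g t).
Proof. by move=> cf cg t; apply: cvgM; [exact: cf|exact: cg]. Qed.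

Lemma contN f : continuous f -> continuous (fun t => - f t).
Proof. by move=> cf t; apply: cvgN; exact: cf. Qed.

Lemma contB f g : continuous f -> continuous g ->
  continuous (fun t => f t - g t).
Proof. by move=> cf cg; apply: contD => //; exact: contN. Qed.

Lemma cont_cst (a : R) : continuous (fun _ : T => a).
Proof. exact: cst_continuous. Qed.

Lemma cont_norm f : continuous f -> continuous (fun t => `|f t|).
Proof. by move=> cf t; apply: cvg_norm; exact: cf. Qed.

Lemma cont_sum (I : Type) (s : seq I) (f : I -> T -> R) :
  (forall i, continuous (f i)) -> continuous (fun t => \sum_(i <- s) f i t).
Proof.
move=> cf; elim: s => [|i s ih].
  by under eq_fun do rewrite big_nil; exact: cst_continuous.
by under eq_fun do rewrite big_cons; apply: contD.
Qed.

Lemma cont_comp (h : R -> R) f : continuous h -> continuous f ->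
  continuous (fun t => h (f t)).
Proof. by move=> ch cf t; apply: (continuous_comp (cf t)); exact: ch. Qed.

Lemma cont_cos f : continuous f -> continuous (fun t => cos (f t)).
Proof. by move=> cf; apply: cont_comp => //; exact: continuous_cos. Qed.

Lemma cont_sin f : continuous f -> continuous (fun t => sin (f t)).
Proof. by move=> cf; apply: cont_comp => //; exact: continuous_sin. Qed.

Lemma cont_expR f : continuous f -> continuous (fun t => expR (f t)).
Proof. by move=> cf; apply: cont_comp => //; exact: continuous_expR. Qed.

End real_continuity.

Section dot_product.
Context (R : realType) (N : nat).
Implicit Types (x y z u v : 'rV[R]_N).

Definition dotv x y : R := \sum_i x ord0 i * y ord0 i.

Lemma dotvC x y : dotv x y = dotv y x.
Proof. by apply: eq_bigr => i _; rewrite mulrC. Qed.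

Lemma dotvDl x y z : dotv (x + y) z = dotv x z + dotv y z.
Proof. by rewrite -big_split; apply: eq_bigr => i _ /=; rewrite mxE mulrDl. Qed.

Lemma dotvZl a x z : dotv (a *: x) z = a * dotv x z.
Proof. by rewrite mulr_sumr; apply: eq_bigr => i _; rewrite mxE mulrA. Qed.

Lemma dotvDr x y z : dotv z (x + y) = dotv z x + dotv z y.
Proof. by rewrite !(dotvC z) dotvDl. Qed.

Lemma dotvZr a x z : dotv z (a *: x) = a * dotv z x.
Proof. by rewrite !(dotvC z) dotvZl. Qed.

Lemma dotvNl x z : dotv (- x) z = - dotv x z.
Proof. by rewrite -scaleN1r dotvZl mulN1r. Qed.

Lemma dotvNr x z : dotv z (- x) = - dotv z x.
Proof. by rewrite !(dotvC z) dotvNl. Qed.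

Lemma dotv_ge0 x : 0 <= dotv x x.
Proof. by apply: sumr_ge0 => i _; rewrite -expr2 sqr_ge0. Qed.

Lemma dotv_ge_coord x i : x ord0 i ^+ 2 <= dotv x x.
Proof.
rewrite /dotv (bigD1 i)//= expr2 lerDl; apply: sumr_ge0 => j _.
by rewrite -expr2 sqr_ge0.
Qed.

Lemma coord_continuous_rV (i : 'I_N) : continuous (fun x => x ord0 i).
Proof. exact: coord_continuous. Qed.

Lemma continuous_rV (T : topologicalType) (f : T -> 'rV[R]_N) (t : T) :
  (forall i, f s ord0 i @[s --> t] --> f t ord0 i) -> {for t, continuous f}.
Proof.
move=> h; apply/cvg_ballP => e e0; near=> s.
apply/ball_rVP => //; near: s; apply: filter_forall => i.
by move: (h i) => /cvgrPdist_lt; apply.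
Unshelve. all: by end_near. Qed.

Lemma dotv_continuous (T : topologicalType) (f g : T -> 'rV[R]_N) :
  (forall i, continuous (fun t => f t ord0 i)) ->
  (forall i, continuous (fun t => g t ord0 i)) ->
  continuous (fun t => dotv (f t) (g t)).
Proof.
by move=> cf cg; apply: cont_sum => i; exact: contM.
Qed.

Lemma dotvl_continuous u : continuous (dotv u).
Proof.
apply: dotv_continuous => i; first exact: cst_continuous.
exact: coord_continuous_rV.
Qed.

Lemma dotv_sub_continuous y : continuous (fun x => dotv (x - y) (x - y)).
Proof.
have h i : continuous (fun x => (x - y) ord0 i).
  under eq_fun do rewrite !mxE.
  apply: (@contB _ _ (fun x : 'rV[R]_N => x ord0 i) (fun=> y ord0 i)).
    exact: coord_continuous_rV.
  exact: cont_cst.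
exact: dotv_continuous.
Qed.

Lemma measurable_coord i : measurable_fun setT (fun x => x ord0 i).
Proof. apply: continuous_measurable_rV; exact: coord_continuous_rV. Qed.

Lemma measurable_dotv d (T : measurableType d) (f g : T -> 'rV[R]_N) :
  measurable_fun setT f -> measurable_fun setT g ->
  measurable_fun setT (fun t => dotv (f t) (g t)).
Proof.
move=> mf mg; apply: measurable_sum => i; apply: measurable_funM.
  exact: (measurableT_comp (measurable_coord i)).
exact: (measurableT_comp (measurable_coord i)).
Qed.

End dot_product.

Section Cb_theory.
Context (R : realType) (N : nat).
Implicit Types (f g : 'rV[R]_N -> R).

Lemma CbP f : Cb f <-> continuous f /\ exists M, forall x, `|f x| <= M.
Proof.
split=> -[cf fM]; split => //.
  case: fM => M [_ h]; have := h (M + 1); rewrite ltrDl ltr01 => /(_ isT) hM.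
  by exists (M + 1) => x; exact: hM.
case: fM => M fM; exists M; split; first exact: num_real.
by move=> r Mr x _ /=; rewrite (le_trans (fM x))// ltW.
Qed.

Lemma Cb_bound f (M : R) : continuous f -> (forall x, `|f x| <= M) -> Cb f.
Proof. by move=> cf fM; apply/CbP; split => //; exists M. Qed.

Lemma Cb_measurable f : Cb f -> measurable_fun setT f.
Proof. by move=> /CbP[cf _]; exact: continuous_measurable_rV. Qed.

Lemma Cb_integrable (p : probability 'rV[R]_N R) f : Cb f ->
  p.-integrable setT (EFin \o f).
Proof.
move=> cf; have /CbP[_ [M fM]] := cf.
apply: (@bounded_integrable _ _ _ p setT f M) => //.
exact: Cb_measurable.
Qed.

Lemma Cb_cst a : Cb (fun _ : 'rV[R]_N => a).
Proof. by apply: (@Cb_bound _ `|a|) => //; exact: cst_continuous. Qed.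

Lemma CbD f g : Cb f -> Cb g -> Cb (fun x => f x + g x).
Proof.
move=> /CbP[cf [A fA]] /CbP[cg [B gB]]; apply: (@Cb_bound _ (A + B)).
  exact: contD.
by move=> x; rewrite (le_trans (ler_normD _ _))// lerD.
Qed.

Lemma CbM f g : Cb f -> Cb g -> Cb (fun x => f x * g x).
Proof.
move=> /CbP[cf [A fA]] /CbP[cg [B gB]]; apply: (@Cb_bound _ (A * B)).
  exact: contM.
by move=> x; rewrite normrM ler_pM.
Qed.

Lemma CbZ a f : Cb f -> Cb (fun x => a * f x).
Proof. by move=> cf; apply: CbM => //; exact: Cb_cst. Qed.

Lemma CbN f : Cb f -> Cb (fun x => - f x).
Proof.
move=> /CbP[cf [A fA]]; apply: (@Cb_bound _ A); first exact: contN.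
by move=> x; rewrite normrN.
Qed.

Lemma CbB f g : Cb f -> Cb g -> Cb (fun x => f x - g x).
Proof. by move=> cf cg; apply: CbD => //; exact: CbN. Qed.

Lemma Cb_norm f : Cb f -> Cb (fun x => `|f x|).
Proof.
move=> /CbP[cf [A fA]]; apply: (@Cb_bound _ A); first exact: cont_norm.
by move=> x; rewrite normr_id.
Qed.

Lemma Cb_cos f : continuous f -> Cb (fun x => cos (f x)).
Proof.
move=> cf; apply: (@Cb_bound _ 1); first exact: cont_cos.
by move=> x; rewrite ler_norml cos_geN1 cos_le1.
Qed.

Lemma Cb_sin f : continuous f -> Cb (fun x => sin (f x)).
Proof.
move=> cf; apply: (@Cb_bound _ 1); first exact: cont_sin.
by move=> x; rewrite ler_norml sin_geN1 sin_le1.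
Qed.

Lemma phase_continuous (xi : 'rV[R]_N) (a : R) :
  continuous (fun x => dotv xi x + a).
Proof. by apply: contD; [exact: dotvl_continuous|exact: cont_cst]. Qed.

Lemma Cb_cos_phase (xi : 'rV[R]_N) (a : R) : Cb (fun x => cos (dotv xi x + a)).
Proof. exact/Cb_cos/phase_continuous. Qed.

End Cb_theory.

(* Iterating q |-> q + (u^2 - q^2) / 2 approximates |u| by polynomials in u,
   uniformly on [-1, 1]. *)
Fixpoint abs_approx (R : realType) (k : nat) (u : R) : R :=
  if k is k'.+1 then
    let q := abs_approx k' u in q + 2^-1 * (u * u - q * q)
  else 0.

(** With e = |u| - q, one iteration multiplies e by 1 - (|u| + q) / 2, which is at most 1 - e / 2
    because q is non-negative. The bound e <= 2 / K then propagates to 2 / (K + 1), since e (1 - e /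
    2) increases on [0, 1]. *)
Lemma abs_approxP (R : realType) (k : nat) (u : R) : `|u| <= 1 ->
  0 <= `|u| - abs_approx k u <= 2 / k.+2%:R /\ 0 <= abs_approx k u.
Proof.
move=> u1; elim: k => [|k [/andP[e0 e1] q0]] /=.
  by rewrite subr0 normr_ge0 lexx divff// u1.
set q := abs_approx k u in e0 e1 q0 *.
have -> : u * u = `|u| * `|u| by rewrite -!expr2 -normrX ger0_norm// sqr_ge0.
move: u1 e0 e1 q0; have := normr_ge0 u; move: `|u| q => v q v0 v1 e0 e1 q0.
have k2 : 0 < (k.+2%:R : R) by [].
have k3 : 0 < (k.+3%:R : R) by [].
have eqk : (k.+3%:R : R) = k.+2%:R + 1 by rewrite -natr1.
have k21 : 1 <= (k.+2%:R : R) by rewrite ler1n.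
move: k2 k3 e1; rewrite eqk; move: (k.+2%:R : R) k21 => K K1 K0 K2 e1.
split; last by nra.
have h : v - q <= 1 by lra.
have e1K : (v - q) * K <= 2 by rewrite -ler_pdivlMr.
have -> : v - (q + 2^-1 * (v * v - q * q)) = (v - q) * (1 - (v + q) / 2).
  by field.
apply/andP; split; first by apply: mulr_ge0 => //; lra.
apply: (@le_trans _ _ ((v - q) * (1 - (v - q) / 2))).
  by apply: ler_wpM2l => //; lra.
rewrite ler_pdivlMr//.
move: h e0 e1K; move: (v - q) => e h e0 e1K.
nra.
Qed.

(** * Levy's continuity theorem *)

Section levy.
Context (R : realType) (N : nat).
Local Notation V := 'rV[R]_N.
Variables (gam : probability V R) (p_ : nat -> probability V R)
  (p : probability V R).
Hypothesis gam_cos : forall xi : V,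
  \int[gam]_z cos (dotv xi z) = expR (- (dotv xi xi / 2)).
Hypothesis p_cos : forall xi : V,
  \int[p_ n]_x cos (dotv xi x) @[n --> \oo] --> \int[p]_x cos (dotv xi x).
Hypothesis p_sin : forall xi : V,
  \int[p_ n]_x sin (dotv xi x) @[n --> \oo] --> \int[p]_x sin (dotv xi x).

(** Quantifying over all frequencies and phases makes the class stable under multiplication by a
    cosine, because a product of two cosines is a sum of cosines. This is what lets Gaussian bumps
    act as multipliers. *)
Let phase_class (h : V -> R) := Cb h /\ forall (xi : V) (a : R),
  \int[p_ n]_x (h x * cos (dotv xi x + a)) @[n --> \oo] -->
  \int[p]_x (h x * cos (dotv xi x + a)).

(* The multipliers of the class of functions whose integrals converge form a
   uniformly closed algebra; it contains the Gaussian bumps, which are mixtures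
   of cosines, hence maxima of such bumps, which approximate any continuous
   function from below. *)
Let multiplier (h : V -> R) := Cb h /\
  forall g, phase_class g -> phase_class (fun x => h x * g x).

Let phase1 : phase_class (fun=> 1).
Proof.
split; first exact: Cb_cst.
move=> xi a.
have E (q : probability V R) : \int[q]_x (1 * cos (dotv xi x + a)) =
    cos a * \int[q]_x cos (dotv xi x) - sin a * \int[q]_x sin (dotv xi x).
  have cc : Cb (fun x : V => cos (dotv xi x)).
    exact/Cb_cos/dotvl_continuous.
  have cs : Cb (fun x : V => sin (dotv xi x)).
    exact/Cb_sin/dotvl_continuous.
  rewrite -!RintegralZl//; [|exact: Cb_integrable..].
  rewrite -RintegralB//; [|exact/Cb_integrable/CbZ..].
  by apply: eq_Rintegral => x _; rewrite mul1r cosD; ring.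
under eq_fun do rewrite E.
rewrite E; apply: cvgB; apply: cvgM; try exact: cvg_cst.
  exact: p_cos.
exact: p_sin.
Qed.

Let phase_Cb (h : V -> R) xi a : Cb h -> Cb (fun x => h x * cos (dotv xi x + a)).
Proof. by move=> ch; apply: CbM => //; exact: Cb_cos_phase. Qed.

Let phase_lin (g h : V -> R) (a b : R) : phase_class g -> phase_class h ->
  phase_class (fun x => a * g x + b * h x).
Proof.
move=> [cg Hg] [ch Hh]; split; first by apply: CbD; exact: CbZ.
move=> xi c.
have E (q : probability V R) :
    \int[q]_x ((a * g x + b * h x) * cos (dotv xi x + c)) =
    a * \int[q]_x (g x * cos (dotv xi x + c)) +
    b * \int[q]_x (h x * cos (dotv xi x + c)).
  rewrite -!RintegralZl//; [|exact/Cb_integrable/phase_Cb..].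
  rewrite -RintegralD//; [|exact/Cb_integrable/CbZ/phase_Cb..].
  by apply: eq_Rintegral => x _; ring.
under eq_fun do rewrite E.
by rewrite E; apply: cvgD; apply: cvgM; try exact: cvg_cst; [exact: Hg|exact: Hh].
Qed.

Let phase_unif (h : V -> R) : Cb h ->
  (forall e, 0 < e -> exists2 g, phase_class g & forall x, `|h x - g x| <= e) ->
  phase_class h.
Proof.
move=> ch H; split => // xi a; apply/cvgrPdist_le => e e0.
have e3 : 0 < e / 3 by lra.
have [g [cg Hg] hg] := H _ e3.
have D (q : probability V R) : `|\int[q]_x (h x * cos (dotv xi x + a)) -
    \int[q]_x (g x * cos (dotv xi x + a))| <= e / 3.
  rewrite -RintegralB//; [|exact/Cb_integrable/phase_Cb..].
  apply: prob_norm_le.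
    by apply: Cb_measurable; apply: CbB; exact: phase_Cb.
  move=> x; rewrite -mulrBl normrM -[leRHS]mulr1 ler_pM//.
  by rewrite ler_norml cos_geN1 cos_le1.
have := Hg xi a => /cvgrPdist_le/(_ _ e3); apply: filterS => n hn.
have := D p; have := D (p_ n); move: hn; rewrite !ler_norml; lra.
Qed.

Let multiplier_phase h : multiplier h -> phase_class h.
Proof.
by move=> [_ /(_ _ phase1)]; under eq_fun do rewrite mulr1.
Qed.

Let multiplier_cst a : multiplier (fun=> a).
Proof.
split; first exact: Cb_cst.
move=> g Hg; have := phase_lin a 0 Hg phase1.
by under eq_fun do rewrite mul0r addr0.
Qed.

Let multiplierM g h : multiplier g -> multiplier h ->
  multiplier (fun x => g x * h x).
Proof.
move=> [cg Hg] [ch Hh]; split; first exact: CbM.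
move=> f Hf; have := Hg _ (Hh _ Hf).
by under eq_fun do rewrite mulrA.
Qed.

Let multiplier_lin g h a b : multiplier g -> multiplier h ->
  multiplier (fun x => a * g x + b * h x).
Proof.
move=> [cg Hg] [ch Hh]; split; first by apply: CbD; exact: CbZ.
move=> f Hf; have := phase_lin a b (Hg _ Hf) (Hh _ Hf).
by under eq_fun do rewrite !mulrA -mulrDl.
Qed.

Let multiplier_unif (h : V -> R) : Cb h ->
  (forall e, 0 < e -> exists2 g, multiplier g & forall x, `|h x - g x| <= e) ->
  multiplier h.
Proof.
move=> ch H; split => // f Hf; have [cf _] := Hf.
have /CbP[_ [M fM]] := cf.
have M0 : 0 <= M by apply: le_trans (fM 0).
apply: phase_unif; first exact: CbM.
move=> e e0; have M1 : 0 < M + 1 by lra.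
have [g [cg Hg] hg] := H _ (divr_gt0 e0 M1).
exists (fun x => g x * f x); first exact: Hg.
move=> x; rewrite -mulrBl normrM.
rewrite (@le_trans _ _ (e / (M + 1) * (M + 1)))//; last by rewrite divfK// gt_eqF.
by apply: ler_pM => //; rewrite (le_trans (fM x))// lerDl.
Qed.

Let gauss_bump s (y x : V) : R := expR (- (s ^+ 2 * dotv (x - y) (x - y) / 2)).

Let Cb_gauss s y : Cb (gauss_bump s y).
Proof.
apply: (@Cb_bound _ _ _ 1).
  apply: cont_expR; apply: contN.
  apply: contM; last exact: cont_cst.
  apply: contM; first exact: cont_cst.
  exact: dotv_sub_continuous.
move=> x; rewrite ger0_norm ?expR_ge0// -expR0 ler_expR oppr_le0.
by rewrite mulr_ge0// mulr_ge0 ?sqr_ge0 ?dotv_ge0.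
Qed.

(** The bump is the characteristic function of [gam] at s (x - y), that is, the average of cos (s (x
    - y) z) over z. By Fubini and the product formula for cosines, the integral to be studied is an
    average over z of integrals covered by the hypothesis on g; dominated convergence in z, with the
    bound M of g, passes to the limit. *)
Let multiplier_gauss s y : multiplier (gauss_bump s y).
Proof.
split => // g [cg Hg]; split; first exact: CbM.
move=> xi a; have /CbP[_ [M gM]] := cg.
have ms (q : probability V R) : \int[q]_x (gauss_bump s y x * g x * cos (dotv xi x + a))
    = \int[gam]_z (2^-1 *
     (\int[q]_x (g x * cos (dotv (xi + s *: z) x + (a - s * dotv y z))) +
      \int[q]_x (g x * cos (dotv (xi - s *: z) x + (a + s * dotv y z))))).
  pose F (xz : V * V) := cos (s * dotv (xz.1 - y) xz.2) *
     (g xz.1 * cos (dotv xi xz.1 + a)).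
  have m1 : measurable_fun setT (fun xz : V * V => xz.1) by exact: measurable_fst.
  have m2 : measurable_fun setT (fun xz : V * V => xz.2) by exact: measurable_snd.
  have mx : measurable_fun setT (fun xz : V * V => xz.1 - y).
    apply: measurable_rV => i; under eq_fun do rewrite !mxE.
    apply: measurable_funB => //.
    exact: (measurableT_comp (measurable_coord i)).
  have mF : measurable_fun setT F.
    apply: measurable_funM.
      apply: (measurable_cont_comp (@continuous_cos _)).
      by apply: measurable_funM => //; exact: measurable_dotv.
    apply: (@measurableT_comp _ _ _ _ _ _ (fun x => g x * cos (dotv xi x + a))
        _ fst) => //.
    by apply: Cb_measurable; exact: phase_Cb.
  have FM xz : `|F xz| <= M.
    rewrite /F normrM -[leRHS]mul1r ler_pM//.
      by rewrite ler_norml cos_geN1 cos_le1.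
    rewrite normrM -[leRHS]mulr1 ler_pM//.
    by rewrite ler_norml cos_geN1 cos_le1.
  transitivity (\int[q]_x \int[gam]_z F (x, z)).
    apply: eq_Rintegral => x _; rewrite /F/=.
    rewrite RintegralZr//; last first.
      apply/Cb_integrable/Cb_cos.
      by apply: contM; [exact: cont_cst|exact: dotvl_continuous].
    rewrite -mulrA; congr (_ * _).
    under eq_Rintegral do rewrite -dotvZl.
    by rewrite gam_cos dotvZl dotvZr mulrA -expr2.
  rewrite (bounded_Fubini _ _ mF FM); apply: eq_Rintegral => z _.
  rewrite /F/= -RintegralD//; [|exact/Cb_integrable/phase_Cb..].
  rewrite -RintegralZl//; last by apply/Cb_integrable/CbD; exact: phase_Cb.
  apply: eq_Rintegral => x _.
  have -> : dotv (xi + s *: z) x + (a - s * dotv y z) =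
    (dotv xi x + a) + s * dotv (x - y) z.
    by rewrite !dotvDl dotvNl dotvZl (dotvC z); ring.
  have -> : dotv (xi - s *: z) x + (a + s * dotv y z) =
    (dotv xi x + a) - s * dotv (x - y) z.
    by rewrite !dotvDl !dotvNl dotvZl (dotvC z); ring.
  by move: (dotv xi x + a) => A; rewrite cosB cosD; field.
rewrite ms; under eq_fun do rewrite ms.
have M0 : 0 <= M by apply: le_trans (gM 0).
have qM (q : probability V R) xi' a' : `|\int[q]_x (g x * cos (dotv xi' x + a'))| <= M.
  apply: prob_norm_le; first by apply: Cb_measurable; exact: phase_Cb.
  move=> x; rewrite normrM -[leRHS]mulr1 ler_pM//.
  by rewrite ler_norml cos_geN1 cos_le1.
have mq (q : probability V R) (f1 : V -> V) (f2 : V -> R) :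
    (forall i, measurable_fun setT (fun z => f1 z ord0 i)) ->
    measurable_fun setT f2 ->
    measurable_fun setT (fun z => \int[q]_x (g x * cos (dotv (f1 z) x + f2 z))).
  move=> mf1 mf2.
  have := @bounded_fubini_measurable1 _ _ _ _ _ gam q
    (fun zx => g zx.2 * cos (dotv (f1 zx.1) zx.2 + f2 zx.1)) M.
  apply; last first.
    move=> x; rewrite normrM -[leRHS]mulr1 ler_pM//.
    by rewrite ler_norml cos_geN1 cos_le1.
  apply: measurable_funM.
    exact: (measurableT_comp (Cb_measurable cg)).
  apply: (measurable_cont_comp (@continuous_cos _)).
  apply: measurable_funD; last exact: (measurableT_comp mf2).
  apply: measurable_dotv => //.
  by apply: measurable_rV => i; exact: (measurableT_comp (mf1 i)).
have msz : measurable_fun setT (fun z : V => s * dotv y z).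
  apply: measurable_funM => //; apply: measurable_dotv => //.
apply: (@Rintegral_dominated_cvg _ _ _ gam setT _ _ (fun=> M)) => //.
- move=> n; apply: measurable_funM => //; apply: measurable_funD; apply: mq.
  + move=> i; under eq_fun do rewrite !mxE; apply: measurable_funD => //.
    by apply: measurable_funM => //; exact: measurable_coord.
  + exact: measurable_funB.
  + move=> i; under eq_fun do rewrite !mxE; apply: measurable_funB => //.
    by apply: measurable_funM => //; exact: measurable_coord.
  + exact: measurable_funD.
- move=> z _; apply: cvgM; first exact: cvg_cst.
  by apply: cvgD; exact: Hg.
- apply: (@Cb_integrable _ _ gam (fun=> M)); exact: Cb_cst.
- move=> n z _; rewrite normrM ger0_norm ?invr_ge0//.
  rewrite ler_pdivrMl// (le_trans (ler_normD _ _))//.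
  have := qM (p_ n) (xi + s *: z) (a - s * dotv y z).
  have := qM (p_ n) (xi - s *: z) (a + s * dotv y z).
  lra.
Qed.

(** Division by B + 1 brings h into [-1, 1], where the polynomials [abs_approx k] tend uniformly to
    the absolute value. A polynomial in a multiplier is a multiplier, and so is a uniform limit. *)
Let multiplier_norm h : multiplier h -> multiplier (fun x => `|h x|).
Proof.
move=> Hh; have [ch _] := Hh; have /CbP[_ [B hB]] := ch.
have B0 : 0 <= B by apply: le_trans (hB 0).
have B1 : 0 < B + 1 by lra.
pose u x := (B + 1)^-1 * h x.
have Hu : multiplier u.
  have := multiplier_lin (B + 1)^-1 0 Hh Hh.
  by under eq_fun do rewrite mul0r addr0.
have u1 x : `|u x| <= 1.
  have i0 : 0 <= (B + 1)^-1 by rewrite invr_ge0 ltW.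
  rewrite /u normrM (ger0_norm i0) ler_pdivrMl// mulr1.
  by rewrite (le_trans (hB x))// lerDl.
have Hq k : multiplier (fun x => abs_approx k (u x)).
  elim: k => [|k ih] /=; first exact: multiplier_cst.
  have := multiplier_lin 1 1 ih
    (multiplier_lin 2^-1 (- 2^-1) (multiplierM Hu Hu) (multiplierM ih ih)).
  by under eq_fun do rewrite !mul1r mulNr -mulrBr.
apply: multiplier_unif; first exact: Cb_norm.
move=> e e0.
have [k ke] : exists k : nat, (B + 1) * (2 / k.+2%:R) <= e.
  have [k hk] : exists k : nat, (B + 1) * 2 / e < k%:R.
    exists (Num.trunc ((B + 1) * 2 / e)).+1; exact: truncnS_gt.
  exists k; rewrite mulrA ler_pdivrMr//.
  move: hk; rewrite ltr_pdivrMr// => /ltW hk; rewrite (le_trans hk)//.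
  by rewrite mulrC ler_pM2l// ler_nat !leqW.
exists (fun x => (B + 1) * abs_approx k (u x)).
  have := multiplier_lin (B + 1) 0 (Hq k) (Hq k).
  by under eq_fun do rewrite mul0r addr0.
move=> x; have [/andP[a b] _] := abs_approxP k (u1 x).
have -> : h x = (B + 1) * u x by rewrite /u mulrA divff ?mul1r// gt_eqF.
rewrite normrM (ger0_norm (ltW B1)) -mulrBr normrM (ger0_norm (ltW B1)).
rewrite ger0_norm// (le_trans _ ke)// ler_pM2l//.
Qed.

Let multiplier_max g h : multiplier g -> multiplier h ->
  multiplier (fun x => Num.max (g x) (h x)).
Proof.
move=> Hg Hh.
have Hd : multiplier (fun x => g x - h x).
  by have := multiplier_lin 1 (-1) Hg Hh; under eq_fun do rewrite mul1r mulN1r.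
have := multiplier_lin 2^-1 2^-1 (multiplier_lin 1 1 Hg Hh) (multiplier_norm Hd).
rewrite (_ : (fun x => _ + _) = (fun x => Num.max (g x) (h x)))//.
apply/funext => x; rewrite !mul1r.
by have [gh|gh] := leP (g x) (h x); [rewrite ler0_norm|rewrite gtr0_norm]; lra.
Qed.

Let code := (('rV[rat]_N * nat) * rat)%type.

(** Rational data keep the family countable. The floor 1/2 leaves room below a function f >= 1: the
    tail of a bump may be as large as 1/2 away from its centre. A code whose bump crosses f is sent
    to the floor, so every code gives a minorant. *)
Let minorant (f : V -> R) (c : code) : V -> R :=
  let g := fun x => 2^-1 + ratr c.2 * gauss_bump c.1.2%:R (map_mx ratr c.1.1) x in
  if `[< forall x, g x <= f x >] then g else (fun=> 2^-1).

Let multiplier_minorant f c : multiplier (minorant f c).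
Proof.
rewrite /minorant; case: ifP => _; last exact: multiplier_cst.
have := multiplier_lin 1 (ratr c.2) (multiplier_cst 2^-1)
  (multiplier_gauss c.1.2%:R (map_mx ratr c.1.1)).
by under eq_fun do rewrite mul1r.
Qed.

Let minorant_le (f : V -> R) c (x : V) : (forall x, 1 <= f x) -> minorant f c x <= f x.
Proof.
move=> f1; rewrite /minorant; case: ifPn => [/asboolP h|_]; first exact: h.
by rewrite (le_trans _ (f1 x))// invf_le1// ler1n.
Qed.

Let minorant_sup (f : V -> R) (x : V) (e : R) : (forall x, 1 <= f x) -> continuous f -> 0 < e ->
  exists c, f x - e < minorant f c x.
Proof.
move=> f1 cf e0.
(* The cap 1/2 keeps the height A positive: A > f x - 1/2 - e'/2 >= 1/4. *)
pose e' := Num.min e 2^-1.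
have e'0 : 0 < e' by rewrite lt_min e0 invr_gt0 ltr0n.
have e'e : e' <= e by rewrite ge_min lexx.
have e'2 : e' <= 2^-1 by rewrite ge_min lexx orbT.
have fx1 := f1 x.
have /rat_in_itvoo[a] : f x - 2^-1 - e' / 2 < f x - 2^-1 by lra.
rewrite in_itv/= => /andP[a1 a2].
set A : R := ratr a in a1 a2.
have A0 : 0 < A by lra.
have [r r0 fr] : exists2 r, 0 < r & forall w, ball x r w -> 2^-1 + A < f w.
  have : \forall w \near x, 2^-1 + A < f w.
    have := cf x; move/cvgrPdist_lt => /(_ (f x - (2^-1 + A))).
    have h : 0 < f x - (2^-1 + A) by lra.
    by move=> /(_ h); apply: filterS => w; rewrite ltr_norml; lra.
  by move/nbhs_ballP => [r /= r0 h]; exists r.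
(* Outside the ball of radius r some coordinate of w - y is at least r / 2, so the exponent v is at
   least k^2 r^2 / 8 >= k r^2 / 8 > 2 A. Then exp v >= 1 + v bounds the tail A exp (- v) by 1/2. *)
have [k k1 kr] : exists2 k : nat, (1 <= k)%N & 16 * A / r ^+ 2 < k%:R.
  exists (Num.trunc (16 * A / r ^+ 2)).+1 => //; exact: truncnS_gt.
(* Moving the centre from x to a rational point y within [dl] per coordinate costs at most B dl / 2
   <= e' / 2 in the value at x; [dl <= 1] is used to bound the squared differences by [dl]. *)
pose B : R := k%:R ^+ 2 * N%:R * A.
have B0 : 0 <= B by rewrite /B mulr_ge0 ?(ltW A0)// mulr_ge0 ?sqr_ge0.
pose dl := Num.min (r / 2) (Num.min 1 (e' / (B + 1))).
have B1 : 0 < B + 1 by lra.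
have dl0 : 0 < dl by rewrite !lt_min ltr01 !divr_gt0.
have dlr : dl <= r / 2 by rewrite ge_min lexx.
have dl1 : dl <= 1 by rewrite !ge_min lexx !orbT.
have dle : dl <= e' / (B + 1) by rewrite !ge_min lexx !orbT.
have [q xq] := ratr_rV_dense x dl0.
exists ((q, k), a); rewrite /minorant/= -/A.
set y : V := map_mx ratr q.
have yE i : y ord0 i = ratr (q ord0 i) by rewrite mxE.
rewrite asboolT.
  rewrite /gauss_bump.
  have d2 : dotv (x - y) (x - y) <= N%:R * dl.
    rewrite /dotv (@le_trans _ _ (\sum_(i < N) dl))//; last first.
      by rewrite sumr_const card_ord -[leLHS]mulr_natl.
    apply: ler_sum => i _; rewrite !mxE -expr2 -real_normK ?num_real//.
    by have := xq i; have := normr_ge0 (x ord0 i - ratr (q ord0 i)); nra.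
  set v := _ / 2.
  have vB : A * v <= e' / 2.
    have h : k%:R ^+ 2 * dotv (x - y) (x - y) <= k%:R ^+ 2 * (N%:R * dl).
      by rewrite ler_wpM2l ?sqr_ge0.
    rewrite /v mulrA ler_pM2r ?invr_gt0// (le_trans (ler_wpM2l (ltW A0) h))//.
    have -> : A * (k%:R ^+ 2 * (N%:R * dl)) = B * dl by rewrite /B; ring.
    rewrite (@le_trans _ _ ((B + 1) * dl))//; first by nra.
    by rewrite mulrC -ler_pdivlMr.
  have := expR_ge1Dx (- v) => hv.
  have : A * (1 - v) <= A * expR (- v) by rewrite ler_pM2l.
  by move: vB a1 e'e; lra.
move=> w; have [xw|xw] := pselect (ball x r w).
  rewrite (le_trans _ (ltW (fr _ xw)))// lerD2l -[leRHS]mulr1 ler_pM2l//.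
  rewrite -expR0 ler_expR oppr_le0.
  by rewrite mulr_ge0// mulr_ge0 ?sqr_ge0 ?dotv_ge0.
have [i wi] : exists i, r <= `|x ord0 i - w ord0 i|.
  apply: contrapT => h; apply: xw; apply/ball_rVP => // i.
  by rewrite ltNge; apply/negP => hi; apply: h; exists i.
rewrite (le_trans _ (f1 w))//.
suff : A * gauss_bump k%:R y w <= 2^-1 by lra.
rewrite /gauss_bump expRN ler_pdivrMr ?expR_gt0//.
set v := _ / 2.
have vA : 2 * A <= v.
  have wy : r / 2 <= `|(w - y) ord0 i|.
    have := xq i; rewrite -yE => xyi; have -> : (w - y) ord0 i = w ord0 i - y ord0 i by rewrite !mxE.
    have : `|x ord0 i - w ord0 i| <= `|x ord0 i - y ord0 i| + `|w ord0 i - y ord0 i|.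
      by rewrite (distrC (w ord0 i)) -[in leLHS](subrK (y ord0 i) (x ord0 i))
        -addrA ler_normD.
    by move: xyi wi dlr; lra.
  have h1 : (r / 2) ^+ 2 <= dotv (w - y) (w - y).
    rewrite (le_trans _ (dotv_ge_coord _ i))//.
    rewrite -[leRHS]real_normK ?num_real//.
    by apply: ler_pM => //; rewrite divr_ge0// ltW.
  have h2 : 16 * A < k%:R * r ^+ 2 by rewrite -ltr_pdivrMr// exprn_gt0.
  have h3 : (k%:R : R) <= k%:R ^+ 2.
    by rewrite expr2 -[leLHS]mulr1 ler_wpM2l// ler1n.
  have h4 : k%:R ^+ 2 * (r / 2) ^+ 2 <= k%:R ^+ 2 * dotv (w - y) (w - y).
    by apply: ler_wpM2l => //; exact: sqr_ge0.
  have h5 : k%:R * r ^+ 2 <= k%:R ^+ 2 * r ^+ 2 by apply: ler_wpM2r => //; exact: sqr_ge0.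
  have h6 : k%:R ^+ 2 * (r / 2) ^+ 2 = (k%:R ^+ 2 * r ^+ 2) / 4 by field.
  by rewrite /v; lra.
by have := expR_ge1Dx v; lra.
Qed.

Let multiplier_cvg h : multiplier h ->
  \int[p_ n]_x h x @[n --> \oo] --> \int[p]_x h x.
Proof.
move=> /multiplier_phase[_ /(_ 0 0)].
have E x : cos (dotv (0 : V) x + 0) = 1.
  by rewrite addr0 /dotv big1 ?cos0// => i _; rewrite mxE mul0r.
under eq_Rintegral do rewrite E mulr1.
by under eq_fun => n do under eq_Rintegral do rewrite E mulr1.
Qed.

(** The running maximum [G k] of the first k minorants is a multiplier, stays between 0 and f, and
    increases to f pointwise. One fixed k therefore recovers the integral of f under p up to e / 2,
    and for that k the integrals under [p_ n] converge. *)
Let liminf_ge (f : V -> R) (e : R) : Cb f -> (forall x, 1 <= f x) -> 0 < e ->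
  \forall n \near \oo, \int[p]_x f x - e < \int[p_ n]_x f x.
Proof.
move=> cf f1 e0; have /CbP[cf' [M fM]] := cf.
pose g j := if unpickle j is Some c then minorant f c else (fun=> 2^-1).
pose G := fix G k := if k is k'.+1 then
  (fun x => Num.max (G k' x) (g k' x)) else (fun=> 2^-1).
have Hg j : multiplier (g j).
  by rewrite /g; case: unpickle => [c|]; [exact: multiplier_minorant|exact: multiplier_cst].
have gf j x : g j x <= f x.
  rewrite /g; case: unpickle => [c|]; first exact: minorant_le.
  by rewrite (le_trans _ (f1 x))// invf_le1// ler1n.
have HG k : multiplier (G k).
  by elim: k => [|k ih] /=; [exact: multiplier_cst|exact: multiplier_max].
have Gf k x : G k x <= f x.
  elim: k => [|k ih] /=; last by rewrite ge_max ih gf.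
  by rewrite (le_trans _ (f1 x))// invf_le1// ler1n.
have G0 k x : 0 <= G k x.
  by elim: k => [|k ih] /=; [rewrite invr_ge0|rewrite le_max ih].
have Gg k j x : (j < k)%N -> g j x <= G k x.
  elim: k => // k ih; rewrite ltnS leq_eqVlt => /predU1P[->|/ih jk] /=.
    by rewrite le_max lexx orbT.
  by rewrite le_max jk.
have Gcvg x : G n x @[n --> \oo] --> f x.
  apply/cvgrPdist_le => d d0.
  have [c fc] := minorant_sup x f1 cf' d0.
  exists (pickle c).+1 => // n /= cn.
  have := Gg n (pickle c) x cn; rewrite /g pickleK.
  by rewrite ger0_norm ?subr_ge0//; lra.
have e2 : 0 < e / 2 by lra.
have icvg : \int[p]_x G n x @[n --> \oo] --> \int[p]_x f x.
  apply: (@Rintegral_dominated_cvg _ _ _ p setT G f f) => //.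
  - by move=> n; apply: Cb_measurable; case: (HG n).
  - exact: Cb_integrable.
  - by move=> n x _; rewrite ger0_norm.
have [k hk] : exists k, `|\int[p]_x f x - \int[p]_x G k x| < e / 2.
  by have /cvgrPdist_lt/(_ _ e2)[k _ /(_ k (leqnn k))] := icvg; exists k.
have := multiplier_cvg (HG k) => /cvgrPdist_lt/(_ _ e2); apply: filterS => n.
have : \int[p_ n]_x G k x <= \int[p_ n]_x f x.
  by apply: le_Rintegral => //; apply: Cb_integrable => //; case: (HG k).
by move: hk; rewrite !ltr_norml; lra.
Qed.

(** The lower bound is applied to M + 1 + f and to M + 1 - f, both at least 1. As all measures have
    mass 1, the second one is an upper bound for the integral of f. *)
Theorem levy_continuity f : Cb f ->
  \int[p_ n]_x f x @[n --> \oo] --> \int[p]_x f x.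
Proof.
move=> cf; have /CbP[_ [M fM]] := cf.
apply/cvgrPdist_lt => e e0.
have c1 : Cb (fun x => (M + 1) + f x) by apply: CbD => //; exact: Cb_cst.
have c2 : Cb (fun x => (M + 1) - f x) by apply: CbB => //; exact: Cb_cst.
have h1 : forall x, 1 <= (M + 1) + f x by move=> x; have := fM x; rewrite ler_norml; lra.
have h2 : forall x, 1 <= (M + 1) - f x by move=> x; have := fM x; rewrite ler_norml; lra.
have D1 (q : probability V R) : \int[q]_x ((M + 1) + f x) = (M + 1) + \int[q]_x f x.
  by rewrite RintegralD//; [rewrite Rintegral_pcst|apply: Cb_integrable; exact: Cb_cst|exact: Cb_integrable].
have D2 (q : probability V R) : \int[q]_x ((M + 1) - f x) = (M + 1) - \int[q]_x f x.
  by rewrite RintegralB//; [rewrite Rintegral_pcst|apply: Cb_integrable; exact: Cb_cst|exact: Cb_integrable].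
near=> n.
have : \int[p]_x ((M + 1) + f x) - e < \int[p_ n]_x ((M + 1) + f x).
  by near: n; exact: liminf_ge.
have : \int[p]_x ((M + 1) - f x) - e < \int[p_ n]_x ((M + 1) - f x).
  by near: n; exact: liminf_ge.
by rewrite !D1 !D2 ltr_norml; lra.
Unshelve. all: by end_near. Qed.

End levy.

(** * Bounded continuous functions determine a Borel probability measure *)

Section narrow_unique.
Context (R : realType) (N : nat).
Local Notation V := 'rV[R]_N.

Let pospart (t : R) : R := (t + `|t|) / 2.

Let pospart_ge0 t : 0 <= pospart t.
Proof. by have := ler_norm (- t); rewrite normrN /pospart; lra. Qed.

(** A continuous function that is positive exactly on the j-th rational ball when this ball lies in
    O, and zero otherwise. The tents together are positive exactly on O. *)
Let tent (O : set V) (j : nat) : V -> R :=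
  if unpickle j is Some q then
    if `[< rat_ball q `<=` O >] then
      fun x => pospart (q.2.+1%:R^-1 - `|x - map_mx ratr q.1|)
    else (fun=> 0)
  else (fun=> 0).

Let tent_ge0 O j x : 0 <= tent O j x.
Proof.
rewrite /tent; case: unpickle => // -[q k]; by case: ifP.
Qed.

Let tent_continuous O j : continuous (tent O j).
Proof.
rewrite /tent; case: unpickle => [[q k]|]; last exact: cont_cst.
case: ifP => _ /=; last exact: cont_cst.
have h : continuous (fun x : V => k.+1%:R^-1 - `|x - map_mx ratr q|).
  apply: contB; first exact: cont_cst.
  have cB : continuous (fun x : V => x - map_mx ratr q).
    by move=> x; apply: (@continuousB _ _ _ id (cst _)); [exact: cvg_id|exact: cst_continuous].
  by move=> x; apply: (continuous_comp (cB x)); exact: norm_continuous.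
rewrite /pospart; apply: contM; last exact: cont_cst.
by apply: contD => //; exact: cont_norm.
Qed.

Let tent_out O j x : ~ O x -> tent O j x = 0.
Proof.
move=> Ox; rewrite /tent; case: unpickle => // -[q k].
case: ifPn => // /asboolP qO /=.
have : ~ rat_ball (q, k) x by move=> h; exact: (Ox (qO _ h)).
rewrite /rat_ball mx_norm_ball /ball_/= => /negP.
rewrite -leNgt distrC => h.
by rewrite /pospart ler0_norm ?subrr ?mul0r// subr_le0.
Qed.

Let tent_in O x : open O -> O x -> exists j, 0 < tent O j x.
Proof.
move=> oO Ox; have := Ox; rewrite {1}(open_rat_ball oO) => -[[q k] qO qx].
exists (pickle (q, k)); rewrite /tent pickleK asboolT//=.
move: qx; rewrite /rat_ball mx_norm_ball /ball_/= distrC => h.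
by move: h; rewrite -subr_gt0 /pospart; move: (_ - `|_|) => t h; rewrite gtr0_norm//; lra.
Qed.

(** The indicator of an open set is a bounded pointwise limit of continuous functions, so p and q
    agree on open sets, which are stable under intersection and generate the sigma-algebra. *)
Lemma prob_eq_Cb (p q : probability V R) :
  (forall f : V -> R, Cb f -> \int[p]_x f x = \int[q]_x f x) -> p ≡μ q.
Proof.
move=> pq A mA.
have openE (O : set V) : open O -> p O = q O.
  move=> oO; have mO := measurable_open_rV oO.
  pose S k x := \sum_(j < k) tent O j x.
  have S0 k x : 0 <= S k x by apply: sumr_ge0.
  have cS k : continuous (S k) by apply: cont_sum.
  (* This form lies in [0, 1] without any normalization of the sum of tents, vanishes off O, and
     tends to 1 as soon as a single tent is positive at x. *)
  pose G k x := 1 - expR (- (k%:R * S k x)).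
  have e1 k x : expR (- (k%:R * S k x)) <= 1.
    by rewrite -expR0 ler_expR oppr_le0 mulr_ge0.
  have G1 k x : `|G k x| <= 1.
    by rewrite ger0_norm ?subr_ge0// lerBlDr lerDl expR_ge0.
  have cG k : Cb (G k).
    apply: (@Cb_bound _ _ _ 1) => //; apply: contB; first exact: cont_cst.
    by apply: cont_expR; apply: contN; apply: contM => //; exact: cont_cst.
  have Gcvg x : G n x @[n --> \oo] --> (\1_O x : R).
    rewrite indicE; have [Ox|Ox] := pselect (O x); last first.
      rewrite memNset//; apply: cvg_near_cst; apply: nearW => n.
      by rewrite /G /S big1 ?mulr0 ?oppr0 ?expR0 ?subrr// => j _; exact: tent_out.
    rewrite mem_set//.
    have [j jx] := tent_in oO Ox; set t := tent _ _ _ in jx.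
    apply/cvgrPdist_le => e e0.
    near=> n; rewrite /G opprB addrC subrK ger0_norm ?expR_ge0//.
    have nt : n%:R * t <= n%:R * S n x.
      rewrite ler_wpM2l// /S.
      have jn : (j < n)%N by near: n; exact: nbhs_infty_gt.
      rewrite (bigD1 (Ordinal jn))//= lerDl.
      by apply: sumr_ge0.
    rewrite (@le_trans _ _ (expR (- (n%:R * t))))//; first by rewrite ler_expR lerN2.
    rewrite expRN -[leRHS]invrK lef_pV2 ?posrE ?expR_gt0 ?invr_gt0//.
    rewrite (le_trans _ (expR_ge1Dx _))//.
    have : e^-1 / t <= n%:R.
      by near: n; exact: nbhs_infty_ger.
    by rewrite ler_pdivrMr// => h; rewrite (le_trans h)// lerDr.
  have E (r : probability V R) : \int[r]_x G n x @[n --> \oo] --> fine (r O).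
    have -> : fine (r O) = \int[r]_x \1_O x.
      by rewrite /Rintegral integral_indic// setIT.
    apply: (@Rintegral_dominated_cvg _ _ _ r setT G _ (fun=> 1)) => //.
    - by move=> n; exact: Cb_measurable.
    - by apply: (@Cb_integrable _ _ r (fun=> 1)); exact: Cb_cst.
  have : fine (p O) = fine (q O).
    have h := E p.
    have Epq : (fun n => \int[p]_x G n x) = (fun n => \int[q]_x G n x).
      by apply/funext => n; exact: pq.
    rewrite Epq in h.
    exact: (cvg_unique _ h (E q)).
  move=> h; rewrite -(fineK (fin_num_measure p O mO)) h.
  exact: (fineK (fin_num_measure q O mO)).
apply: (measure_unique (@open V) (fun=> setT)) => //.
- by move=> B C; exact: openI.
- by move=> _; exact: openT.
- by rewrite bigcup_const//; exists 0%N.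
- by move=> _; rewrite -ge0_fin_numE ?fin_num_measure.
Unshelve. all: by end_near. Qed.

End narrow_unique.

(** * Gaussian measures *)

Section real_derivatives.
Context (R : realType).
Implicit Types (f g : R -> R) (x a b c : R).

Lemma is_der_eq f x a b : is_derive x 1 f a -> a = b -> is_derive x 1 f b.
Proof. by move=> h <-. Qed.

Lemma is_derD f g x a b : is_derive x 1 f a -> is_derive x 1 g b ->
  is_derive x 1 (fun t => f t + g t) (a + b).
Proof. by move=> h1 h2; exact: is_deriveD. Qed.

Lemma is_derN f x a : is_derive x 1 f a -> is_derive x 1 (fun t => - f t) (- a).
Proof. by move=> h1; exact: is_deriveN. Qed.

Lemma is_derB f g x a b : is_derive x 1 f a -> is_derive x 1 g b ->
  is_derive x 1 (fun t => f t - g t) (a - b).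
Proof. by move=> h1 h2; exact: is_deriveB. Qed.

Lemma is_derM f g x a b : is_derive x 1 f a -> is_derive x 1 g b ->
  is_derive x 1 (fun t => f t * g t) (a * g x + f x * b).
Proof.
move=> h1 h2; apply: (is_der_eq (is_deriveM h1 h2)).
by rewrite /GRing.scale/= addrC; ring.
Qed.

Lemma is_der_cst c x : is_derive x 1 (fun _ : R => c) 0.
Proof. exact: is_derive_cst. Qed.

Lemma is_der_id x : is_derive x 1 (fun t : R => t) 1.
Proof. exact: is_derive_id. Qed.

Lemma is_derZ f c x a : is_derive x 1 f a ->
  is_derive x 1 (fun t => c * f t) (c * a).
Proof.
move=> h; apply: (is_der_eq (is_derM (is_der_cst c x) h)); ring.
Qed.

Lemma is_der_comp f g x a b : is_derive (g x) 1 f a -> is_derive x 1 g b ->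
  is_derive x 1 (fun t => f (g t)) (a * b).
Proof. by move=> h1 h2; exact: is_derive1_comp. Qed.

Lemma is_der_expR g x b : is_derive x 1 g b ->
  is_derive x 1 (fun t => expR (g t)) (b * expR (g x)).
Proof. by move=> h; rewrite mulrC; exact: (is_der_comp (is_derive_expR _)). Qed.

Lemma is_der_cos g x b : is_derive x 1 g b ->
  is_derive x 1 (fun t => cos (g t)) (- (b * sin (g x))).
Proof.
move=> h; apply: (is_der_eq (is_der_comp (is_derive_cos _) h)); ring.
Qed.

Lemma is_der_sin g x b : is_derive x 1 g b ->
  is_derive x 1 (fun t => sin (g t)) (b * cos (g x)).
Proof.
move=> h; apply: (is_der_eq (is_der_comp (is_derive_sin _) h)); ring.
Qed.

Lemma is_der_exprn n x : is_derive x 1 (fun t : R => t ^+ n) (n%:R * x ^+ n.-1).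
Proof.
elim: n => [|n ih].
  by under eq_fun do rewrite expr0; rewrite mul0r; exact: is_der_cst.
under eq_fun do rewrite exprS.
apply: (is_der_eq (is_derM (is_der_id x) ih)).
case: n {ih} => [|n] /=; first by rewrite mul0r mulr0 addr0.
by rewrite -!natr1 !exprS; ring.
Qed.

Lemma is_der_shift f x c a : is_derive (x + c) 1 f a ->
  is_derive x 1 (fun t => f (t + c)) a.
Proof.
move=> h.
have hc := is_derD (is_der_id x) (is_der_cst c x).
have := @is_der_comp f (fun t => t + c) x a _ h hc.
by rewrite addr0 mulr1.
Qed.

Lemma is_der_cont f x a : is_derive x 1 f a -> {for x, continuous f}.
Proof.
by move=> [h _]; apply: differentiable_continuous; exact/derivable1_diffP.
Qed.

Lemma is_der_derive1 f x a : is_derive x 1 f a -> derive1 f x = a.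
Proof. by move=> [_ h]; rewrite derive1E. Qed.

Lemma is_der_FTC2 f F (a b : R) : a < b -> continuous f ->
  (forall x, is_derive x 1 F (f x)) ->
  \int[lebesgue_measure]_(x in `[a, b]) f x = F b - F a.
Proof.
move=> ab cf dF; rewrite /Rintegral (continuous_FTC2 (F := F) ab) //.
- by apply: continuous_subspaceT.
- split.
  + by move=> x _; case: (dF x).
  + by apply: cvg_at_right_filter; exact: is_der_cont (dF a).
  + by apply: cvg_at_left_filter; exact: is_der_cont (dF b).
- by move=> x _; exact: is_der_derive1.
Qed.

End real_derivatives.

(** * Stein's identity for the standard normal law *)

Section normal_stein.
Context (R : realType).
Local Notation mu := (@lebesgue_measure R).
Local Notation gauss := (normal_prob (0 : R) 1).
Local Notation npdf := (@normal_pdf R 0 1).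

(** The change of variables is known for the Radon-Nikodym derivative, which agrees almost
    everywhere with [normal_pdf] because both integrate to the normal law on every measurable
    set. *)
Lemma ge0_integral_normal (m s : R) (f : R -> \bar R) : (forall x, (0 <= f x)%E) ->
  measurable_fun setT f ->
  (\int[normal_prob m s]_x f x = \int[mu]_x (f x * (normal_pdf m s x)%:E))%E.
Proof.
move=> f0 mf.
rewrite -(Radon_Nikodym_SigmaFinite.change_of_variables
  (normal_prob_dominates m s) f0 measurableT mf).
have RNi := Radon_Nikodym_SigmaFinite.f_integrable (normal_prob_dominates m s).
have mpdf : measurable_fun setT (fun x => (normal_pdf m s x)%:E).
  by apply/measurable_EFinP; exact: measurable_normal_pdf.
apply: ae_eq_integral => //.
- by apply: emeasurable_funM => //; exact: measurable_int RNi.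
- exact: emeasurable_funM.
- apply: ae_eqe_mul2l; apply: integral_ae_eq => // A _ mA.
  by rewrite -Radon_Nikodym_SigmaFinite.f_integral//; exact: normal_prob_dominates.
Qed.

Lemma integrable_normal (m s : R) (f : R -> R) : measurable_fun setT f ->
  mu.-integrable setT (EFin \o (fun x => f x * normal_pdf m s x)) ->
  (normal_prob m s).-integrable setT (EFin \o f).
Proof.
move=> mf fi; apply/integrableP; split; first exact/measurable_EFinP.
rewrite ge0_integral_normal//; last first.
  by apply/measurable_EFinP/measurableT_comp.
case/integrableP : fi => _; apply: le_lt_trans.
rewrite le_eqVlt; apply/orP; left; apply/eqP; apply: eq_integral => x _ /=.
by rewrite -EFinM normrM (ger0_norm (normal_pdf_ge0 _ _ _)).
Qed.

Lemma Rintegral_normal (m s : R) (f : R -> R) : measurable_fun setT f ->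
  mu.-integrable setT (EFin \o (fun x => f x * normal_pdf m s x)) ->
  \int[normal_prob m s]_x f x = \int[mu]_x (f x * normal_pdf m s x).
Proof.
move=> mf fi; have nf := integrable_normal mf fi.
rewrite /Rintegral -(@Radon_Nikodym_change_of_variables _ _ _ (normal_prob m s)
  mu (normal_prob_dominates m s) (EFin \o f) setT measurableT nf); congr fine.
under [RHS]eq_integral do rewrite EFinM.
have RNi := @Radon_Nikodym_integrable _ _ _
  (charge_of_finite_measure (normal_prob m s)) mu (normal_prob_dominates m s).
have mpdf : measurable_fun setT (fun x => (normal_pdf m s x)%:E).
  by apply/measurable_EFinP; exact: measurable_normal_pdf.
apply: ae_eq_integral => //.
- apply: emeasurable_funM; first exact/measurable_EFinP.
  exact: measurable_int RNi.
- apply: emeasurable_funM => //; exact/measurable_EFinP.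
- apply: (@ae_eqe_mul2l _ _ _ mu setT _ (EFin \o normal_pdf m s) (EFin \o f)).
  apply: integral_ae_eq => // A _ mA.
  by rewrite -Radon_Nikodym_integral//; exact: normal_prob_dominates.
Qed.

Lemma npdfE (z : R) : npdf z = normal_peak 1 * expR (- (z ^+ 2 / 2)).
Proof.
by rewrite normal_pdfE ?oner_neq0// /normal_fun subr0 expr1n mulNr.
Qed.

Lemma is_der_npdf (z : R) : is_derive z 1 npdf (- z * npdf z).
Proof.
rewrite (_ : npdf = fun z => normal_peak 1 * expR (- (z ^+ 2 / 2))); last first.
  by apply/funext => t; exact: npdfE.
have h := is_derZ (normal_peak 1) (is_der_expR (is_derN
  (is_derM (is_der_exprn 2 z) (is_der_cst 2^-1 z)))).
apply: (is_der_eq h).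
by rewrite /= mulr0 addr0 expr1; field.
Qed.

(** The majorant is a multiple of the normal density of variance 2: |z| <= 1 + z^2 / 4 <= exp (z^2 /
    4), and this factor turns exp (- z^2 / 2) into exp (- z^2 / 4). *)
Lemma integrable_abs_npdf : mu.-integrable setT (EFin \o (fun z => z * npdf z)).
Proof.
pose s : R := Num.sqrt 2.
have s0 : s != 0 by rewrite sqrtr_eq0 -ltNge.
have pk := normal_peak_gt0 s0.
have i2 : mu.-integrable setT
    (EFin \o (fun z => normal_peak 1 / normal_peak s * normal_pdf 0 s z)).
  have -> : EFin \o (fun z => normal_peak 1 / normal_peak s * normal_pdf 0 s z) =
      (fun z => (normal_peak 1 / normal_peak s)%:E * (normal_pdf 0 s z)%:E)%E by [].
  apply: integrableZl => //; exact: integrable_normal_pdf.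
apply: (dominated_Rintegrable measurableT _ i2).
  by apply: measurable_funM => //; exact: measurable_normal_pdf.
move=> z _; rewrite npdfE normal_pdfE// /normal_fun subr0 mulNr.
rewrite mulrA divfK ?gt_eqF// mulrCA normrM ger0_norm ?normal_peak_ge0//.
rewrite ler_wpM2l ?normal_peak_ge0// normrM (ger0_norm (expR_ge0 _)).
have -> : s ^+ 2 *+ 2 = 4 by rewrite sqr_sqrtr// -mulrnA.
rewrite -(real_normK (num_real z)); move: (normr_ge0 z); move: `|z| => w w0.
have -> : - (w ^+ 2 / 4) = w ^+ 2 / 4 - w ^+ 2 / 2 by field.
rewrite expRD ler_pM2r ?expR_gt0// (le_trans _ (expR_ge1Dx _))//.
by have := sqr_ge0 (w / 2 - 1); rewrite sqrrB expr1n mulr1; lra.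
Qed.

Lemma integrable_normal_id : gauss.-integrable setT (EFin \o (fun z : R => z)).
Proof. by apply: integrable_normal => //; exact: integrable_abs_npdf. Qed.

Lemma cvg_Rintegral_itv (F : R -> R) : mu.-integrable setT (EFin \o F) ->
  \int[mu]_(x in `[- k.+1%:R, k.+1%:R]) F x @[k --> \oo] --> \int[mu]_x F x.
Proof.
move=> Fi; under eq_fun do rewrite Rintegral_mkcond.
have mF : measurable_fun setT F by apply/measurable_EFinP; exact: measurable_int Fi.
apply: (@Rintegral_dominated_cvg _ _ _ mu setT _ F (fun x => `|F x|)) => //.
- move=> k; apply/(measurable_restrictT _ _).1 => //.
  exact: measurable_funTS.
- move=> x _; apply: cvg_near_cst.
  near=> k; rewrite patchE mem_set//= in_itv/= -ler_norml.
  rewrite (@le_trans _ _ k%:R)//; last by rewrite ler_nat.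
  by near: k; exact: nbhs_infty_ger.
- by have := integrable_norm Fi.
- by move=> n x _; rewrite patchE; case: ifPn => //; rewrite normr0.
Unshelve. all: by end_near. Qed.

(** The density satisfies n'(z) = - z n(z), so (dh - z h) n is the derivative of h n. Its integral
    over [- (k + 1), k + 1] is a boundary term of order 1 / k. *)
Lemma normal_stein (h dh : R -> R) (M : R) :
  (forall z : R, is_derive z 1 h (dh z)) -> continuous dh ->
  (forall z, `|h z| <= M) -> (forall z, `|dh z| <= M) ->
  \int[gauss]_z (z * h z) = \int[gauss]_z dh z.
Proof.
move=> hd cdh hM dhM.
have ch : continuous h by move=> z; exact: is_der_cont (hd z).
have cn : continuous npdf by apply: continuous_normal_pdf; exact: oner_neq0.
have mn := @measurable_normal_pdf R 0 1.
have n0 := @normal_pdf_ge0 R 0 1.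
have mh := continuous_measurable_fun ch.
have mdh := continuous_measurable_fun cdh.
have M0 : 0 <= M by apply: le_trans (hM 0).
have in1 : mu.-integrable setT (EFin \o npdf) by exact: integrable_normal_pdf.
have i1 : mu.-integrable setT (EFin \o (fun z => z * h z * npdf z)).
  have iA : mu.-integrable setT (EFin \o (fun z => M * `|z * npdf z|)).
    exact: (integrableZl measurableT M (integrable_norm integrable_abs_npdf)).
  apply: (dominated_Rintegrable measurableT _ iA).
  - apply: measurable_funM => //; exact: measurable_funM.
  - move=> z _; rewrite mulrAC normrM mulrC ler_pM//.
have i2 : mu.-integrable setT (EFin \o (fun z => dh z * npdf z)).
  have iA : mu.-integrable setT (EFin \o (fun z => M * npdf z)).
    exact: (integrableZl measurableT M in1).
  apply: (dominated_Rintegrable measurableT _ iA).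
  - exact: measurable_funM.
  - by move=> z _; rewrite normrM (ger0_norm (n0 z)) ler_wpM2r.
rewrite !Rintegral_normal//; last exact: measurable_funM.
apply/eqP; rewrite -subr_eq0 -oppr_eq0 opprB -RintegralB//.
pose F z := dh z * npdf z - z * h z * npdf z.
have iF : mu.-integrable setT (EFin \o F).
  exact: (integrableB measurableT i2 i1).
have cF : continuous F.
  by apply: contB; apply: contM => //; apply: contM => // z; exact: cvg_id.
have dF (z : R) : is_derive z 1 (fun z => h z * npdf z) (F z).
  apply: (is_der_eq (is_derM (hd z) (is_der_npdf z))).
  by rewrite /F; ring.
have := cvg_Rintegral_itv iF.
have -> : (fun k : nat => \int[mu]_(x in `[- k.+1%:R, k.+1%:R]) F x) =
    (fun k => h k.+1%:R * npdf k.+1%:R - h (- k.+1%:R) * npdf (- k.+1%:R)).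
  apply/funext => k; rewrite (is_der_FTC2 _ cF dF)//.
  by rewrite gtrN.
move=> hF; apply/eqP; apply: (cvg_unique _ hF); rewrite -/F.
  exact: Rhausdorff.
rewrite /=; apply/norm_cvg0P.
apply: (@squeeze_cvgr _ _ _ _ (fun=> 0)
  (fun k : nat => (2 * M * normal_peak 1 * 2) * k.+1%:R^-1)).
- apply: nearW => k; rewrite normr_ge0/=.
  have npk (w : R) : w ^+ 2 = k.+1%:R ^+ 2 -> npdf w <= normal_peak 1 * (2 * k.+1%:R^-1).
    move=> w2; rewrite npdfE ler_wpM2l ?normal_peak_ge0// w2.
    rewrite expRN -[leRHS]invrK lef_pV2 ?posrE ?expR_gt0 ?invr_gt0 ?mulr_gt0//.
    rewrite (le_trans _ (expR_ge1Dx _))// invfM invrK.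
    have : 1 <= k.+1%:R :> R by rewrite ler1n.
    by move: (k.+1%:R : R) => K K1; nra.
  have b (w : R) : w ^+ 2 = k.+1%:R ^+ 2 ->
      `|h w * npdf w| <= M * (normal_peak 1 * (2 * k.+1%:R^-1)).
    move=> w2; rewrite normrM (ger0_norm (n0 _)) ler_pM// npk//.
  rewrite (le_trans (ler_normB _ _))//.
  have := b k.+1%:R erefl; have := b (- k.+1%:R) (sqrrN _).
  set A := M * (normal_peak 1 * _); have -> : 2 * M * normal_peak 1 * 2 * k.+1%:R^-1 = 2 * A.
    by rewrite /A; ring.
  lra.
- exact: cvg_cst.
- rewrite -[X in _ --> X](mulr0 (2 * M * normal_peak 1 * 2)).
  by apply: cvgM; [exact: cvg_cst|exact: cvg_harmonic].
Qed.

End normal_stein.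

Section derive_integral.
Context d (T : measurableType d) (R : realType).
Variables (mu : {measure set T -> \bar R}) (D : set T).

Lemma is_der_integral (f df : R -> T -> R) (G : T -> R) (a u v : R) :
  measurable D -> u < a < v ->
  (forall x, u < x < v -> mu.-integrable D (EFin \o f x)) ->
  (forall x y, u < x < v -> D y -> is_derive x 1 (f ^~ y) (df x y)) ->
  mu.-integrable D (EFin \o G) ->
  (forall x y, u < x < v -> D y -> `|df x y| <= G y) ->
  is_derive a 1 (fun x => \int[mu]_(y in D) f x y) (\int[mu]_(y in D) df a y).
Proof.
move=> mD uav fi fd iG dG.
have Ia : `]u, v[%classic a by rewrite /= in_itv.
have fi' x : `]u, v[%classic x -> mu.-integrable D (EFin \o f x).
  by rewrite /= in_itv; exact: fi.
have fd' x y : `]u, v[%classic x -> D y -> derivable (f ^~ y) x 1.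
  by rewrite /= in_itv/= => h Dy; have [] := fd x y h Dy.
have dE x y : `]u, v[%classic x -> D y -> partial1of2 f x y = df x y.
  rewrite /= in_itv/= => h Dy; rewrite partial1of2E.
  by have [] := fd x y h Dy.
have dG' x y : `]u, v[%classic x -> D y -> `|partial1of2 f x y| <= `|G y|.
  move=> h Dy; rewrite dE// (le_trans _ (ler_norm _))//.
  have h' : u < x < v by move: h; rewrite /= in_itv.
  exact: dG.
have iG' : mu.-integrable D (EFin \o (fun y => `|G y|)).
  by have := integrable_norm iG.
have G0 y : 0 <= `|G y| by [].
split.
  exact: (derivable_under_integral mD Ia fi' fd' G0 iG' dG').
rewrite -derive1E (differentiation_under_integral mD Ia fi' fd' G0 iG' dG').
by apply: eq_Rintegral => y /set_mem Dy; exact: dE.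
Qed.

End derive_integral.

(** * Gaussian vectors *)

Section gaussian_vectors.
Context (R : realType) (N : nat).
Local Notation V := 'rV[R]_N.
Implicit Types (p : probability V R) (A : 'M[R]_N) (b x v xi : V).

(** Differentiability is asked along every line, not only along the axes: adding a random multiple
    of a vector b requires the derivative in the direction b. *)
Definition C1b (g : V -> R) (dg : 'I_N -> V -> R) : Prop :=
  [/\ Cb g, forall k, Cb (dg k) & forall (x v : V) (s : R),
    is_derive s 1 (fun t => g (x + t *: v))
      (\sum_k v ord0 k * dg k (x + s *: v))].

(* Stein's characterization of the centred normal law of covariance A *)
Definition gaussian p A : Prop :=
  (forall j, p.-integrable setT (EFin \o (fun x : V => x ord0 j))) /\
  forall g dg, C1b g dg -> forall j,
    \int[p]_x (x ord0 j * g x) = \sum_k A j k * \int[p]_x dg k x.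

Lemma integrable_coordM p (f : V -> R) g :
  p.-integrable setT (EFin \o f) -> Cb g ->
  p.-integrable setT (EFin \o (fun x => f x * g x)).
Proof.
move=> fi cg; have /CbP[_ [M gM]] := cg.
have mf : measurable_fun setT f by apply/measurable_EFinP; exact: measurable_int fi.
have i : p.-integrable setT (EFin \o (fun x => M * `|f x|)).
  exact: (integrableZl measurableT M (integrable_norm fi)).
apply: (dominated_Rintegrable measurableT _ i).
  by apply: measurable_funM => //; exact: Cb_measurable.
by move=> x _; rewrite normrM mulrC ler_wpM2r.
Qed.

Lemma Cb_shift g b : Cb g -> Cb (fun x => g (x + b)).
Proof.
move=> /CbP[cg [M gM]]; apply: (@Cb_bound _ _ _ M) => // x.
have cB : continuous (fun x : V => x + b).
  by move=> y; apply: (@continuousD _ _ _ id (cst _)); [exact: cvg_id|exact: cst_continuous].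
by apply: (continuous_comp (cB x)); exact: cg.
Qed.

Lemma C1b_shift g dg b : C1b g dg ->
  C1b (fun x => g (x + b)) (fun k x => dg k (x + b)).
Proof.
move=> [cg cdg h]; split; [exact: Cb_shift|by move=> k; exact: Cb_shift|].
move=> x v s; have := h (x + b) v s.
under eq_fun do rewrite addrAC.
by under eq_bigr do rewrite addrAC.
Qed.

Lemma gaussian_dirac : exists p, gaussian p 0.
Proof.
exists (dirac (0 : V)); split.
  move=> j; apply/integrableP; split.
    by apply/measurable_EFinP; exact: measurable_coord.
  rewrite integral_dirac//; last first.
    by apply/measurable_EFinP/measurableT_comp => //; exact: measurable_coord.
  by rewrite diracT mul1e ltry.
move=> g dg [cg cdg _] j; rewrite big1; last by move=> k _; rewrite mxE mul0r.
rewrite /Rintegral integral_dirac//; last first.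
  apply/measurable_EFinP; apply: measurable_funM; first exact: measurable_coord.
  exact: Cb_measurable.
by rewrite diracT mul1e /= mxE mul0r.
Qed.

Section product.
Context d1 d2 (T1 : measurableType d1) (T2 : measurableType d2).
Variables (m1 : probability T1 R) (m2 : probability T2 R).

Lemma integrable_fst (f : T1 -> R) : m1.-integrable setT (EFin \o f) ->
  (m1 \x m2)%E.-integrable setT (EFin \o (fun z => f z.1)).
Proof.
move=> fi; have mf : measurable_fun setT f by apply/measurable_EFinP; exact: measurable_int fi.
apply/integrable12ltyP.
  by apply/measurable_EFinP; apply: measurableT_comp.
rewrite (eq_integral (fun t => `|(f t)%:E|%E)).
  by case/integrableP : fi.
by move=> t _; rewrite /= integral_cst// [X in (_ * X)%E](probability_setT m2) mule1.
Qed.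

Lemma integrable_snd (f : T2 -> R) : m2.-integrable setT (EFin \o f) ->
  (m1 \x m2)%E.-integrable setT (EFin \o (fun z => f z.2)).
Proof.
move=> fi; have mf : measurable_fun setT f by apply/measurable_EFinP; exact: measurable_int fi.
apply/integrable21ltyP.
  by apply/measurable_EFinP; apply: measurableT_comp.
rewrite (eq_integral (fun t => `|(f t)%:E|%E)).
  by case/integrableP : fi.
by move=> t _; rewrite /= integral_cst// [X in (_ * X)%E](probability_setT m1) mule1.
Qed.

End product.

Section step.
Variable n : probability R R.
Hypothesis ni : n.-integrable setT (EFin \o (fun z : R => z)).
Hypothesis stein : forall (h dh : R -> R) (M : R),
  (forall z : R, is_derive z 1 h (dh z)) -> continuous dh ->
  (forall z, `|h z| <= M) -> (forall z, `|dh z| <= M) ->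
  \int[n]_z (z * h z) = \int[n]_z dh z.

(** The new law is that of X + Z b with Z independent of X. Stein's identity for X with Z frozen
    produces the entries of A; the one-dimensional identity for Z with X frozen, applied to z |-> g
    (x + z b), produces b_j b_k. *)
Lemma gaussian_step p A b : gaussian p A ->
  exists p', gaussian p' (A + b^T *m b).
Proof.
move=> [pi ps].
pose phi (xz : V * R) : V := xz.1 + xz.2 *: b.
have mphi : measurable_fun setT phi.
  apply: measurable_rV => i; under eq_fun do rewrite !mxE.
  apply: measurable_funD; first exact: (measurableT_comp (measurable_coord i)).
  by apply: measurable_funM.
exists (law (p \x n)%E mphi).
have ij j : (p \x n)%E.-integrable setT
    (EFin \o (fun xz : V * R => xz.1 ord0 j)) by exact: (integrable_fst _ (pi j)).
have iz : (p \x n)%E.-integrable setT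
    (EFin \o (fun xz : V * R => xz.2)) by exact: (integrable_snd _ ni).
have izb j : (p \x n)%E.-integrable setT
    (EFin \o (fun xz : V * R => b ord0 j * xz.2)).
  exact: (integrableZl measurableT (b ord0 j) iz).
split.
  move=> j; apply: integrable_law; first exact: measurable_coord.
  have := integrableD measurableT (ij j) (izb j).
  apply: eq_integrable => // xz _.
  by rewrite /= /phi !mxE EFinD (mulrC xz.2).
move=> g dg gdg j; have [cg cdg gd] := gdg; have /CbP[_ [M gM]] := cg.
have M0 : 0 <= M by apply: le_trans (gM 0).
have mg := Cb_measurable cg.
have mgphi : measurable_fun setT (fun xz => g (phi xz)).
  exact: (measurableT_comp mg).
have dominated (f : V * R -> R) : measurable_fun setT f ->
    (p \x n)%E.-integrable setT (EFin \o f) ->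
    (p \x n)%E.-integrable setT (EFin \o (fun xz => f xz * g (phi xz))).
  move=> mf fi.
  have i : (p \x n)%E.-integrable setT (EFin \o (fun xz => M * `|f xz|)).
    exact: (integrableZl measurableT M (integrable_norm fi)).
  apply: (dominated_Rintegrable measurableT _ i); first exact: measurable_funM.
  by move=> x _; rewrite normrM mulrC ler_wpM2r.
have m1 : measurable_fun setT (fun xz : V * R => xz.1 ord0 j).
  exact: (measurableT_comp (measurable_coord j)).
have m2 : measurable_fun setT (fun xz : V * R => b ord0 j * xz.2).
  exact: measurable_funM.
have i1 := dominated _ m1 (ij j).
have i2 := dominated _ m2 (izb j).
have Edg k : \int[law (p \x n)%E mphi]_x dg k x =
    \int[n]_z \int[p]_x dg k (x + z *: b).
  have /CbP[_ [M' gM']] := cdg k.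
  have mk : measurable_fun setT (fun xz => dg k (phi xz)).
    by apply: (measurableT_comp (Cb_measurable (cdg k))).
  rewrite Rintegral_law//.
  - rewrite fubini_Rintegral2//.
    + by apply: (finite_bounded_integrable _ (product_measure_lty p n) mk)=> // x _; exact: gM'.
    + move=> y; apply: (@Cb_integrable _ _ p (fun x => dg k (x + y *: b))).
      exact: Cb_shift.
  - exact: Cb_measurable.
  - by apply: (finite_bounded_integrable _ (product_measure_lty p n) mk)=> // x _; exact: gM'.
rewrite Rintegral_law; first last.
- have := integrableD measurableT i1 i2.
  apply: eq_integrable => // xz _.
  by rewrite /= -EFinD -mulrDl /phi !mxE (mulrC xz.2).
- by apply: measurable_funM => //; exact: measurable_coord.
(* The two summands are integrated in opposite orders, so that in each of them the inner integral is
   the one to which a Stein identity applies. *)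
transitivity (\int[(p \x n)%E]_xz (xz.1 ord0 j * g (phi xz)) +
  \int[(p \x n)%E]_xz (b ord0 j * xz.2 * g (phi xz))).
  rewrite -RintegralD//; apply: eq_Rintegral => xz _.
  by rewrite -mulrDl /phi !mxE (mulrC xz.2).
rewrite (fubini_Rintegral2 i1)//; last first.
  move=> z; apply: (@integrable_coordM p (fun x => x ord0 j) (fun x => g (phi (x, z)))) => //.
  exact: (Cb_shift (z *: b) cg).
rewrite (fubini_Rintegral1 i2)//; last first.
  move=> x.
  have i : n.-integrable setT (EFin \o (fun z => M * `|b ord0 j * z|)).
    apply: (integrableZl measurableT M (integrable_norm _)).
    exact: (integrableZl measurableT (b ord0 j) ni).
  apply: (@dominated_Rintegrable _ _ _ n setT
    (fun z => b ord0 j * z * g (phi (x, z))) _ _ _ i) => //.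
    apply: measurable_funM; first exact: measurable_funM.
    exact: (measurable_section1 mgphi).
  by move=> z _; rewrite normrM mulrC ler_wpM2r.
have inner1 z : \int[p]_x (x ord0 j * g (x + z *: b)) =
    \sum_k A j k * \int[p]_x dg k (x + z *: b).
  exact: (ps _ _ (C1b_shift (z *: b) gdg)).
have mdgk k : measurable_fun setT (fun xz => dg k (phi xz)).
  by apply: (measurableT_comp (Cb_measurable (cdg k))).
have inner2 x : \int[n]_z (b ord0 j * z * g (x + z *: b)) =
    b ord0 j * \sum_k b ord0 k * \int[n]_z dg k (x + z *: b).
  have dgi k : n.-integrable setT (EFin \o (fun z => dg k (x + z *: b))).
    have /CbP[_ [M' gM']] := cdg k.
    apply: (@bounded_integrable _ _ _ n setT (fun z => dg k (x + z *: b)) M') => //.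
    exact: (measurable_section1 (mdgk k)).
  have dgis k : n.-integrable setT (EFin \o (fun z => b ord0 k * dg k (x + z *: b))).
    exact: (integrableZl measurableT (b ord0 k) (dgi k)).
  have [M' hM'] : exists M', forall z, `|\sum_k b ord0 k * dg k (x + z *: b)| <= M'.
    have h k : exists m, forall y, `|dg k y| <= m by case/CbP : (cdg k).
    exists (\sum_k `|b ord0 k| * sval (cid (h k))) => z.
    rewrite (le_trans (ler_norm_sum _ _ _))//; apply: ler_sum => k _.
    by rewrite normrM ler_wpM2l//; exact: (svalP (cid (h k))).
  have cphi : continuous (fun z : R => x + z *: b).
    move=> z; apply: continuous_rV => i.
    under eq_fun do rewrite !mxE; rewrite !mxE.
    apply: cvgD; first exact: cvg_cst.
    by apply: cvgM; [exact: cvg_id|exact: cvg_cst].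
  transitivity (b ord0 j * \int[n]_z (z * g (x + z *: b))).
    rewrite -RintegralZl//; first by apply: eq_Rintegral => z _; rewrite mulrA.
    have i : n.-integrable setT (EFin \o (fun z => M * `|z|)).
      exact: (integrableZl measurableT M (integrable_norm ni)).
    apply: (@dominated_Rintegrable _ _ _ n setT
      (fun z => z * g (phi (x, z))) _ _ _ i) => //.
      by apply: measurable_funM => //; exact: (measurable_section1 mgphi).
    by move=> z _; rewrite normrM mulrC ler_wpM2r.
  congr (_ * _).
  rewrite (@stein _ (fun z => \sum_k b ord0 k * dg k (x + z *: b))
    (Num.max M M')).
  - rewrite Rintegral_sum//; apply: eq_bigr => k _; rewrite RintegralZl//.
  - apply: cont_sum => k; apply: contM; first exact: cont_cst.
    move=> z; apply: (continuous_comp (cphi z)).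
    by case: (cdg k) => + _; exact.
  - by move=> z; rewrite le_max gM.
  - by move=> z; rewrite le_max hM' orbT.
transitivity (\int[n]_z (\sum_k A j k * \int[p]_x dg k (x + z *: b)) +
    \int[p]_x (b ord0 j * \sum_k b ord0 k * \int[n]_z dg k (x + z *: b))).
  congr (_ + _); apply: eq_Rintegral => t _; first exact: inner1.
  exact: inner2.
have bk k : exists M', forall xz, `|dg k (phi xz)| <= M'.
  by have /CbP[_ [M' h]] := cdg k; exists M'.
have dgp k : (p \x n)%E.-integrable setT (EFin \o (fun xz => dg k (phi xz))).
  have [M' h] := bk k.
  by apply: (finite_bounded_integrable _ (product_measure_lty p n) (mdgk k)).
have dg1 k x : n.-integrable setT (EFin \o (fun z => dg k (x + z *: b))).
  have [M' h] := bk k.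
  apply: (@bounded_integrable _ _ _ n setT (fun z => dg k (phi (x, z))) M') => //.
  exact: (measurable_section1 (mdgk k)).
have dg2 k z : p.-integrable setT (EFin \o (fun x => dg k (x + z *: b))).
  by apply: Cb_integrable; exact: Cb_shift.
have ik k : n.-integrable setT (EFin \o (fun z => \int[p]_x dg k (x + z *: b))).
  exact: (fubini_Rintegrable2 (dgp k) (dg2 k)).
have ik' k : p.-integrable setT (EFin \o (fun x => \int[n]_z dg k (x + z *: b))).
  exact: (fubini_Rintegrable1 (dgp k) (dg1 k)).
have Edg' k : \int[law (p \x n)%E mphi]_x dg k x =
    \int[p]_x \int[n]_z dg k (x + z *: b).
  rewrite Edg -(fubini_Rintegral2 (dgp k) (dg2 k)).
  exact: (fubini_Rintegral1 (dgp k) (dg1 k)).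
have iZ1 k : n.-integrable setT
    (EFin \o (fun z => A j k * \int[p]_x dg k (x + z *: b))).
  exact: (integrableZl measurableT (A j k) (ik k)).
have iZ2 k : p.-integrable setT
    (EFin \o (fun x => b ord0 k * \int[n]_z dg k (x + z *: b))).
  exact: (integrableZl measurableT (b ord0 k) (ik' k)).
under [X in _ + X]eq_Rintegral do rewrite mulr_sumr.
rewrite Rintegral_sum// Rintegral_sum//; last first.
  by move=> k; exact: (integrableZl measurableT (b ord0 j) (iZ2 k)).
rewrite -big_split/=; apply: eq_bigr => k _.
rewrite !mxE big_ord1 !mxE mulrDl RintegralZl// -Edg; congr (_ + _).
by rewrite RintegralZl// RintegralZl// -Edg' mulrA.
Qed.

End step.

Lemma gaussian_exists (s : seq V) :
  exists p, gaussian p (\sum_(b <- s) b^T *m b).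
Proof.
elim: s => [|b s [p ps]]; first by rewrite big_nil; exact: gaussian_dirac.
rewrite big_cons addrC.
(* The identity map carries the normal law from [measurableTypeR R] to [R]. *)
have mid : measurable_fun setT (fun z : measurableTypeR R => z : R).
  exact: measurable_id.
apply: (@gaussian_step (law (normal_prob (0 : R) 1) mid)) ps.
  by apply: integrable_law => //; exact: (@integrable_normal_id R).
move=> h dh M hd cdh hM dhM.
have mh : measurable_fun setT h.
  by apply: continuous_measurable_fun => z; exact: is_der_cont (hd z).
have mdh := continuous_measurable_fun cdh.
rewrite Rintegral_law; first last.
- have i : (normal_prob (0 : R) 1).-integrable setT (EFin \o (fun z => M * `|z|)).
    exact: (integrableZl measurableT M (integrable_norm (@integrable_normal_id R))).
  apply: (dominated_Rintegrable measurableT _ i); first exact: measurable_funM.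
  by move=> z _; rewrite /= normrM mulrC ler_wpM2r.
- exact: measurable_funM.
rewrite Rintegral_law//; first exact: (normal_stein hd cdh hM dhM).
by apply: (@bounded_integrable _ _ _ (normal_prob (0 : R) 1) setT dh M).
Qed.

Lemma gaussian_zero_mean p A : gaussian p A -> zero_mean p.
Proof.
move=> [pi ps] i; split; first exact: pi.
have := ps (fun=> 1) (fun _ _ => 0); rewrite /C1b => /(_ _ i).
under eq_Rintegral do rewrite mulr1.
move=> ->; first by rewrite big1// => k _; rewrite Rintegral_cst// mul0r mulr0.
split; [exact: Cb_cst|by move=> k; exact: Cb_cst|move=> x v s].
rewrite big1; last by move=> k _; rewrite mulr0.
exact: is_der_cst.
Qed.

Definition qform A xi : R := \sum_j xi ord0 j * \sum_k A j k * xi ord0 k.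

Lemma is_der_dotv xi a x v (s : R) :
  is_derive s 1 (fun t => a * dotv xi (x + t *: v)) (a * dotv xi v).
Proof.
under eq_fun do rewrite dotvDr dotvZr.
have := is_derZ a (is_derD (is_der_cst (dotv xi x) s)
  (is_derM (is_der_id s) (is_der_cst (dotv xi v) s))).
by move=> h; apply: (is_der_eq h); ring.
Qed.

(** Differentiating C(s), the mean of cos (s xi.x + c), brings down a factor xi.x that Stein's
    identity converts into a derivative: C'(s) = - s q C(s) with q = [qform A xi]. Hence C(s) exp
    (s^2 q / 2) is constant, and its values at 0 and 1 are compared. *)
Lemma gaussian_cos p A xi c : gaussian p A ->
  \int[p]_x cos (dotv xi x + c) = cos c * expR (- (qform A xi / 2)).
Proof.
move=> [pi ps]; pose C s := \int[p]_x cos (s * dotv xi x + c).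
have cphase (s : R) : continuous (fun x => s * dotv xi x + c).
  apply: contD; last exact: cont_cst.
  by apply: contM; [exact: cont_cst|exact: dotvl_continuous].
have Ccos s : Cb (fun x => cos (s * dotv xi x + c)) by exact: Cb_cos.
have Csin s : Cb (fun x => sin (s * dotv xi x + c)) by exact: Cb_sin.
have ixi k : p.-integrable setT (EFin \o (fun x : V => xi ord0 k * x ord0 k)).
  exact: (integrableZl measurableT (xi ord0 k) (pi k)).
have idot : p.-integrable setT (EFin \o (fun x => dotv xi x)).
  have -> : EFin \o (fun x => dotv xi x) =
      (fun x => \sum_k (EFin \o (fun x : V => (xi ord0 k * x ord0 k)%R)) x)%E.
    by apply/funext => x /=; rewrite sumEFin.
  by apply: integrable_sum => // k; exact: ixi.
have Ceq s : \int[p]_x (- (dotv xi x * sin (s * dotv xi x + c))) =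
    - (s * qform A xi * C s).
  have -> : (fun x => - (dotv xi x * sin (s * dotv xi x + c))) =
      (fun x => \sum_j (- xi ord0 j) * (x ord0 j * sin (s * dotv xi x + c))).
    apply/funext => x; rewrite /dotv mulr_suml -sumrN; apply: eq_bigr => j _.
    by rewrite mulNr mulrA.
  have ij j : p.-integrable setT
      (EFin \o (fun x : V => x ord0 j * sin (s * dotv xi x + c))).
    by apply: integrable_coordM.
  rewrite Rintegral_sum//; last first.
    by move=> j; exact: (integrableZl measurableT (- xi ord0 j) (ij j)).
  rewrite /qform -mulrA mulr_suml mulr_sumr -sumrN; apply: eq_bigr => j _.
  rewrite RintegralZl// (ps _ (fun k x => s * xi ord0 k * cos (s * dotv xi x + c))).
    rewrite mulNr; congr (- _); rewrite !mulrA (mulrC s) -!mulrA; congr (_ * _).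
    rewrite mulr_suml mulr_sumr; apply: eq_bigr => k _.
    by rewrite RintegralZl//; [rewrite /C; ring|exact: Cb_integrable].
  split; [exact: Csin|by move=> k; exact: CbZ|].
  move=> x v t.
  have h := is_derD (is_der_dotv xi s x v t) (is_der_cst c t).
  apply: (is_der_eq (is_der_sin h)).
  by rewrite addr0 /dotv mulr_sumr mulr_suml; apply: eq_bigr => k _; ring.
have dC (s : R) : is_derive s 1 C (- (s * qform A xi * C s)).
  rewrite -Ceq.
  apply: (@is_der_integral _ _ _ p setT (fun t x => cos (t * dotv xi x + c))
    (fun t x => - (dotv xi x * sin (t * dotv xi x + c)))
    (fun x => `|dotv xi x|) s (s - 1) (s + 1)) => //.
  - by rewrite ltrDl ltr01 gtrDl ltrN10.
  - by move=> t _; exact: Cb_integrable.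
  - move=> t x _ _.
    have h := is_derD (is_derM (is_der_id t) (is_der_cst (dotv xi x) t)) (is_der_cst c t).
    by apply: (is_der_eq (is_der_cos h)); rewrite mul1r mulr0 !addr0.
  - by have := integrable_norm idot.
  - move=> t x _ _; rewrite normrN normrM -[leRHS]mulr1 ler_wpM2l//.
    by rewrite ler_norml sin_geN1 sin_le1.
have dD (s : R) : is_derive s 1 (fun s => C s * expR (s ^+ 2 * (qform A xi / 2))) 0.
  have h := is_derM (dC s) (is_der_expR (is_derM (is_der_exprn 2 s)
    (is_der_cst (qform A xi / 2) s))).
  by apply: (is_der_eq h); rewrite /=; field.
have := is_derive_0_is_cst 1 0 dD.
rewrite expr1n expr0n/= mul1r mul0r expR0 mulr1 => h.
have C0 : C 0 = cos c.
  by rewrite /C; under eq_Rintegral do rewrite mul0r add0r; rewrite Rintegral_pcst.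
have -> : \int[p]_x cos (dotv xi x + c) = C 1.
  by rewrite /C; apply: eq_Rintegral => x _; rewrite mul1r.
by rewrite expRN -C0 -h mulfK// gt_eqF// expR_gt0.
Qed.

End gaussian_vectors.

Section characteristic_functions.
Context (R : realType) (N : nat).
Local Notation V := 'rV[R]_N.
Implicit Types (p q : probability V R) (A : 'M[R]_N) (xi v : V).

Lemma qform1 xi : qform 1%:M xi = dotv xi xi.
Proof.
apply: eq_bigr => j _; congr (_ * _); rewrite (bigD1 j)//= mxE eqxx mul1r.
by rewrite big1 ?addr0// => k kj; rewrite mxE eq_sym (negbTE kj) mul0r.
Qed.

Lemma gaussian_sin p A xi : gaussian p A -> \int[p]_x sin (dotv xi x) = 0.
Proof.
move=> gp; have := gaussian_cos xi (- (pi / 2)) gp.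
rewrite cosN cos_pihalf mul0r => <-.
by apply: eq_Rintegral => x _; rewrite -cosBpihalf.
Qed.

Lemma gaussian_cos0 p A xi : gaussian p A ->
  \int[p]_x cos (dotv xi x) = expR (- (qform A xi / 2)).
Proof.
move=> gp; have := gaussian_cos xi 0 gp; rewrite cos0 mul1r => <-.
by apply: eq_Rintegral => x _; rewrite addr0.
Qed.

Lemma standard_gaussian_exists : exists p : probability V R, gaussian p 1%:M.
Proof.
have [p hp] := gaussian_exists [seq (delta_mx ord0 i : V) | i <- enum 'I_N].
exists p; move: hp; rewrite big_map big_enum/=.
suff -> : \sum_i ((delta_mx ord0 i : V)^T *m delta_mx ord0 i) = (1%:M : 'M[R]_N) by [].
rewrite mx1_sum_delta; apply: eq_bigr => i _.
by rewrite trmx_delta mul_delta_mx.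
Qed.

Theorem narrow_cvg_of_characteristic (p_ : nat -> probability V R) p :
  (forall xi, \int[p_ n]_x cos (dotv xi x) @[n --> \oo] -->
    \int[p]_x cos (dotv xi x)) ->
  (forall xi, \int[p_ n]_x sin (dotv xi x) @[n --> \oo] -->
    \int[p]_x sin (dotv xi x)) ->
  forall f, Cb f -> \int[p_ n]_x f x @[n --> \oo] --> \int[p]_x f x.
Proof.
move=> hc hs f cf; have [g hg] := standard_gaussian_exists.
apply: (@levy_continuity _ _ g) => //.
by move=> xi; rewrite (gaussian_cos0 _ hg) qform1.
Qed.

(** The constant sequence p satisfies the hypotheses of the continuity theorem with limit q, so each
    integral under p also tends to the one under q. *)
Theorem characteristic_unique p q :
  (forall xi, \int[p]_x cos (dotv xi x) = \int[q]_x cos (dotv xi x)) ->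
  (forall xi, \int[p]_x sin (dotv xi x) = \int[q]_x sin (dotv xi x)) ->
  p ≡μ q.
Proof.
move=> hc hs; apply: prob_eq_Cb => f cf.
have h : \int[p]_x f x @[_ --> (\oo : set_system nat)] --> \int[q]_x f x.
  have h1 xi : \int[p]_x cos (dotv xi x) @[n --> \oo] -->
      \int[q]_x cos (dotv xi x) by rewrite hc; exact: cvg_cst.
  have h2 xi : \int[p]_x sin (dotv xi x) @[n --> \oo] -->
      \int[q]_x sin (dotv xi x) by rewrite hs; exact: cvg_cst.
  exact: (@narrow_cvg_of_characteristic (fun=> p) q h1 h2 f cf).
have h0 : \int[p]_x f x @[_ --> (\oo : set_system nat)] --> \int[p]_x f x.
  exact: cvg_cst.
exact: (cvg_unique _ h0 h).
Qed.

End characteristic_functions.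

(** * Symmetric elimination for positive semidefinite matrices *)

Section psd_factorization.
Context (R : realType) (N : nat).
Local Notation V := 'rV[R]_N.
Implicit Types (A : 'M[R]_N) (u v : V).

Let bform A u v : R := (u *m A *m v^T) ord0 ord0.

Lemma qformE A v : (v *m A *m v^T) ord0 ord0 = qform A v.
Proof.
rewrite mxE /qform; under eq_bigr do rewrite !mxE mulr_suml.
rewrite exchange_big/=; apply: eq_bigr => j _; rewrite mulr_sumr.
by apply: eq_bigr => k _; rewrite mulrA.
Qed.

Let bformDl A u u' v : bform A (u + u') v = bform A u v + bform A u' v.
Proof. by rewrite /bform !mulmxDl mxE. Qed.

Let bformDr A u v v' : bform A u (v + v') = bform A u v + bform A u v'.
Proof. by rewrite /bform linearD/= mulmxDr mxE. Qed.

Let bformZl A (a : R) u v : bform A (a *: u) v = a * bform A u v.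
Proof. by rewrite /bform -!scalemxAl mxE. Qed.

Let bformZr A (a : R) u v : bform A u (a *: v) = a * bform A u v.
Proof. by rewrite /bform linearZ/= -scalemxAr mxE. Qed.

Let bformC A u v : A^T = A -> bform A u v = bform A v u.
Proof.
move=> sA; rewrite /bform -{1}sA -[in LHS](trmxK (_ *m _)) mxE.
by rewrite !trmx_mul !trmxK mulmxA.
Qed.

Let bform_delta A k j : bform A (delta_mx ord0 k) (delta_mx ord0 j) = A k j.
Proof.
by rewrite /bform -rowE trmx_delta -colE !mxE.
Qed.

(** Elimination as in Cholesky's method, by induction on the number m of rows not yet cleared, the
    first k being zero. A zero pivot forces its whole row to vanish; otherwise the rank-one matrix
    built from the pivot row is subtracted and what remains is still positive semidefinite. *)
Lemma psd_factor A : A^T = A -> (forall v, 0 <= (v *m A *m v^T) ord0 ord0) ->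
  exists s : seq V, A = \sum_(b <- s) b^T *m b.
Proof.
suff H m : forall k, (k + m = N)%N -> forall A, A^T = A ->
    (forall v, 0 <= bform A v v) -> (forall i j : 'I_N, (i < k)%N -> A i j = 0) ->
    exists s : seq V, A = \sum_(b <- s) b^T *m b.
  by move=> sA pA; exact: (H N 0%N).
elim: m => [|m ih] k kmN {}A sA pA A0.
  exists [::]; rewrite big_nil; apply/matrixP => i j; rewrite mxE A0//.
  by rewrite -(addn0 k) kmN.
have kN : (k < N)%N by rewrite -kmN -addSnnS leq_addr.
pose k' := Ordinal kN; set a := A k' k'.
have kmN' : (k.+1 + m = N)%N by rewrite addSnnS.
have symA i j : A i j = A j i by rewrite -[in LHS]sA mxE.
have expand v t : bform A (v + t *: delta_mx ord0 k') (v + t *: delta_mx ord0 k') =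
    bform A v v + 2 * t * bform A (delta_mx ord0 k') v + t ^+ 2 * a.
  rewrite bformDl !bformDr !bformZl !bformZr bform_delta.
  by rewrite (bformC v (delta_mx ord0 k') sA) /a; ring.
have a0 : 0 <= a by rewrite /a -bform_delta.
have [az|anz] := eqVneq a 0.
  apply: (ih k.+1) => // i j; rewrite ltnS leq_eqVlt => /predU1P[ik|]; last exact: A0.
  have -> : i = k' by exact/val_inj.
  apply: contrapT => /eqP Anz.
  (* With a zero pivot the form is affine in t along e_j + t e_k', and this t gives it the value
     -1. *)
  pose t := - (A j j + 1) / (2 * A k' j).
  have := pA (delta_mx ord0 j + t *: delta_mx ord0 k').
  rewrite expand !bform_delta az mulr0 addr0 (_ : 2 * t * _ = - (A j j + 1)).
    by lra.
  by rewrite /t; field.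
have ap : 0 < a by rewrite lt_neqAle eq_sym anz.
pose b : V := (Num.sqrt a)^-1 *: row k' A.
have bb i j : (b^T *m b) i j = A k' i * A k' j / a.
  rewrite mxE big_ord1 !mxE mulrACA -invfM -expr2 sqr_sqrtr//.
  by rewrite mulrC.
have [|||s As] := ih k.+1 kmN' (A - b^T *m b).
- by rewrite linearB/= sA trmx_mul trmxK.
- move=> v; pose c := bform A (delta_mx ord0 k') v.
  (* - c / a minimizes the form along the line v + t e_k'; the minimum, bform A v v - c^2 / a, is
     the value at v of the reduced matrix. *)
  have := pA (v + (- (c / a)) *: delta_mx ord0 k'); rewrite expand -/c.
  suff -> : bform (A - b^T *m b) v v = bform A v v - c ^+ 2 / a.
    suff -> : bform A v v + 2 * - (c / a) * c + (- (c / a)) ^+ 2 * a =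
      bform A v v - c ^+ 2 / a by [].
    by field.
  rewrite /bform mulmxBr mulmxBl mxE; congr (_ + _); rewrite mxE; congr (- _).
  have cE : (b *m v^T) ord0 ord0 = (Num.sqrt a)^-1 * c.
    by rewrite /b /c /bform -rowE -scalemxAl mxE.
  have -> : v *m (b^T *m b) *m v^T = (b *m v^T)^T *m (b *m v^T).
    by rewrite trmx_mul trmxK !mulmxA.
  rewrite mxE big_ord1 mxE cE mulrACA -invfM -!expr2 sqr_sqrtr//.
  by rewrite mulrC.
- move=> i j; rewrite ltnS leq_eqVlt => /predU1P[ik|ik].
    have -> : i = k' by exact/val_inj.
    by rewrite !mxE; have := bb k' j; rewrite mxE => ->; rewrite -/a mulrAC divff// mul1r subrr.
  rewrite !mxE; have := bb i j; rewrite mxE => ->.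
  by rewrite (A0 i j ik) (symA k' i) (A0 i k' ik) !mul0r subrr.
exists (b :: s); rewrite big_cons -As addrC subrK//.
Qed.

End psd_factorization.

(** * The heat equation *)

Section chain_rule.
Context (R : realType) (N : nat).
Local Notation V := 'rV[R]_N.
Local Notation W := (R * V)%type.

Lemma is_derP (f : R -> R) (x a : R) : is_derive x 1 f a <->
  forall e, 0 < e -> \forall y \near x, `|f y - f x - a * (y - x)| <= e * `|y - x|.
Proof.
split.
  move=> [df dfa] e e0.
  have : h^-1 *: ((f \o shift x) (h *: 1) - f x) @[h --> 0^'] --> a.
    by rewrite -dfa; exact: df.
  move/cvgrPdist_le => /(_ _ e0); rewrite !near_withinE => /nbhs_ballP[d /= d0 h].
  apply/nbhs_ballP; exists d => //= y; rewrite /ball/= => xy.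
  have [->|yx] := eqVneq y x; first by rewrite !subrr mulr0 subrr normr0 mulr0.
  have yx0 : y - x != 0 by rewrite subr_eq0.
  have := h (y - x); rewrite /ball/= sub0r normrN distrC => /(_ xy yx0).
  rewrite /GRing.scale/= mulr1 subrK => h'.
  have -> : f y - f x - a * (y - x) = ((y - x)^-1 * (f y - f x) - a) * (y - x).
    by rewrite mulrBl mulrAC mulVf// mul1r.
  by rewrite normrM (distrC x y); apply: ler_wpM2r => //; rewrite distrC.
move=> H.
have cv : h^-1 *: ((f \o shift x) (h *: 1) - f x) @[h --> 0^'] --> a.
  apply/cvgrPdist_le => e e0; rewrite near_withinE.
  have /nbhs_ballP[d /= d0 h] := H _ e0.
  apply/nbhs_ballP; exists d => //= t; rewrite /ball/= sub0r normrN => td t0.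
  have := h (t + x); rewrite /ball/= opprD addrCA subrr addr0 normrN => /(_ td).
  rewrite /GRing.scale/= mulr1 addrK => h'.
  have -> : a - t^-1 * (f (t + x) - f x) =
      - (f (t + x) - f x - a * t) * t^-1.
    by field.
  rewrite normrM normrN normfV ler_pdivrMr// normr_gt0//.
by split; [apply/cvg_ex; exists a|exact/cvg_lim].
Qed.

Lemma is_derive_line (f : W -> R) (q v : W) (r : R) :
  (forall p, derivable f p v) ->
  is_derive r 1 (fun s => f (q + s *: v)) ('D_v f (q + r *: v)).
Proof.
move=> df; have E : (fun h : R => h^-1 *: (((fun s => f (q + s *: v)) \o shift r) (h *: 1)
   - f (q + r *: v))) = (fun h => h^-1 *: ((f \o shift (q + r *: v)) (h *: v) -
   f (q + r *: v))).
  apply/funext => h; rewrite /= /GRing.scale/= mulr1.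
  by congr (_ * (f _ - _)); rewrite addrCA -scalerDl.
split; first by rewrite /derivable E; exact: df.
by rewrite /derive E.
Qed.

Lemma MVT_abs (h dh : R -> R) (c L e : R) :
  (forall x : R, is_derive x 1 h (dh x)) ->
  (forall x : R, `|x| <= `|c| -> `|dh x - L| <= e) ->
  `|h c - h 0 - c * L| <= e * `|c|.
Proof.
move=> hd he; have ch : continuous h by move=> x; exact: is_der_cont (hd x).
have [c0|c0] := leP 0 c.
  have [x] := @MVT_segment _ h dh 0 c c0 (fun x _ => hd x) (continuous_subspaceT ch).
  rewrite in_itv/= => /andP[x0 xc] ->; rewrite subr0 mulrC -mulrBr normrM mulrC.
  by rewrite ler_wpM2r// he// !ger0_norm.
have [x] := @MVT_segment _ h dh c 0 (ltW c0) (fun x _ => hd x) (continuous_subspaceT ch).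
rewrite in_itv/= => /andP[cx x0] hc.
have -> : h c - h 0 = dh x * c by rewrite -opprB hc sub0r mulrN opprK.
rewrite mulrC -mulrBr normrM mulrC ler_wpM2r// he//.
by rewrite !ler0_norm ?lerN2// ltW.
Qed.

Let lin (s : seq (option 'I_N)) (c : option 'I_N -> R) : W :=
  \sum_(o <- s) c o *: dir R o.

(** Directions are moved one at a time: the mean value theorem on each segment produces a partial
    derivative at an intermediate point, which continuity compares with its value at p. *)
Lemma strict_differentiability (f : W -> R) (p : W) :
  (forall o q, derivable f q (dir R o)) ->
  (forall o, continuous (partial o f)) ->
  forall (s : seq (option 'I_N)) (e : R), 0 < e ->
  exists2 d, 0 < d & forall c, (forall o, `|c o| <= d) ->
    `|f (p + lin s c) - f p - \sum_(o <- s) c o * partial o f p|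
    <= e * \sum_(o <- s) `|c o|.
Proof.
move=> df cf s e e0; elim: s => [|o s [d d0 ih]].
  exists 1 => // c _; rewrite /lin !big_nil addr0 subrr subr0 normr0 mulr0//.
have /cvgrPdist_le/(_ _ e0)/nbhs_ballP[r /= r0 hr] := cf o p.
(* With all |c o| <= r / (K + 1) / 2, every intermediate point is within distance r of p. *)
pose K := \sum_(o' <- o :: s) `|dir R o'| : R.
have K0 : 0 <= K by apply: sumr_ge0.
have K1 : 0 < K + 1 by lra.
pose d' := Num.min d (r / (K + 1) / 2).
have d'0 : 0 < d' by rewrite lt_min d0 !divr_gt0.
exists d' => // c cd.
have cd1 o' : `|c o'| <= d by rewrite (le_trans (cd o'))// ge_min lexx.
have cd2 o' : `|c o'| <= r / (K + 1) / 2 by rewrite (le_trans (cd o'))// ge_min lexx orbT.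
have := ih c cd1; rewrite /lin !big_cons -/(lin s c).
set q := p + lin s c => hq.
have -> : p + (c o *: dir R o + lin s c) = q + c o *: dir R o.
  by rewrite /q -addrA (addrC (lin s c)).
have := @MVT_abs (fun t => f (q + t *: dir R o))
  (fun t => partial o f (q + t *: dir R o)) (c o) (partial o f p) e.
move=> /(_ (fun t => is_derive_line q t (df o))) h.
have {}h : `|f (q + c o *: dir R o) - f q - c o * partial o f p| <= e * `|c o|.
  move: h; rewrite scale0r addr0; apply => t tc.
  rewrite distrC; apply: hr; rewrite -ball_normE /ball_/=.
  rewrite opprD addrA /q opprD addrA subrr sub0r -opprD normrN.
  have lb : `|lin s c + t *: dir R o| <= K * (r / (K + 1) / 2).
    rewrite (le_trans (ler_normD _ _))// {1}/K big_cons mulrDl addrC lerD//.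
      by rewrite normrZ mulrC; apply: ler_wpM2l => //; exact: (le_trans tc (cd2 o)).
    rewrite /lin (le_trans (ler_norm_sum _ _ _))// mulr_suml; apply: ler_sum => o' _.
    by rewrite normrZ mulrC; apply: ler_wpM2l => //; exact: cd2.
  rewrite (le_lt_trans lb)//.
  have -> : K * (r / (K + 1) / 2) = r * (K / (K + 1)) / 2 by field; lra.
  have : K / (K + 1) <= 1 by rewrite ler_pdivrMr//; lra.
  move: (K / (K + 1)) => k k1; nra.
rewrite mulrDr (_ : _ - _ - (_ + _) =
  (f (q + c o *: dir R o) - f q - c o * partial o f p) +
  (f q - f p - \sum_(o <- s) c o * partial o f p)); last by ring.
by rewrite (le_trans (ler_normD _ _))// lerD.
Qed.

(** Continuous partial derivatives are enough to differentiate f along an arbitrary differentiable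
    path, here t |-> (t, sqrt t x) as well as lines in space. *)
Lemma partial_chain_rule (f : W -> R) (tau : R -> R) (X : R -> V) (s0 dtau : R)
    (dX : V) :
  (forall o q, derivable f q (dir R o)) ->
  (forall o, continuous (partial o f)) ->
  is_derive s0 1 tau dtau ->
  (forall i, is_derive s0 1 (fun s => X s ord0 i) (dX ord0 i)) ->
  is_derive s0 1 (fun s => f (tau s, X s))
    (dtau * partial None f (tau s0, X s0) +
     \sum_i dX ord0 i * partial (Some i) f (tau s0, X s0)).
Proof.
move=> df cf dt dx; set p := (tau s0, X s0).
pose c s (o : option 'I_N) : R :=
  if o is Some i then X s ord0 i - X s0 ord0 i else tau s - tau s0.
pose dc (o : option 'I_N) : R := if o is Some i then dX ord0 i else dtau.
pose os := None :: [seq Some i | i <- enum 'I_N].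
have osE (F : option 'I_N -> R) : \sum_(o <- os) F o = F None + \sum_i F (Some i).
  by rewrite big_cons big_map big_enum.
have ptE s : (tau s, X s) = p + lin os (c s).
  rewrite /lin big_cons big_map big_enum/= /c/= /p.
  have -> : \sum_i (X s ord0 i - X s0 ord0 i) *: dir R (Some i) =
      ((0 : R), X s - X s0).
    rewrite [X s - X s0 in RHS]row_sum_delta.
    apply: (big_ind2 (fun (a : W) b => a = (0, b))) => //.
      by move=> a1 b1 a2 b2 -> ->; congr pair; rewrite addr0.
    by move=> i _; rewrite !mxE; congr pair; rewrite scaler0.
  congr pair; rewrite /=; first by rewrite /GRing.scale/= mulr1 addr0 addrC subrK.
  by rewrite scaler0 add0r addrC subrK.
have cder o : is_derive s0 1 (fun s => c s o) (dc o).
  case: o => [i|] /=.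
    by apply: (is_der_eq (is_derB (dx i) (is_der_cst _ _))); rewrite subr0.
  by apply: (is_der_eq (is_derB dt (is_der_cst _ _))); rewrite subr0.
have c0 o : c s0 o = 0 by case: o => [i|] /=; rewrite subrr.
apply/is_derP => e e0.
(* The error e is split evenly. [B] bounds the speed of the path and absorbs the error of f; [P]
   bounds the partial derivatives and absorbs the error of the path, with P + 1 as denominator
   because P may be zero. *)
pose B := \sum_(o <- os) (`|dc o| + 1).
have B0 : 0 < B.
  by rewrite /B osE ltr_pwDl// ?sumr_ge0// => *; rewrite ?addr_ge0// ltr_pwDr.
pose P := \sum_(o <- os) `|partial o f p|.
have P0 : 0 <= P by apply: sumr_ge0.
have e1 : 0 < e / (2 * B) by rewrite divr_gt0// mulr_gt0.
have P1 : 0 < P + 1 by lra.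
have e2 : 0 < e / (2 * (P + 1)) by rewrite divr_gt0// mulr_gt0.
have [d d0 hd] := strict_differentiability p df cf os e1.
have near1 : \forall s \near s0, forall o, `|c s o| <= d.
  apply: (@filter_forall R (option 'I_N) (fun o s => `|c s o| <= d) _ (nbhs_filter s0)) => o; have /cvgrPdist_le/(_ _ d0) := is_der_cont (cder o).
  by rewrite c0; apply: filterS => s; rewrite sub0r normrN.
have near2 : \forall s \near s0, forall o,
    `|c s o - dc o * (s - s0)| <= e / (2 * (P + 1)) * `|s - s0|.
  apply: (@filter_forall R (option 'I_N) (fun o s => `|c s o - dc o * (s - s0)| <= e / (2 * (P + 1)) * `|s - s0|) _ (nbhs_filter s0)) => o; have /is_derP/(_ _ e2) := cder o.
  by apply: filterS => s; rewrite c0 subr0.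
have near3 : \forall s \near s0, forall o, `|c s o| <= (`|dc o| + 1) * `|s - s0|.
  apply: (@filter_forall R (option 'I_N) (fun o s => `|c s o| <= (`|dc o| + 1) * `|s - s0|) _ (nbhs_filter s0)) => o; have /is_derP/(_ _ ltr01) := cder o.
  apply: filterS => s; rewrite c0 subr0 mul1r => h.
  rewrite mulrDl mul1r -normrM -[c s o](subrK (dc o * (s - s0))).
  by rewrite (le_trans (ler_normD _ _))// addrC lerD2l.
near=> s.
have h1 : forall o, `|c s o| <= d by near: s.
have h2 : forall o, `|c s o - dc o * (s - s0)| <= e / (2 * (P + 1)) * `|s - s0| by near: s.
have h3 : forall o, `|c s o| <= (`|dc o| + 1) * `|s - s0| by near: s.
have := hd _ h1; rewrite -ptE => h4.
rewrite (_ : dtau * _ + _ = \sum_(o <- os) dc o * partial o f p); last by rewrite osE.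
have -> : f (tau s, X s) - f p - (\sum_(o <- os) dc o * partial o f p) * (s - s0) =
  (f (tau s, X s) - f p - \sum_(o <- os) c s o * partial o f p) +
  \sum_(o <- os) (c s o - dc o * (s - s0)) * partial o f p.
  have -> : \sum_(o <- os) (c s o - dc o * (s - s0)) * partial o f p =
      \sum_(o <- os) c s o * partial o f p -
      (\sum_(o <- os) dc o * partial o f p) * (s - s0).
    by rewrite mulr_suml -sumrB; apply: eq_bigr => o _; ring.
  ring.
rewrite (le_trans (ler_normD _ _))//.
have -> : e * `|s - s0| = e / (2 * B) * (B * `|s - s0|) + e / 2 * `|s - s0|.
  by field; rewrite gt_eqF.
apply: lerD.
  rewrite (le_trans h4)// ler_wpM2l ?(ltW e1)// /B mulr_suml.
  by apply: ler_sum => o _; exact: h3.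
apply: (@le_trans _ _ (e / (2 * (P + 1)) * `|s - s0| * P)).
  rewrite (le_trans (ler_norm_sum _ _ _))// /P mulr_sumr; apply: ler_sum => o _.
  by rewrite normrM ler_wpM2r.
rewrite mulrAC ler_wpM2r// (_ : e / (2 * (P + 1)) * P = e / 2 * (P / (P + 1))).
  by rewrite ler_piMr ?divr_ge0 ?(ltW e0)// ler_pdivrMr// mul1r lerDl.
by field; rewrite gt_eqF.
Unshelve. all: by end_near. Qed.

End chain_rule.

Section calculus_half_line.
Context (R : realType).
Local Notation mu := (@lebesgue_measure R).

Lemma integrable_oneDsqrV (M : R) :
  mu.-integrable `[0, +oo[ (EFin \o (fun t : R => M * (1 + t ^+ 2)^-1)).
Proof.
have c1 : continuous (fun t : R => (1 + t ^+ 2)^-1) by exact: continuous_oneDsqrV.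
have i1 : mu.-integrable `[0, +oo[ (EFin \o (fun t : R => (1 + t ^+ 2)^-1)).
  apply/integrableP; split.
    by apply/measurable_EFinP; apply: measurable_funTS; exact: continuous_measurable_fun.
  have h t : 0 <= (1 + t ^+ 2)^-1 :> R by rewrite invr_ge0 addr_ge0 ?sqr_ge0.
  under eq_integral do rewrite /= ger0_norm//.
  by have := integral0y_oneDsqr R; rewrite /oneDsqr/= => ->; rewrite ltry.
have mI : measurable (`[0%R, +oo[ : set (measurableTypeR R)).
  exact: measurable_itv.
exact: (integrableZl mI M i1).
Qed.

Lemma cvg_Rintegral_itv0y (F : R -> R) : mu.-integrable `[0, +oo[ (EFin \o F) ->
  \int[mu]_(x in `[0, k.+1%:R]) F x @[k --> \oo] --> \int[mu]_(x in `[0, +oo[) F x.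
Proof.
move=> Fi; have mF : measurable_fun (`[0%R, +oo[ : set R) F.
  by apply/measurable_EFinP; exact: measurable_int Fi.
have -> : (fun k : nat => \int[mu]_(x in `[0, k.+1%:R]) F x) =
    (fun k : nat => \int[mu]_(x in `[0, +oo[) (F \_ `[0, k.+1%:R]) x).
  apply/funext => k; rewrite -Rintegral_mkcondr; congr Rintegral.
  apply/seteqP; split => x; rewrite /= !in_itv/=; last by case.
  by move=> /andP[x0 xk]; rewrite x0 xk.
apply: (@Rintegral_dominated_cvg _ _ _ mu _ _ F (fun x => `|F x|)) => //.
- move=> k; apply/measurable_restrict => //.
  by apply: measurable_funS mF => // x [].
- move=> x; rewrite /= in_itv/= andbT => x0; apply: cvg_near_cst.
  near=> k; rewrite patchE mem_set//= in_itv/= x0/=.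
  rewrite (@le_trans _ _ k%:R)//; last by rewrite ler_nat.
  by near: k; exact: nbhs_infty_ger.
- by have := integrable_norm Fi.
- by move=> n x _; rewrite patchE; case: ifPn => //; rewrite normr0.
Unshelve. all: by end_near. Qed.

(** The derivative is asked for at t > 0 only, since the functions u of interest contain sqrt t.
    Continuity at 0 supplies the boundary value. *)
Lemma FTC2y (u v : R -> R) (M : R) : continuous u -> continuous v ->
  (forall t : R, 0 < t -> is_derive t 1 u (v t)) ->
  (forall t : R, 0 <= t -> `|v t| <= M * (1 + t ^+ 2)^-1) ->
  u k.+1%:R @[k --> \oo] --> (0 : R) ->
  \int[mu]_(t in `[0, +oo[) v t = - u 0.
Proof.
move=> cu cv duv vM u0.
have vi : mu.-integrable `[0, +oo[ (EFin \o v).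
  apply: (dominated_Rintegrable _ _ (integrable_oneDsqrV M)) => //.
    by apply: measurable_funTS; exact: continuous_measurable_fun.
  by move=> x; rewrite /= in_itv/= andbT; exact: vM.
apply: (cvg_unique _ (cvg_Rintegral_itv0y vi)); first exact: Rhausdorff.
have -> : (fun k : nat => \int[mu]_(x in `[0, k.+1%:R]) v x) =
    (fun k : nat => u k.+1%:R - u 0).
  apply/funext => k; rewrite /Rintegral (continuous_FTC2 (F := u)) //.
  - by apply: continuous_subspaceT.
  - split.
    + by move=> x; rewrite in_itv/= => /andP[x0 _]; case: (duv x x0).
    + by apply: cvg_at_right_filter; exact: cu.
    + by apply: cvg_at_left_filter; exact: cu.
  - move=> x; rewrite in_itv/= => /andP[x0 _].
    exact: is_der_derive1 (duv x x0).
have h : (fun k : nat => u k.+1%:R - u 0) k @[k --> \oo] --> 0 - u 0.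
  by apply: cvgB => //; exact: cvg_cst.
by rewrite sub0r in h.
Qed.

End calculus_half_line.

Section schwartz_theory.
Context (R : realType) (N : nat).
Local Notation V := 'rV[R]_N.
Local Notation W := (R * V)%type.
Variable phi : W -> R.
Hypothesis sphi : schwartz phi.
Implicit Types (s : seq (option 'I_N)).

Local Notation D s := (iter_partial s phi).

Lemma schwartz_continuous s : continuous (D s).
Proof. by case: (sphi s). Qed.

Lemma schwartz_derivable s o q : derivable (D s) q (dir R o).
Proof. by case: (sphi s). Qed.

(** Only the weight in time is kept: in space all integrals are taken against probabilities, for
    which a uniform bound suffices. *)
Lemma schwartz_decay s k : exists M, forall p : W,
  (1 + `|p.1|) ^+ k * `|D s p| <= M.
Proof.
have [_ _ /(_ k)[M [_ h]]] := sphi s.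
have := h (M + 1); rewrite ltrDl ltr01 => /(_ isT) hM.
exists (M + 1) => p; have := hM p I; rewrite /= normrM => h'.
have e0 : 0 <= enorm p.2 by exact: sqrtr_ge0.
rewrite (le_trans _ h')// ler_wpM2r// ger0_norm; last first.
  by rewrite exprn_ge0// addr_ge0// addr_ge0.
by rewrite lerXn2r ?nnegrE ?addr_ge0// lerDl.
Qed.

Lemma schwartz_bounded s : exists M, forall p : W, `|D s p| <= M.
Proof.
by have [M h] := schwartz_decay s 0; exists M => p; have := h p; rewrite expr0 mul1r.
Qed.

Lemma continuous_pair_rV (T : topologicalType) (f : T -> R) (g : T -> V) :
  continuous f -> (forall i, continuous (fun t => g t ord0 i)) ->
  continuous (fun t => (f t, g t)).
Proof.
move=> cf cg t; have cg' : {for t, continuous g}.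
  by apply: continuous_rV => i; exact: cg.
exact: (cvg_pair (cf t) cg').
Qed.

Lemma schwartz_path_continuous s (T : topologicalType) (f : T -> R) (g : T -> V) :
  continuous f -> (forall i, continuous (fun t => g t ord0 i)) ->
  continuous (fun t => D s (f t, g t)).
Proof.
move=> cf cg t.
have h1 : {for t, continuous (fun t => (f t, g t))} by exact: continuous_pair_rV.
have h2 : {for (f t, g t), continuous (D s)} by exact: schwartz_continuous.
exact: (continuous_comp h1 h2).
Qed.

Lemma scaled_coord_continuous c i : continuous (fun x : V => (c *: x) ord0 i).
Proof.
under eq_fun do rewrite mxE.
by apply: contM; [exact: cont_cst|exact: coord_continuous_rV].
Qed.

Lemma schwartz_slice_Cb s t c : Cb (fun x : V => D s (t, c *: x)).
Proof.
have [M h] := schwartz_bounded s; apply: (@Cb_bound _ _ _ M) => //.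
apply: schwartz_path_continuous; first exact: cont_cst.
by move=> i; exact: scaled_coord_continuous.
Qed.

Lemma schwartz_slice_C1b s t c :
  C1b (fun x : V => D s (t, c *: x))
    (fun k x => c * D (Some k :: s) (t, c *: x)).
Proof.
split; [exact: schwartz_slice_Cb|by move=> k; apply: CbZ; exact: schwartz_slice_Cb|].
move=> x v r.
have h := @partial_chain_rule R N (D s) (fun=> t) (fun r => c *: (x + r *: v)) r 0
  (c *: v) (fun o q => @schwartz_derivable s o q) (fun o => @schwartz_continuous (o :: s)) (is_der_cst t r).
apply: is_der_eq.
  apply: h => i.
  have := is_derZ c (is_derD (is_der_cst (x ord0 i) r)
    (is_derM (is_der_id r) (is_der_cst (v ord0 i) r))).
  rewrite mulr0 addr0 mul1r add0r => h.
  by rewrite mxE; under eq_fun do rewrite !mxE.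
rewrite mul0r add0r; apply: eq_bigr => k _.
by rewrite mxE mulrA (mulrC c).
Qed.

Lemma divergence_schwartz (A : 'M[R]_N) (p : W) :
  divergence (fun q => A *m grad phi q) p =
  \sum_i \sum_j A i j * D [:: Some i; Some j] p.
Proof.
apply: eq_bigr => i _; rewrite /partial.
have -> : (fun q => (A *m grad phi q) i ord0) =
    \sum_j (fun q => A i j *: D [:: Some j] q).
  apply/funext => q; rewrite fct_sumE !mxE; apply: eq_bigr => j _; rewrite mxE.
  by [].
have dj j : derivable (fun q => A i j *: D [:: Some j] q) p (dir R (Some i)).
  by apply: derivableZ; exact: schwartz_derivable.
rewrite derive_sum//; apply: eq_bigr => j _.
rewrite deriveZ//; exact: schwartz_derivable.
Qed.

End schwartz_theory.

(** * Existence for the heat equation *)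

Section heat_existence.
Context (R : realType) (N : nat).
Local Notation V := 'rV[R]_N.
Local Notation W := (R * V)%type.
Local Notation sqrt := Num.sqrt.

Lemma bounded_param_continuous d (T : measurableType d) (p : probability T R)
    (F : R -> T -> R) (M : R) : (forall t, measurable_fun setT (F t)) ->
  (forall x, continuous (F ^~ x)) -> (forall t x, `|F t x| <= M) ->
  continuous (fun t => \int[p]_x F t x).
Proof.
move=> mF cF FM t.
apply: (@continuity_under_integral _ _ _ p F setT measurableT (t - 1) (t + 1)
   _ _ (fun=> M)).
- by move=> s _; apply: (@bounded_integrable _ _ _ p setT (F s) M).
- by apply: aeW => x _ s _; exact: cF.
- apply: (@bounded_integrable _ _ _ p setT (fun=> M) `|M|) => //.
- by move=> s _; apply: aeW => x _; exact: FM.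
- by rewrite inE/= in_itv/= ltrDl ltr01 gtrDl ltrN10.
Qed.

Lemma scale_measurable (c : R) : measurable_fun setT (fun x : V => c *: x).
Proof.
apply: measurable_rV => i; under eq_fun do rewrite mxE.
by apply: measurable_funM => //; exact: measurable_coord.
Qed.

Lemma sqrt_cont : continuous (sqrt : R -> R).
Proof. by move=> x; exact: sqrt_continuous. Qed.

Lemma Cb_scale (f : V -> R) (c : R) : Cb f -> Cb (fun x => f (c *: x)).
Proof.
move=> /CbP[cf [M fM]]; apply: (@Cb_bound _ _ _ M) => // x.
have h1 : {for x, continuous (fun x : V => c *: x)}.
  by apply: continuous_rV => i; exact: scaled_coord_continuous.
have h2 : {for c *: x, continuous f} by exact: cf.
exact: (continuous_comp h1 h2).
Qed.

Lemma Cb_sum (I : Type) (s : seq I) (f : I -> V -> R) :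
  (forall i, Cb (f i)) -> Cb (fun x => \sum_(i <- s) f i x).
Proof.
move=> cf; elim: s => [|i s ih].
  by under eq_fun do rewrite big_nil; exact: Cb_cst.
by under eq_fun do rewrite big_cons; exact: CbD.
Qed.

Variables (A : 'M[R]_N) (G : probability V R).
Hypotheses (hG : gaussian G A) (sA : A^T = A).

(** [Num.sqrt] is 0 on negative numbers, so the law is the unit mass at 0 for all t <= 0 and the
    path is narrowly continuous on the whole line. *)
Definition heat_law (t : R) : probability V R :=
  law G (scale_measurable (sqrt t)).

Lemma heat_law_integral t (f : V -> R) : Cb f ->
  \int[heat_law t]_x f x = \int[G]_x f (sqrt t *: x).
Proof.
move=> cf; rewrite Rintegral_law//; first exact: Cb_measurable.
by apply: (@Cb_integrable _ _ G (fun x => f (sqrt t *: x))); exact: Cb_scale.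
Qed.

Lemma sqrt_path_continuous (x : V) i : continuous (fun t : R => (sqrt t *: x) ord0 i).
Proof.
under eq_fun do rewrite mxE.
by apply: contM; [exact: sqrt_cont|exact: cont_cst].
Qed.

Lemma heat_law_narrow_continuous (I : set R) : narrow_continuous I heat_law.
Proof.
move=> f cf; apply: continuous_subspaceT => t.
have /CbP[cf' [M fM]] := cf.
under eq_fun do rewrite heat_law_integral//.
apply: (@bounded_param_continuous _ _ G (fun t x => f (sqrt t *: x)) M).
- by move=> s; apply: Cb_measurable; exact: Cb_scale.
- move=> x s.
  have h1 : {for s, continuous (fun s => sqrt s *: x)}.
    by apply: continuous_rV => i; exact: sqrt_path_continuous.
  have h2 : {for sqrt s *: x, continuous f} by exact: cf'.
  exact: (continuous_comp h1 h2).
- by move=> s x; exact: fM.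
Qed.

Section solution.
Variable phi : W -> R.
Hypothesis sphi : schwartz phi.
Local Notation D s := (iter_partial s phi).

Let L (p : W) : R :=
  D [:: None] p + 2^-1 * \sum_i \sum_j A i j * D [:: Some i; Some j] p.

Let u (t : R) := \int[G]_x phi (t, sqrt t *: x).
Let v (t : R) := \int[G]_x L (t, sqrt t *: x).

Let L_Cb t c : Cb (fun x : V => L (t, c *: x)).
Proof.
apply: CbD; first exact: (schwartz_slice_Cb sphi [:: None]).
apply: CbZ; apply: Cb_sum => i; apply: Cb_sum => j; apply: CbZ.
exact: (schwartz_slice_Cb sphi [:: Some i; Some j]).
Qed.

Let Lpath_continuous (x : V) : continuous (fun t => L (t, sqrt t *: x)).
Proof.
apply: contD.
  apply: (schwartz_path_continuous sphi (s := [:: None])) => [t|i]; first exact: cvg_id.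
  exact: sqrt_path_continuous.
apply: contM; first exact: cont_cst.
apply: cont_sum => i; apply: cont_sum => j; apply: contM; first exact: cont_cst.
apply: (schwartz_path_continuous sphi (s := [:: Some i; Some j])) => [t|k].
  exact: cvg_id.
exact: sqrt_path_continuous.
Qed.

Let L_decay : exists M, forall t x, `|L (t, x)| <= M * (1 + t ^+ 2)^-1.
Proof.
have h s : exists M, forall t x, `|D s (t, x)| <= M * (1 + t ^+ 2)^-1.
  have [M hM] := schwartz_decay sphi s 2; exists M => t x.
  have t1 : 0 < 1 + t ^+ 2 by rewrite ltr_pwDl// sqr_ge0.
  rewrite ler_pdivlMr// mulrC (le_trans _ (hM (t, x)))// ler_wpM2r//=.
  rewrite -(real_normK (num_real t)) sqrrD expr1n mul1r.
  by rewrite -addrA lerD2l lerDr mulrn_wge0.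
exists (sval (cid (h [:: None])) + 2^-1 * \sum_i \sum_j `|A i j| *
  sval (cid (h [:: Some i; Some j]))) => t x.
rewrite mulrDl (le_trans (ler_normD _ _))// lerD//.
  exact: (svalP (cid (h [:: None]))).
rewrite normrM ger0_norm ?invr_ge0// -mulrA ler_wpM2l ?invr_ge0//.
rewrite mulr_suml (le_trans (ler_norm_sum _ _ _))//; apply: ler_sum => i _.
rewrite mulr_suml (le_trans (ler_norm_sum _ _ _))//; apply: ler_sum => j _.
rewrite normrM -mulrA ler_wpM2l//.
exact: (svalP (cid (h [:: Some i; Some j]))).
Qed.

(** Differentiating phi (t, sqrt t x) in t gives a term (2 sqrt t)^-1 x.grad phi. Stein's identity
    replaces x_j by second derivatives with coefficients A j k, and the chain rule in x contributes
    a factor sqrt t that leaves exactly 1/2; the symmetry of A puts the indices in the order of the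
    divergence. *)
Let stein_L (t : R) : 0 < t ->
  \int[G]_x (D [:: None] (t, sqrt t *: x) +
    \sum_j (2 * sqrt t)^-1 * (x ord0 j * D [:: Some j] (t, sqrt t *: x))) = v t.
Proof.
move=> t0; have s0 : 0 < sqrt t by rewrite sqrtr_gt0.
have [gi gs] := hG.
have iD0 : G.-integrable setT (EFin \o (fun x => D [:: None] (t, sqrt t *: x))).
  by apply: Cb_integrable; exact: (schwartz_slice_Cb sphi [:: None]).
have ij j : G.-integrable setT
    (EFin \o (fun x : V => x ord0 j * D [:: Some j] (t, sqrt t *: x))).
  apply: (integrable_coordM (gi j)); exact: (schwartz_slice_Cb sphi [:: Some j]).
have ij' j : G.-integrable setT
    (EFin \o (fun x : V => (2 * sqrt t)^-1 * (x ord0 j * D [:: Some j] (t, sqrt t *: x)))).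
  exact: (integrableZl measurableT _ (ij j)).
have iD i j : G.-integrable setT
    (EFin \o (fun x => D [:: Some i; Some j] (t, sqrt t *: x))).
  by apply: Cb_integrable; exact: (schwartz_slice_Cb sphi [:: Some i; Some j]).
have iAD i j : G.-integrable setT
    (EFin \o (fun x => A i j * D [:: Some i; Some j] (t, sqrt t *: x))).
  exact: (integrableZl measurableT _ (iD i j)).
have isum (I : finType) (f : I -> V -> R) :
    (forall i, G.-integrable setT (EFin \o f i)) ->
    G.-integrable setT (EFin \o (fun x => \sum_i f i x)).
  move=> fi; have -> : EFin \o (fun x => \sum_i f i x) =
      (fun x => \sum_i (EFin \o f i) x)%E by apply/funext => x /=; rewrite sumEFin.
  by apply: integrable_sum => // i; exact: fi.
have iADs i := isum _ _ (iAD i).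
rewrite /v RintegralD//; last exact: isum.
rewrite [RHS]RintegralD//; last first.
  exact: (integrableZl measurableT 2^-1 (isum _ _ iADs)).
congr (_ + _); rewrite Rintegral_sum// RintegralZl//; last exact: isum.
rewrite Rintegral_sum//.
under [in RHS]eq_bigr do rewrite Rintegral_sum//.
rewrite exchange_big/= mulr_sumr; apply: eq_bigr => j _.
rewrite RintegralZl// (gs _ _ (schwartz_slice_C1b sphi [:: Some j] t (sqrt t))).
rewrite !mulr_sumr; apply: eq_bigr => k _.
rewrite !RintegralZl//.
have -> : A k j = A j k by rewrite -{1}sA mxE.
  by rewrite /=; field; rewrite gt_eqF.
exact: (iD k j).
Qed.

Let du (t : R) : 0 < t -> is_derive t 1 u (v t).
Proof.
move=> t0; rewrite -stein_L//; have [gi gs] := hG.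
have [M0 hM0] := schwartz_bounded sphi [:: None].
have hM j := schwartz_bounded sphi [:: Some j].
(* The factor (2 sqrt s)^-1 blows up at 0, but is at most K on the neighbourhood (t / 2, t + 1)
   where domination is required. *)
pose K := (2 * sqrt (t / 2))^-1.
have t2 : 0 < t / 2 by lra.
have K0 : 0 <= K by rewrite invr_ge0 mulr_ge0// sqrtr_ge0.
pose Gd (x : V) := M0 + \sum_j K * sval (cid (hM j)) * `|x ord0 j|.
have iGd : G.-integrable setT (EFin \o Gd).
  have i1 : G.-integrable setT (EFin \o (fun x : V =>
      \sum_j K * sval (cid (hM j)) * `|x ord0 j|)).
    have -> : EFin \o (fun x : V => \sum_j K * sval (cid (hM j)) * `|x ord0 j|) =
        (fun x => \sum_j (EFin \o (fun x : V => (K * sval (cid (hM j)) * `|x ord0 j|)%R)) x)%E.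
      by apply/funext => x /=; rewrite sumEFin.
    have ij j : G.-integrable setT
        (EFin \o (fun x : V => K * sval (cid (hM j)) * `|x ord0 j|)).
      have := integrableZl measurableT (K * sval (cid (hM j))) (integrable_norm (gi j)).
      by [].
    by apply: integrable_sum => // j; exact: ij.
  have i0 : G.-integrable setT (EFin \o (fun _ : V => M0)).
    by apply: (@Cb_integrable _ _ G (fun=> M0)); exact: Cb_cst.
  exact: (integrableD measurableT i0 i1).
apply: (@is_der_integral _ _ _ G setT (fun s x => phi (s, sqrt s *: x))
  (fun s x => D [:: None] (s, sqrt s *: x) +
    \sum_j (2 * sqrt s)^-1 * (x ord0 j * D [:: Some j] (s, sqrt s *: x)))
  Gd t (t / 2) (t + 1)) => //.
- by apply/andP; split; lra.
- by move=> s _; apply: Cb_integrable; exact: (schwartz_slice_Cb sphi [::]).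
- move=> s x /andP[s1 _] _; have s0 : 0 < s by lra.
  have h := @partial_chain_rule R N phi id (fun s => sqrt s *: x) s 1
    ((2 * sqrt s)^-1 *: x) (fun o q => @schwartz_derivable _ _ _ sphi [::] o q)
    (fun o => @schwartz_continuous _ _ _ sphi [:: o]) (is_der_id s).
  apply: is_der_eq.
    apply: h => i; under eq_fun do rewrite mxE.
    have := is_derM (is_derive1_sqrt s0) (is_der_cst (x ord0 i) s).
    by rewrite mulr0 addr0 mxE.
  rewrite mul1r; congr (_ + _); apply: eq_bigr => j _.
  by rewrite mxE mulrA.
- move=> s x /andP[s1 _] _; have s0 : 0 < s by lra.
  rewrite /Gd (le_trans (ler_normD _ _))//; apply: lerD; first exact: hM0.
  rewrite (le_trans (ler_norm_sum _ _ _))//; apply: ler_sum => j _.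
  have i0 : 0 <= (2 * sqrt s)^-1 by rewrite invr_ge0 mulr_ge0// sqrtr_ge0.
  rewrite 2!normrM (ger0_norm i0) mulrCA [leRHS]mulrC; apply: ler_wpM2l => //.
  apply: ler_pM => //.
    by rewrite lef_pV2 ?posrE ?mulr_gt0 ?sqrtr_gt0// ler_pM2l// ler_wsqrtr// ltW.
  exact: (svalP (cid (hM j))).
Qed.

Lemma heat_law_test :
  \int[lebesgue_measure]_(t in `[0%R, +oo[)
    (\int[heat_law t]_x (partial None phi (t, x)
       + 2^-1 * divergence (fun q => A *m grad phi q) (t, x))) = - phi (0, 0).
Proof.
have [M hM] := L_decay.
have [M1 hM1] := schwartz_bounded sphi [::].
have E t : \int[heat_law t]_x (partial None phi (t, x)
       + 2^-1 * divergence (fun q => A *m grad phi q) (t, x)) = v t.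
  under eq_Rintegral do rewrite (divergence_schwartz sphi).
  rewrite (heat_law_integral t (f := fun x => L (t, x)))//.
  have -> : (fun x => L (t, x)) = (fun x => L (t, 1 *: x)).
    by apply/funext => x; rewrite scale1r.
  exact: L_Cb.
under eq_Rintegral do rewrite E.
have cu : continuous u.
  apply: (@bounded_param_continuous _ _ G (fun t x => phi (t, sqrt t *: x)) M1).
  - by move=> t; apply: Cb_measurable; exact: (schwartz_slice_Cb sphi [::]).
  - move=> x; apply: (schwartz_path_continuous sphi (s := [::])) => [t|k].
      exact: cvg_id.
    exact: sqrt_path_continuous.
  - by move=> t x; exact: hM1.
have t1 (t : R) : 1 <= 1 + t ^+ 2 by rewrite lerDl sqr_ge0.
have cv : continuous v.
  apply: (@bounded_param_continuous _ _ G (fun t x => L (t, sqrt t *: x)) `|M|).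
  - by move=> t; apply: Cb_measurable; exact: L_Cb.
  - by move=> x; exact: Lpath_continuous.
  - move=> t x; rewrite (le_trans (hM _ _))// (le_trans (ler_norm _))// normrM.
    rewrite ler_piMr// ger0_norm ?invr_ge0 ?(le_trans _ (t1 t))//.
    by rewrite invf_le1// (lt_le_trans _ (t1 t)).
rewrite (FTC2y cu cv du (M := M)).
- rewrite /u; under eq_Rintegral do rewrite sqrtr0 scale0r.
  by rewrite Rintegral_pcst.
- move=> t _; apply: prob_norm_le; first by apply: Cb_measurable; exact: L_Cb.
  by move=> x; exact: hM.
have [M2 hM2] := schwartz_decay sphi [::] 1.
apply/norm_cvg0P.
apply: (@squeeze_cvgr _ _ _ _ (fun=> 0) (fun k : nat => M2 * k.+1%:R^-1)).
- apply: nearW => k; rewrite normr_ge0/=; apply: prob_norm_le.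
    by apply: Cb_measurable; exact: (schwartz_slice_Cb sphi [::]).
  move=> x; rewrite ler_pdivlMr// mulrC (le_trans _ (hM2 (k.+1%:R, sqrt k.+1%:R *: x)))//=.
  by rewrite expr1 ler_wpM2r// ger0_norm// lerDr.
- exact: cvg_cst.
- rewrite -[X in _ --> X](mulr0 M2).
  by apply: cvgM; [exact: cvg_cst|exact: cvg_harmonic].
Qed.

End solution.

Lemma heat_law_solution : heat_solution A heat_law.
Proof. by move=> phi sphi; exact: heat_law_test. Qed.

End heat_existence.

(** * A family of Schwartz functions *)

Section damped_trigonometric_polynomials.
Context (R : realType) (N : nat).
Local Notation V := 'rV[R]_N.
Local Notation W := (R * V)%type.
Implicit Types (f g P Q : W -> R) (p v : W) (a b c : R).

(** The Gaussian is split into k + 1 equal factors. Each of them absorbs one factor 1 + u, because u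
    <= 1 / (4 gm) + gm u^2 by completing the square. *)
Lemma expR_sqr_bound (k : nat) (dl : R) : 0 < dl ->
  exists C, forall u, 0 <= u -> (1 + u) ^+ k * expR (- (dl * u ^+ 2)) <= C.
Proof.
move=> dl0; pose gm := dl / k.+1%:R.
have gm0 : 0 < gm by rewrite divr_gt0.
pose c := 1 + (4 * gm)^-1.
have c1 : 1 <= c by rewrite lerDl invr_ge0 mulr_ge0// ltW.
exists (c ^+ k.+1) => u u0.
rewrite expRN ler_pdivrMr ?expR_gt0//.
have -> : dl * u ^+ 2 = k.+1%:R * (gm * u ^+ 2).
  by rewrite /gm; field; rewrite addrC natr1.
rewrite expRM_natl -exprMn.
have h : 1 + u <= c * expR (gm * u ^+ 2).
  apply: (@le_trans _ _ (c * (1 + gm * u ^+ 2))); last first.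
    by rewrite ler_wpM2l ?(le_trans ler01 c1)// expR_ge1Dx.
  have h1 : u <= (4 * gm)^-1 + gm * u ^+ 2.
    rewrite -subr_ge0.
    have -> : (4 * gm)^-1 + gm * u ^+ 2 - u = gm * (u - (2 * gm)^-1) ^+ 2.
      by field; rewrite gt_eqF.
    by rewrite mulr_ge0 ?(ltW gm0)// sqr_ge0.
  have h2 : 0 <= gm * u ^+ 2 by rewrite mulr_ge0 ?(ltW gm0)// sqr_ge0.
  have h3 : 0 <= (4 * gm)^-1 by rewrite invr_ge0 mulr_ge0// ltW.
  by rewrite /c; nra.
apply: (@le_trans _ _ ((1 + u) ^+ k.+1)).
  by rewrite exprS ler_peMl ?exprn_ge0 ?addr_ge0// lerDl.
by rewrite lerXn2r ?nnegrE ?addr_ge0// mulr_ge0 ?expR_ge0// (le_trans ler01 c1).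
Qed.

Lemma enorm_ge0 (x : V) : 0 <= enorm x. Proof. exact: sqrtr_ge0. Qed.

Lemma enorm_sqr (x : V) : enorm x ^+ 2 = dotv x x.
Proof.
rewrite /enorm sqr_sqrtr; last by apply: sumr_ge0 => i _; rewrite sqr_ge0.
by apply: eq_bigr => i _; rewrite expr2.
Qed.

Lemma coord_le_enorm (x : V) i : `|x ord0 i| <= enorm x.
Proof.
rewrite -(@ler_pXn2r _ 2)// ?nnegrE ?enorm_ge0//.
by rewrite enorm_sqr real_normK ?num_real//; exact: dotv_ge_coord.
Qed.

(** A directional derivative is an ordinary derivative at 0 along a line; the calculus rules on the
    real line transfer through this equivalence. *)
Lemma is_derive_lineP f p v a :
  is_derive (0 : R) 1 (fun s => f (p + s *: v)) a <-> is_derive p v f a.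
Proof.
have E : (fun h : R => h^-1 *: (((fun s => f (p + s *: v)) \o shift 0) (h *: 1)
   - f (p + 0 *: v))) = (fun h => h^-1 *: ((f \o shift p) (h *: v) - f p)).
  apply/funext => h; rewrite /= scale0r addr0 /GRing.scale/= mulr1 addr0.
  by rewrite [p + _]addrC.
split=> -[h1 h2]; split.
- by rewrite /derivable -E; exact: h1.
- by rewrite /derive -E; exact: h2.
- by rewrite /derivable E; exact: h1.
- by rewrite /derive E; exact: h2.
Qed.

Section rules.
Variables (p v : W).

Lemma dir_derD f g a b : is_derive p v f a -> is_derive p v g b ->
  is_derive p v (fun q => f q + g q) (a + b).
Proof. by move=> /is_derive_lineP h1 /is_derive_lineP h2; apply/is_derive_lineP; exact: is_derD. Qed.

Lemma dir_derN f a : is_derive p v f a -> is_derive p v (fun q => - f q) (- a).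
Proof. by move=> /is_derive_lineP h1; apply/is_derive_lineP; exact: is_derN. Qed.

Lemma dir_derM f g a b : is_derive p v f a -> is_derive p v g b ->
  is_derive p v (fun q => f q * g q) (a * g p + f p * b).
Proof.
move=> /is_derive_lineP h1 /is_derive_lineP h2; apply/is_derive_lineP.
by have := is_derM h1 h2; rewrite scale0r addr0.
Qed.

Lemma dir_der_expR f a : is_derive p v f a ->
  is_derive p v (fun q => expR (f q)) (a * expR (f p)).
Proof.
move=> /is_derive_lineP h1; apply/is_derive_lineP.
by have := is_der_expR h1; rewrite scale0r addr0.
Qed.

Lemma dir_der_cos f a : is_derive p v f a ->
  is_derive p v (fun q => cos (f q)) (- (a * sin (f p))).
Proof.
move=> /is_derive_lineP h1; apply/is_derive_lineP.
by have := is_der_cos h1; rewrite scale0r addr0.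
Qed.

Lemma dir_der_sin f a : is_derive p v f a ->
  is_derive p v (fun q => sin (f q)) (a * cos (f p)).
Proof.
move=> /is_derive_lineP h1; apply/is_derive_lineP.
by have := is_der_sin h1; rewrite scale0r addr0.
Qed.

Lemma dir_der_cst c : is_derive p v (fun _ : W => c) 0.
Proof. by apply/is_derive_lineP; exact: is_der_cst. Qed.

Lemma dir_der_fst : is_derive p v (fun q : W => q.1) v.1.
Proof.
apply/is_derive_lineP.
have := is_derD (is_der_cst p.1 (0 : R)) (is_derM (is_der_id 0) (is_der_cst v.1 0)).
by rewrite mulr0 addr0 mul1r add0r.
Qed.

Lemma dir_der_coord i : is_derive p v (fun q : W => q.2 ord0 i) (v.2 ord0 i).
Proof.
apply/is_derive_lineP.
under eq_fun do rewrite !mxE.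
have := is_derD (is_der_cst (p.2 ord0 i) (0 : R))
  (is_derM (is_der_id 0) (is_der_cst (v.2 ord0 i) 0)).
by rewrite mulr0 addr0 mul1r add0r.
Qed.

Lemma dir_der_eq f a b : is_derive p v f a -> a = b -> is_derive p v f b.
Proof. by move=> h <-. Qed.

End rules.

(** Polynomial functions as an inductive predicate: stability under differentiation, continuity and
    polynomial growth each follow by induction on the construction. *)
Inductive polyW : (W -> R) -> Prop :=
| polyW_cst c : polyW (fun=> c)
| polyW_fst : polyW (fun p => p.1)
| polyW_coord i : polyW (fun p => p.2 ord0 i)
| polyWD P Q : polyW P -> polyW Q -> polyW (fun p => P p + Q p)
| polyWM P Q : polyW P -> polyW Q -> polyW (fun p => P p * Q p).

Lemma polyWN P : polyW P -> polyW (fun p => - P p).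
Proof.
move=> hP; have := polyWM (polyW_cst (-1)) hP.
by under eq_fun do rewrite mulN1r.
Qed.

Lemma polyWX P n : polyW P -> polyW (fun p => P p ^+ n).
Proof.
move=> hP; elim: n => [|n ih].
  by under eq_fun do rewrite expr0; exact: polyW_cst.
by under eq_fun do rewrite exprS; exact: polyWM.
Qed.

Lemma polyW_sum (I : Type) (s : seq I) (F : I -> W -> R) :
  (forall i, polyW (F i)) -> polyW (fun p => \sum_(i <- s) F i p).
Proof.
move=> hF; elim: s => [|i s ih].
  by under eq_fun do rewrite big_nil; exact: polyW_cst.
by under eq_fun do rewrite big_cons; exact: polyWD.
Qed.

Lemma polyW_partial P v : polyW P ->
  exists2 P', polyW P' & forall p, is_derive p v P (P' p).
Proof.
elim=> [c||i|{}P Q _ [P' hP' dP] _ [Q' hQ' dQ]|{}P Q hP [P' hP' dP] hQ [Q' hQ' dQ]].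
- by exists (fun=> 0); [exact: polyW_cst|move=> p; exact: dir_der_cst].
- by exists (fun=> v.1); [exact: polyW_cst|move=> p; exact: dir_der_fst].
- by exists (fun=> v.2 ord0 i); [exact: polyW_cst|move=> p; exact: dir_der_coord].
- by exists (fun p => P' p + Q' p); [exact: polyWD|move=> p; exact: dir_derD].
- exists (fun p => P' p * Q p + P p * Q' p); last by move=> p; exact: dir_derM.
  by apply: polyWD; exact: polyWM.
Qed.

Lemma polyW_continuous P : polyW P -> continuous P.
Proof.
elim=> [c||i|{}P Q _ cP _ cQ|{}P Q _ cP _ cQ].
- exact: cont_cst.
- by move=> p; exact: cvg_fst.
- move=> p.
  have h1 : {for p, continuous (snd : W -> V)} by exact: cvg_snd.
  have h2 : {for p.2, continuous (fun x : V => x ord0 i)}.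
    exact: coord_continuous_rV.
  exact: (continuous_comp h1 h2).
- exact: contD.
- exact: contM.
Qed.

Lemma polyW_growth P : polyW P -> exists C m, 0 <= C /\
  forall p, `|P p| <= C * (1 + (`|p.1| + enorm p.2)) ^+ m.
Proof.
have r1 p : 1 <= 1 + (`|p.1| + enorm p.2).
  by rewrite lerDl addr_ge0 ?enorm_ge0.
have r0 p : 0 <= 1 + (`|p.1| + enorm p.2) by rewrite (le_trans ler01 (r1 p)).
elim=> [c||i|{}P Q _ [C [m [C0 hC]]] _ [C' [m' [C'0 hC']]]
           |{}P Q _ [C [m [C0 hC]]] _ [C' [m' [C'0 hC']]]].
- by exists `|c|, 0%N; split => // p; rewrite expr0 mulr1.
- exists 1, 1%N; split => // p; rewrite mul1r expr1 addrCA lerDl.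
  by rewrite addr_ge0// enorm_ge0.
- exists 1, 1%N; split => // p; rewrite mul1r expr1 addrA.
  by rewrite (le_trans (coord_le_enorm _ _))// lerDr addr_ge0.
- exists (C + C'), (m + m')%N; split => [|p]; first exact: addr_ge0.
  rewrite (le_trans (ler_normD _ _))// mulrDl lerD//.
    by rewrite (le_trans (hC p))// ler_wpM2l// ler_weXn2l// leq_addr.
  by rewrite (le_trans (hC' p))// ler_wpM2l// ler_weXn2l// leq_addl.
- exists (C * C'), (m + m')%N; split => [|p]; first exact: mulr_ge0.
  by rewrite normrM exprD mulrACA ler_pM.
Qed.

Variables (theta psi : W -> R) (dl C0 : R).
Hypotheses (ptheta : polyW theta) (ppsi : polyW psi) (dl0 : 0 < dl).
Hypothesis psi_coercive : forall p,
  dl * (`|p.1| + enorm p.2) ^+ 2 - C0 <= psi p.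

(** Sine terms are included, although the function of interest has none, to obtain a class closed
    under partial derivatives. Membership then yields all the Schwartz conditions at once. *)
Let damped f := exists P Q, [/\ polyW P, polyW Q &
  f = fun p => (P p * cos (theta p) + Q p * sin (theta p)) * expR (- psi p)].

Let damped_partial f o : damped f ->
  damped (partial o f) /\ forall p, derivable f p (dir R o).
Proof.
move=> [P [Q [hP hQ ->]]].
have [P' hP' dP] := polyW_partial (dir R o) hP.
have [Q' hQ' dQ] := polyW_partial (dir R o) hQ.
have [th' hth' dth] := polyW_partial (dir R o) ptheta.
have [ps' hps' dps] := polyW_partial (dir R o) ppsi.
pose P2 p := P' p + Q p * th' p + - (P p * ps' p).
pose Q2 p := Q' p + - (P p * th' p) + - (Q p * ps' p).
have d p : is_derive p (dir R o)
    (fun p => (P p * cos (theta p) + Q p * sin (theta p)) * expR (- psi p))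
    ((P2 p * cos (theta p) + Q2 p * sin (theta p)) * expR (- psi p)).
  have h := dir_derM (dir_derD (dir_derM (dP p) (dir_der_cos (dth p)))
      (dir_derM (dQ p) (dir_der_sin (dth p)))) (dir_der_expR (dir_derN (dps p))).
  by apply: (dir_der_eq h); rewrite /P2 /Q2; ring.
split; last by move=> p; case: (d p).
exists P2, Q2; split.
- apply: polyWD; last by apply: polyWN; exact: polyWM.
  by apply: polyWD => //; exact: polyWM.
- apply: polyWD; last by apply: polyWN; exact: polyWM.
  by apply: polyWD => //; apply: polyWN; exact: polyWM.
- by apply/funext => p; rewrite /partial; case: (d p).
Qed.

Let damped_continuous f : damped f -> continuous f.
Proof.
move=> [P [Q [hP hQ ->]]]; apply: contM.
  by apply: contD; apply: contM; try exact: polyW_continuous;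
    [apply: cont_cos|apply: cont_sin]; exact: polyW_continuous.
by apply: cont_expR; apply: contN; exact: polyW_continuous.
Qed.

Let damped_decay f k : damped f -> bounded_fun (fun p : W =>
  (1 + `|p.1| + enorm p.2) ^+ k * f p).
Proof.
move=> [P [Q [hP hQ ->]]].
have [C [m [C1 hC]]] := polyW_growth hP.
have [C' [m' [C1' hC']]] := polyW_growth hQ.
have [B hB] := expR_sqr_bound (k + (m + m')) dl0.
exists ((C + C') * expR C0 * B); split; first exact: num_real.
move=> r Br p _ /=; rewrite (le_trans _ (ltW Br))//.
rewrite -addrA; set u := `|p.1| + enorm p.2.
have u0 : 0 <= u by rewrite addr_ge0 ?enorm_ge0.
have u1 : 1 <= 1 + u by rewrite lerDl.
have u10 : 0 <= 1 + u by rewrite addr_ge0.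
have hPQ : `|P p * cos (theta p) + Q p * sin (theta p)| <=
    (C + C') * (1 + u) ^+ (m + m').
  rewrite (le_trans (ler_normD _ _))// mulrDl lerD//.
    rewrite normrM -[leRHS]mulr1 ler_pM//; last by rewrite ler_norml cos_geN1 cos_le1.
    by rewrite (le_trans (hC p))// ler_wpM2l// ler_weXn2l// leq_addr.
  rewrite normrM -[leRHS]mulr1 ler_pM//; last by rewrite ler_norml sin_geN1 sin_le1.
  by rewrite (le_trans (hC' p))// ler_wpM2l// ler_weXn2l// leq_addl.
have hE : expR (- psi p) <= expR C0 * expR (- (dl * u ^+ 2)).
  by rewrite -expRD ler_expR; have := psi_coercive p; rewrite -/u; lra.
rewrite !normrM (ger0_norm (expR_ge0 _)) (ger0_norm (exprn_ge0 _ u10)).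
apply: (@le_trans _ _ ((1 + u) ^+ k * ((C + C') * (1 + u) ^+ (m + m') *
    (expR C0 * expR (- (dl * u ^+ 2)))))).
  by apply: ler_wpM2l; [exact: exprn_ge0|apply: ler_pM => //; exact: expR_ge0].
have -> : (1 + u) ^+ k * ((C + C') * (1 + u) ^+ (m + m') *
    (expR C0 * expR (- (dl * u ^+ 2)))) =
  (C + C') * expR C0 * ((1 + u) ^+ (k + (m + m')) * expR (- (dl * u ^+ 2))).
  by rewrite (exprD _ k); ring.
by apply: ler_wpM2l; [rewrite mulr_ge0 ?addr_ge0 ?expR_ge0|exact: hB].
Qed.

Lemma schwartz_damped : schwartz (fun p => cos (theta p) * expR (- psi p)).
Proof.
have h0 : damped (fun p => cos (theta p) * expR (- psi p)).
  exists (fun=> 1), (fun=> 0); split; [exact: polyW_cst..|].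
  by apply/funext => p; rewrite mul1r mul0r addr0.
move=> s; have h : damped (iter_partial s (fun p => cos (theta p) * expR (- psi p))).
  by elim: s => //= o s ih; case: (damped_partial o ih).
split; first exact: damped_continuous.
  by move=> o; case: (damped_partial o h).
by move=> k; exact: damped_decay.
Qed.

End damped_trigonometric_polynomials.

(** * Time cutoffs and their concentration *)

Section cutoff.
Context (R : realType).
Local Notation mu := (@lebesgue_measure R).
Implicit Types (b t : R).

(** Composition with a continuous map into D, such as t |-> |t| or a clipping, turns continuity
    relative to D into continuity everywhere, so that results on globally continuous functions
    apply. *)
Lemma within_comp_continuous (T U : topologicalType) (D : set U) (g : T -> U)
    (f : U -> R) : {within D, continuous f} -> continuous g -> (forall y, D (g y)) ->
  continuous (fun y => f (g y)).
Proof.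
move=> /subspace_continuousP cf cg Dg t.
apply: (@cvg_comp _ _ _ g f _ (within D (nbhs (g t)))); last exact: cf.
move=> B; rewrite /within/= => nB.
have : \forall s \near t, D (g s) -> B (g s) by exact: (cg t _ nB).
by apply: filterS => s; apply.
Qed.

Lemma within_norm_continuous (g : R -> R) :
  {within `[0, +oo[, continuous g} -> continuous (fun t : R => g `|t|).
Proof.
move=> cg; apply: (within_comp_continuous (g := fun t : R => `|t|) cg) => t.
  by apply: (@cont_norm R R (fun t => t)) => s; exact: cvg_id.
by rewrite /= in_itv/= normr_ge0.
Qed.

(** The almost everywhere version serves the cutoffs, whose value at t = b is exp (- 1) for every n,
    whereas the indicator of [0, b] is 1 there. *)
Lemma Rintegral_dominated_cvg_ae d (T : measurableType d)
    (m : {measure set T -> \bar R}) (D : set T)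
    (fs : nat -> T -> R) (f g : T -> R) : measurable D ->
  (forall n, measurable_fun D (fs n)) -> measurable_fun D f ->
  {ae m, forall x, D x -> fs n x @[n --> \oo] --> f x} ->
  m.-integrable D (EFin \o g) ->
  (forall n x, D x -> `|fs n x| <= g x) ->
  \int[m]_(x in D) fs n x @[n --> \oo] --> \int[m]_(x in D) f x.
Proof.
move=> mD mfs mf fsf ig fsg.
have h1 : {ae m, forall x, D x -> (fs n x)%:E @[n --> \oo] --> (f x)%:E}.
  apply: filterS fsf => x h Dx.
  by apply: cvg_EFin; [exact: nearW|exact: h].
have h2 : {ae m, forall x, forall n, D x -> (`|(fs n x)%:E| <= (g x)%:E)%E}.
  by apply: aeW => x n Dx; rewrite /= lee_fin fsg.
have [ifx _ h] := dominated_convergence mD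
  (fun n => (measurable_EFinP _ _).2 (mfs n)) ((measurable_EFinP _ _).2 mf)
  h1 ig h2.
apply: fine_cvg.
by rewrite /Rintegral fineK//; exact: integrable_fin_num.
Qed.

Lemma continuous_Rintegrable0y (f : R -> R) (M : R) : continuous f ->
  (forall t : R, 0 <= t -> `|f t| <= M * (1 + t ^+ 2)^-1) ->
  mu.-integrable `[0, +oo[ (EFin \o f).
Proof.
move=> cf fM; apply: (dominated_Rintegrable _ _ (integrable_oneDsqrV M)) => //.
  by apply: measurable_funTS; exact: continuous_measurable_fun.
by move=> t; rewrite /= in_itv/= andbT; exact: fM.
Qed.

(* A smooth replacement for the indicator of [0, b], approached as n grows, for
   which the test functions of the uniqueness proof are Schwartz. *)
Definition cutoff (b : R) (n : nat) (t : R) : R :=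
  expR (- ((t * b^-1) ^+ 2) ^+ n.+1).

Definition dcutoff (b : R) (n : nat) (t : R) : R :=
  - (n.+1%:R * ((t * b^-1) ^+ 2) ^+ n * (2 * (t * b^-1) * b^-1)) * cutoff b n t.

Lemma is_der_cutoff b n (t : R) : is_derive t 1 (cutoff b n) (dcutoff b n t).
Proof.
have h1 := is_derM (is_der_id t) (is_der_cst b^-1 t).
have h2 := is_der_comp (g := fun s => s * b^-1) (is_der_exprn 2 _) h1.
have h3 := is_der_comp (g := fun s => (s * b^-1) ^+ 2) (is_der_exprn n.+1 _) h2.
apply: (is_der_eq (is_der_expR (is_derN h3))).
by rewrite /dcutoff /= mulr0 addr0 mul1r expr1 mulrA.
Qed.

Lemma cutoff_continuous b n : continuous (cutoff b n).
Proof. by move=> t; exact: is_der_cont (is_der_cutoff b n t). Qed.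

Lemma dcutoff_continuous b n : continuous (dcutoff b n).
Proof.
have c1 : continuous (fun t : R => t * b^-1).
  by apply: contM; [move=> t; exact: cvg_id|exact: cont_cst].
have cX m : continuous (fun t : R => t ^+ m) by exact: exprn_continuous.
apply: contM; last exact: cutoff_continuous.
apply: contN; apply: contM.
  apply: contM; first exact: cont_cst.
  exact: (cont_comp (cX n) (cont_comp (cX 2) c1)).
apply: contM; last exact: cont_cst.
by apply: contM => //; exact: cont_cst.
Qed.

Lemma cutoff_ge0 b n t : 0 <= cutoff b n t. Proof. exact: expR_ge0. Qed.

Lemma dcutoff_le0 b n t : 0 < b -> 0 <= t -> dcutoff b n t <= 0.
Proof.
move=> b0 t0; rewrite /dcutoff mulNr oppr_le0 mulr_ge0 ?cutoff_ge0//.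
have tb : 0 <= t * b^-1 by rewrite mulr_ge0// invr_ge0 ltW.
by rewrite !mulr_ge0 ?exprn_ge0 ?sqr_ge0// ?invr_ge0 ?ltW.
Qed.

Lemma sqr_le_exprn (s : R) n : 0 <= s -> s - 1 <= s ^+ n.+1.
Proof.
move=> s0; have [s1|s1] := leP 1 s.
  by rewrite (@le_trans _ _ s)//; [lra|rewrite exprS ler_peMr// exprn_ege1].
by rewrite (@le_trans _ _ 0) ?exprn_ge0//; lra.
Qed.

(** From s^(n+1) >= s - 1 for s >= 0. The bound is independent of n and provides the majorants for
    the limit in n. *)
Lemma cutoff_gauss b n t : cutoff b n t <= expR 1 * expR (- (t * b^-1) ^+ 2).
Proof.
rewrite -expRD ler_expR; have := sqr_le_exprn n (sqr_ge0 (t * b^-1)); lra.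
Qed.

Lemma cutoff_decay b (k : nat) : 0 < b -> exists C, forall n t, 0 <= t ->
  (1 + t) ^+ k * cutoff b n t <= C.
Proof.
move=> b0; have d0 : 0 < b^-1 ^+ 2 by rewrite exprn_gt0// invr_gt0.
have [C hC] := expR_sqr_bound k d0.
exists (expR 1 * C) => n t t0.
have t1 : 0 <= (1 + t) ^+ k by rewrite exprn_ge0// addr_ge0.
apply: (le_trans (ler_wpM2l t1 (cutoff_gauss b n t))).
rewrite mulrCA ler_pM2l ?expR_gt0// exprMn.
by have := hC t t0; rewrite (mulrC (b^-1 ^+ 2)).
Qed.

Lemma dcutoff_decay b n (k : nat) : 0 < b -> exists C, forall t, 0 <= t ->
  (1 + t) ^+ k * `|dcutoff b n t| <= C.
Proof.
move=> b0; have [C hC] := cutoff_decay (k + (2 * n).+1) b0.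
pose B := n.+1%:R * (b^-1 ^+ 2) ^+ n * (2 * b^-1 * b^-1).
have bV0 : 0 <= b^-1 by rewrite invr_ge0 ltW.
have B0 : 0 <= B by rewrite /B !mulr_ge0 ?exprn_ge0 ?sqr_ge0.
exists (B * C) => t t0; rewrite /dcutoff normrM normrN.
have -> : n.+1%:R * ((t * b^-1) ^+ 2) ^+ n * (2 * (t * b^-1) * b^-1) =
    B * t ^+ (2 * n).+1.
  by rewrite /B (exprS t (2 * n)) exprM (exprMn 2 t) exprMn; ring.
rewrite (ger0_norm (cutoff_ge0 _ _ _)) (ger0_norm (mulr_ge0 B0 (exprn_ge0 _ t0))).
have -> : (1 + t) ^+ k * (B * t ^+ (2 * n).+1 * cutoff b n t) =
  B * ((1 + t) ^+ k * t ^+ (2 * n).+1 * cutoff b n t) by ring.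
rewrite ler_wpM2l// (le_trans _ (hC n t t0))// exprD.
rewrite ler_wpM2r ?cutoff_ge0// ler_wpM2l ?exprn_ge0 ?addr_ge0//.
by rewrite lerXn2r ?nnegrE ?addr_ge0// lerDr.
Qed.

Lemma le_oneDsqrV (f : R -> R) C t : 0 <= t -> (1 + t) ^+ 2 * `|f t| <= C ->
  `|f t| <= C * (1 + t ^+ 2)^-1.
Proof.
move=> t0 h; have t1 : 0 < 1 + t ^+ 2 by rewrite ltr_pwDl// sqr_ge0.
rewrite ler_pdivlMr// mulrC (le_trans _ h)// ler_wpM2r//.
by rewrite sqrrD expr1n mul1r -addrA lerD2l lerDr mulrn_wge0.
Qed.

Lemma cutoff_cvg b t : 0 < b -> 0 <= t -> t != b ->
  cutoff b n t @[n --> \oo] --> (\1_(`[0, b]%classic) t : R).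
Proof.
move=> b0 t0 tb; set s := (t * b^-1) ^+ 2.
have tb0 : 0 <= t * b^-1 by rewrite mulr_ge0// invr_ge0 ltW.
have [tlb|] := ltP t b.
  have s1 : `|s| < 1.
    rewrite ger0_norm ?sqr_ge0// /s expr_lt1// ltr_pdivrMr//; lra.
  rewrite indicE mem_set/=; last by rewrite in_itv/= t0 ltW.
  have h : s ^+ n @[n --> \oo] --> (0 : R) by exact: cvg_expr.
  have h' : s ^+ n.+1 @[n --> \oo] --> (0 : R).
    by rewrite -(cvg_shiftS (fun n => s ^+ n)) in h.
  rewrite -[X in _ --> X]expR0 -oppr0.
  apply: (@cvg_comp _ _ _ (fun n => - s ^+ n.+1) expR).
    by apply: cvgN; exact: h'.
  exact: continuous_expR.
rewrite le_eqVlt eq_sym (negbTE tb)/= => bt.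
rewrite indicE memNset/=; last by rewrite in_itv/= => /andP[_]; lra.
have s1 : 1 < s.
  by rewrite /s expr_gt1// ltr_pdivlMr// mul1r.
apply/cvgrPdist_le => e e0.
have hs : `|s^-1| < 1 by rewrite ger0_norm ?invr_ge0 ?sqr_ge0// invf_lt1//; lra.
have h : s^-1 ^+ n @[n --> \oo] --> (0 : R) by exact: cvg_expr.
have /cvgrPdist_le/(_ _ e0) := h.
apply: filterS => n; rewrite !sub0r !normrN => hn.
rewrite ger0_norm ?cutoff_ge0// /cutoff -/s expRN (le_trans _ hn)//.
have sn : 0 < s ^+ n by rewrite exprn_gt0//; lra.
rewrite ger0_norm ?exprn_ge0 ?invr_ge0 ?sqr_ge0// exprVn.
rewrite lef_pV2 ?posrE ?expR_gt0//.
rewrite (le_trans _ (expR_ge1Dx _))// exprS.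
rewrite (@le_trans _ _ (s * s ^+ n))//; last by rewrite lerDr.
by rewrite ler_peMl// ltW.
Qed.

Lemma cutoff_Rintegral_cvg b (h : R -> R) (C : R) : 0 < b -> continuous h ->
  (forall t, 0 <= t -> `|h t| <= C * (1 + t)) ->
  \int[mu]_(t in `[0, +oo[) (cutoff b n t * h t) @[n --> \oo] -->
  \int[mu]_(t in `[0, b]) h t.
Proof.
move=> b0 ch hC.
(* Two powers give the integrable majorant (1 + t^2)^-1, the third absorbs the linear growth of
   h. *)
have [B hB] := cutoff_decay 3 b0.
have C0 : 0 <= C by have := hC 0 (lexx _); have := normr_ge0 (h 0); lra.
have bd n t : 0 <= t -> `|cutoff b n t * h t| <= C * B * (1 + t ^+ 2)^-1.
  move=> t0; apply: (@le_oneDsqrV (fun t => cutoff b n t * h t)) => //.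
  rewrite normrM (ger0_norm (cutoff_ge0 _ _ _)).
  have h1 : 0 <= (1 + t) ^+ 2 * cutoff b n t by rewrite mulr_ge0 ?sqr_ge0 ?cutoff_ge0.
  rewrite mulrA (le_trans (ler_wpM2l h1 (hC t t0)))//.
  have -> : (1 + t) ^+ 2 * cutoff b n t * (C * (1 + t)) =
    C * ((1 + t) ^+ 3 * cutoff b n t) by ring.
  by rewrite ler_wpM2l// hB.
have mI : measurable (`[0, b] : set R) by exact: measurable_itv.
have mh := continuous_measurable_fun ch.
have -> : \int[mu]_(t in `[0, b]) h t =
    \int[mu]_(t in `[0, +oo[) (\1_(`[0, b]%classic) t * h t).
  rewrite (_ : `[0, b]%classic = `[0, +oo[ `&` `[0, b]); last first.
    apply/seteqP; split => t; rewrite /= !in_itv/=; last by case.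
    by move=> /andP[-> ->].
  rewrite Rintegral_mkcondr; apply: eq_Rintegral => t /set_mem/=.
  rewrite in_itv/= andbT => t0; rewrite patchE indicE.
  rewrite in_setI (mem_set (_ : `[0, +oo[%classic t))/= ?in_itv/= ?t0//.
  by case: ifPn => _; rewrite ?mul1r ?mul0r.
apply: (@Rintegral_dominated_cvg_ae _ _ mu _ _ _ (fun t => C * B * (1 + t ^+ 2)^-1)).
- exact: measurable_itv.
- move=> n; apply: measurable_funTS; apply: measurable_funM => //.
  by apply: continuous_measurable_fun; exact: cutoff_continuous.
- apply: measurable_funTS; apply: measurable_funM => //.
- exists [set b]; split => //; first exact: lebesgue_measure_set1.
  move=> t /= /not_implyP[]; rewrite in_itv/= andbT => t0 nt.
  apply: contrapT => /eqP tb; apply: nt; apply: cvgM; last exact: cvg_cst.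
  exact: cutoff_cvg.
- exact: integrable_oneDsqrV.
- by move=> n t; rewrite /= in_itv/= andbT; exact: bd.
Qed.

Lemma cvg_natS0 (u : R -> R) (M : R) :
  (forall t : R, 0 <= t -> `|u t| <= M * (1 + t ^+ 2)^-1) ->
  u k.+1%:R @[k --> \oo] --> (0 : R).
Proof.
move=> uM; apply/norm_cvg0P.
have M0 : 0 <= M by have := uM 0 (lexx _); rewrite expr0n/= addr0 invr1 mulr1; exact: le_trans.
apply: (@squeeze_cvgr _ _ _ _ (fun=> 0) (fun k : nat => M * k.+1%:R^-1)).
- apply: nearW => k; rewrite normr_ge0/= (le_trans (uM _ _))// ler_wpM2l//.
  have k1 : 1 <= k.+1%:R :> R by rewrite ler1n.
  rewrite lef_pV2 ?posrE// ?ltr_pwDl ?sqr_ge0//.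
  by move: (k.+1%:R : R) k1 => K K1; nra.
- exact: cvg_cst.
- rewrite -[X in _ --> X](mulr0 M).
  by apply: cvgM; [exact: cvg_cst|exact: cvg_harmonic].
Qed.

Lemma dcutoff_Rintegral b n : 0 < b ->
  \int[mu]_(t in `[0, +oo[) dcutoff b n t = -1.
Proof.
move=> b0; have [C hC] := cutoff_decay 2 b0; have [C' hC'] := dcutoff_decay n 2 b0.
have h4 t : 0 <= t -> `|dcutoff b n t| <= C' * (1 + t ^+ 2)^-1.
  by move=> t0; apply: le_oneDsqrV => //; exact: hC'.
have h5 : cutoff b n k.+1%:R @[k --> \oo] --> (0 : R).
  apply: (@cvg_natS0 _ C) => t t0; apply: le_oneDsqrV => //.
  by rewrite ger0_norm ?cutoff_ge0// hC.
rewrite (FTC2y (@cutoff_continuous b n) (@dcutoff_continuous b n)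
  (fun t _ => is_der_cutoff b n t) h4 h5).
by rewrite /cutoff mul0r expr0n/= expr0n/= oppr0 expR0.
Qed.

(** On [0, oo), - [dcutoff] is a probability density that should approach the unit mass at b.
    Integration by parts moves the derivative off the cutoff: the second moment about b is b^2 plus
    the integral of 2 (t - b) against the cutoff, which tends to the integral over [0, b], namely -
    b^2. *)
Lemma dcutoff_second_moment b : 0 < b ->
  \int[mu]_(t in `[0, +oo[) (- dcutoff b n t * (t - b) ^+ 2) @[n --> \oo] --> (0 : R).
Proof.
move=> b0.
have [C hC] := cutoff_decay 4 b0.
pose K := (1 + b) ^+ 2.
have K0 : 0 <= K by exact: sqr_ge0.
have tbK t : 0 <= t -> (t - b) ^+ 2 <= K * (1 + t) ^+ 2.
  move=> t0; rewrite /K -exprMn -[leLHS]real_normK ?num_real//.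
  rewrite lerXn2r ?nnegrE ?mulr_ge0 ?addr_ge0 ?(ltW b0)//.
  by rewrite ler_norml; nra.
have ctb : continuous (fun t : R => (t - b)).
  by apply: contB; [move=> t; exact: cvg_id|exact: cont_cst].
have csq : continuous (fun t : R => (t - b) ^+ 2).
  exact: (cont_comp (@exprn_continuous R 2) ctb).
have E n : \int[mu]_(t in `[0, +oo[) (- dcutoff b n t * (t - b) ^+ 2) =
    b ^+ 2 + \int[mu]_(t in `[0, +oo[) (cutoff b n t * (2 * (t - b))).
  have [C' hC'] := dcutoff_decay n 4 b0.
  pose v t := dcutoff b n t * (t - b) ^+ 2 + cutoff b n t * (2 * (t - b)).
  have d1 t : 0 <= t -> `|dcutoff b n t * (t - b) ^+ 2| <= K * C' * (1 + t ^+ 2)^-1.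
    move=> t0; apply: (@le_oneDsqrV (fun t => dcutoff b n t * (t - b) ^+ 2)) => //.
    rewrite normrM (ger0_norm (sqr_ge0 _)).
    have h1 : 0 <= (1 + t) ^+ 2 * `|dcutoff b n t| by rewrite mulr_ge0 ?sqr_ge0.
    rewrite mulrA (le_trans (ler_wpM2l h1 (tbK t t0)))//.
    have -> : (1 + t) ^+ 2 * `|dcutoff b n t| * (K * (1 + t) ^+ 2) =
      K * ((1 + t) ^+ 4 * `|dcutoff b n t|) by ring.
    by rewrite ler_wpM2l// hC'.
  have d2 t : 0 <= t -> `|cutoff b n t * (2 * (t - b))| <= 2 * (1 + b) * C * (1 + t ^+ 2)^-1.
    move=> t0; apply: (@le_oneDsqrV (fun t => cutoff b n t * (2 * (t - b)))) => //.
    rewrite normrM (ger0_norm (cutoff_ge0 _ _ _)).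
    have h1 : 0 <= (1 + t) ^+ 2 * cutoff b n t by rewrite mulr_ge0 ?sqr_ge0 ?cutoff_ge0.
    have h2 : `|2 * (t - b)| <= 2 * (1 + b) * (1 + t) ^+ 2.
      by rewrite ler_norml; nra.
    rewrite mulrA (le_trans (ler_wpM2l h1 h2))//.
    have -> : (1 + t) ^+ 2 * cutoff b n t * (2 * (1 + b) * (1 + t) ^+ 2) =
      2 * (1 + b) * ((1 + t) ^+ 4 * cutoff b n t) by ring.
    by rewrite ler_wpM2l ?hC// mulr_ge0// addr_ge0// ltW.
  have c1 : continuous (fun t => dcutoff b n t * (t - b) ^+ 2).
    by apply: contM => //; exact: dcutoff_continuous.
  have c2 : continuous (fun t => cutoff b n t * (2 * (t - b))).
    apply: contM; first exact: cutoff_continuous.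
    by apply: contM => //; exact: cont_cst.
  have i1 := continuous_Rintegrable0y c1 d1.
  have i2 := continuous_Rintegrable0y c2 d2.
  have : \int[mu]_(t in `[0, +oo[) v t = - b ^+ 2.
    have cv : continuous v by exact: contD.
    have cu : continuous (fun t => cutoff b n t * (t - b) ^+ 2).
      by apply: contM => //; exact: cutoff_continuous.
    have duv t : 0 < t -> is_derive t 1 (fun t => cutoff b n t * (t - b) ^+ 2) (v t).
      move=> _; have h1 := is_derB (is_der_id t) (is_der_cst b t).
      have h2 := is_der_comp (g := fun s => s - b) (is_der_exprn 2 _) h1.
      apply: (is_der_eq (is_derM (is_der_cutoff b n t) h2)).
      by rewrite /v /= subr0 mulr1 expr1.
    have hv t : 0 <= t -> `|v t| <= (K * C' + 2 * (1 + b) * C) * (1 + t ^+ 2)^-1.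
      move=> t0; rewrite mulrDl (le_trans (ler_normD _ _))//.
      by apply: lerD; [exact: d1|exact: d2].
    have u0 : cutoff b n k.+1%:R * (k.+1%:R - b) ^+ 2 @[k --> \oo] --> (0 : R).
      apply: (@cvg_natS0 (fun t => cutoff b n t * (t - b) ^+ 2) (K * C)) => t t0.
      apply: (@le_oneDsqrV (fun t => cutoff b n t * (t - b) ^+ 2)) => //.
      rewrite normrM (ger0_norm (sqr_ge0 _)) (ger0_norm (cutoff_ge0 _ _ _)).
      have h1 : 0 <= (1 + t) ^+ 2 * cutoff b n t by rewrite mulr_ge0 ?sqr_ge0 ?cutoff_ge0.
      rewrite mulrA (le_trans (ler_wpM2l h1 (tbK t t0)))//.
      have -> : (1 + t) ^+ 2 * cutoff b n t * (K * (1 + t) ^+ 2) =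
        K * ((1 + t) ^+ 4 * cutoff b n t) by ring.
      by rewrite ler_wpM2l// hC.
    rewrite (FTC2y cu cv duv hv u0).
    by rewrite /cutoff mul0r expr0n/= expr0n/= oppr0 expR0 mul1r sub0r sqrrN.
  rewrite /v RintegralD//.
  have -> : \int[mu]_(t in `[0, +oo[) (- dcutoff b n t * (t - b) ^+ 2) =
      - \int[mu]_(t in `[0, +oo[) (dcutoff b n t * (t - b) ^+ 2).
    rewrite -[RHS]mulN1r -RintegralZl//.
    by apply: eq_Rintegral => t _; rewrite mulN1r mulNr.
  by lra.
under eq_fun do rewrite E.
have h : \int[mu]_(t in `[0, +oo[) (cutoff b n t * (2 * (t - b))) @[n --> \oo] -->
    \int[mu]_(t in `[0, b]) (2 * (t - b)).
  apply: (@cutoff_Rintegral_cvg _ (fun t => 2 * (t - b)) (2 * (1 + b))) => //.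
    by apply: contM => //; exact: cont_cst.
  by move=> t t0; rewrite ler_norml; nra.
have e : \int[mu]_(t in `[0, b]) (2 * (t - b)) = - b ^+ 2.
  have dF t : is_derive t 1 (fun t => (t - b) ^+ 2) (2 * (t - b)).
    have h1 := is_derB (is_der_id t) (is_der_cst b t).
    have h2 := is_der_comp (g := fun s => s - b) (is_der_exprn 2 _) h1.
    by apply: (is_der_eq h2); rewrite /= subr0 mulr1 expr1.
  have cf : continuous (fun t => 2 * (t - b)) by apply: contM => //; exact: cont_cst.
  rewrite (is_der_FTC2 b0 cf dF).
  by rewrite subrr expr0n/= !sub0r sqrrN.
rewrite e in h.
have : b ^+ 2 + \int[mu]_(t in `[0, +oo[) (cutoff b n t * (2 * (t - b)))
    @[n --> \oo] --> b ^+ 2 - b ^+ 2.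
  by apply: cvgD; [exact: cvg_cst|exact: h].
by rewrite subrr.
Qed.

(** Chebyshev's argument: |c t - c b| is at most e / 2 near b and at most 2 M elsewhere, hence at
    most e / 2 + (2 M / d^2) (t - b)^2 everywhere, and the second moment about b vanishes in the
    limit. *)
Lemma cutoff_concentrates (c : R -> R) (M b : R) : 0 < b -> continuous c ->
  (forall t, `|c t| <= M) ->
  \int[mu]_(t in `[0, +oo[) (dcutoff b n t * c t) @[n --> \oo] --> - c b.
Proof.
move=> b0 cc cM; have M0 : 0 <= M by apply: le_trans (cM 0).
apply/cvgrPdist_le => e e0.
have e2 : 0 < e / 2 by lra.
have /cvgrPdist_le/(_ _ e2)/nbhs_ballP[d /= d0 hd] := cc b.
pose K := 2 * M / d ^+ 2.
have K0 : 0 <= K by apply: divr_ge0; [exact: mulr_ge0|exact: sqr_ge0].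
have bound t : `|c t - c b| <= e / 2 + K * (t - b) ^+ 2.
  have [bt|bt] := pselect (ball b d t).
    rewrite distrC (le_trans (hd _ bt))// lerDl; apply: mulr_ge0 => //; exact: sqr_ge0.
  have dt : d <= `|t - b|.
    by rewrite leNgt; apply/negP => h; apply: bt; rewrite /ball/= distrC.
  have h : 1 <= (t - b) ^+ 2 / d ^+ 2.
    rewrite ler_pdivlMr ?exprn_gt0// mul1r -[leRHS]real_normK ?num_real//.
    by rewrite lerXn2r// nnegrE ltW.
  rewrite (le_trans (ler_normB _ _))// (@le_trans _ _ (2 * M))//.
    by have := cM t; have := cM b; lra.
  rewrite (@le_trans _ _ (K * (t - b) ^+ 2))//; last by rewrite lerDr ltW.
  have -> : K * (t - b) ^+ 2 = 2 * M * ((t - b) ^+ 2 / d ^+ 2) by rewrite /K; ring.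
  by apply: ler_peMr => //; exact: mulr_ge0.
have K1 : 0 < K + 1 by lra.
have e4 : 0 < e / 2 / (K + 1) by rewrite divr_gt0.
have /cvgrPdist_le/(_ _ e4) := dcutoff_second_moment b0.
apply: filterS => n; rewrite sub0r normrN => hn.
have [C hC] := dcutoff_decay n 2 b0; have [C4 hC4] := dcutoff_decay n 4 b0.
have mI : measurable (`[0%R, +oo[ : set (measurableTypeR R)) by exact: measurable_itv.
have i0 : mu.-integrable `[0, +oo[ (EFin \o dcutoff b n).
  apply: (@continuous_Rintegrable0y _ C); first exact: dcutoff_continuous.
  by move=> t t0; apply: le_oneDsqrV => //; exact: hC.
have i1 : mu.-integrable `[0, +oo[ (EFin \o (fun t => dcutoff b n t * c t)).
  apply: (@continuous_Rintegrable0y _ (M * C)).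
    by apply: contM => //; exact: dcutoff_continuous.
  move=> t t0; apply: (@le_oneDsqrV (fun t => dcutoff b n t * c t)) => //.
  rewrite normrM mulrA mulrC ler_pM ?hC// mulr_ge0 ?sqr_ge0//.
have i2 : mu.-integrable `[0, +oo[ (EFin \o (fun t => dcutoff b n t * c b)).
  have := integrableZr mI (c b) i0; apply: eq_integrable => // t _.
have ctb : continuous (fun t : R => (t - b)).
  by apply: contB; [move=> t; exact: cvg_id|exact: cont_cst].
have csq : continuous (fun t : R => (t - b) ^+ 2).
  exact: (cont_comp (@exprn_continuous R 2) ctb).
have i3 : mu.-integrable `[0, +oo[ (EFin \o (fun t => - dcutoff b n t * (t - b) ^+ 2)).
  apply: (@continuous_Rintegrable0y _ ((1 + b) ^+ 2 * C4)).
    by apply: contM => //; apply: contN; exact: dcutoff_continuous.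
  move=> t t0; apply: (@le_oneDsqrV (fun t => - dcutoff b n t * (t - b) ^+ 2)) => //.
  rewrite normrM normrN (ger0_norm (sqr_ge0 _)).
  have h1 : 0 <= (1 + t) ^+ 2 * `|dcutoff b n t| by rewrite mulr_ge0 ?sqr_ge0.
  have h2 : (t - b) ^+ 2 <= (1 + b) ^+ 2 * (1 + t) ^+ 2.
    rewrite -exprMn -[leLHS]real_normK ?num_real//.
    rewrite lerXn2r ?nnegrE ?mulr_ge0 ?addr_ge0 ?(ltW b0)//.
    by rewrite ler_norml; nra.
  rewrite mulrA (le_trans (ler_wpM2l h1 h2))//.
  have -> : (1 + t) ^+ 2 * `|dcutoff b n t| * ((1 + b) ^+ 2 * (1 + t) ^+ 2) =
    (1 + b) ^+ 2 * ((1 + t) ^+ 4 * `|dcutoff b n t|) by ring.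
  by rewrite ler_wpM2l ?sqr_ge0// hC4.
have -> : - c b = \int[mu]_(t in `[0, +oo[) (dcutoff b n t * c b).
  by rewrite RintegralZr// dcutoff_Rintegral// mulN1r.
rewrite -RintegralB//.
have i0' : mu.-integrable `[0, +oo[ (EFin \o (fun t => - (e / 2) * dcutoff b n t)).
  exact: (integrableZl mI (- (e / 2)) i0).
have i3' : mu.-integrable `[0, +oo[ (EFin \o (fun t => K * (- dcutoff b n t * (t - b) ^+ 2))).
  exact: (integrableZl mI K i3).
have iG : mu.-integrable `[0, +oo[ (EFin \o (fun t =>
    - (e / 2) * dcutoff b n t + K * (- dcutoff b n t * (t - b) ^+ 2))).
  exact: (integrableD mI i0' i3').
apply: (@le_trans _ _ (\int[mu]_(t in `[0, +oo[)
    (- (e / 2) * dcutoff b n t + K * (- dcutoff b n t * (t - b) ^+ 2)))).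
  apply: (le_normr_Rintegral_dominated mI _ iG).
    apply: measurable_funTS; apply: continuous_measurable_fun.
    by apply: contB; apply: contM => //; try exact: dcutoff_continuous; exact: cont_cst.
  move=> t; rewrite /= in_itv/= andbT => t0.
  rewrite -mulrBr normrM ler0_norm ?dcutoff_le0// distrC.
  have h := ler_wpM2l (_ : 0 <= - dcutoff b n t) (bound t).
  rewrite (le_trans (h _))//; first by rewrite oppr_ge0 dcutoff_le0.
  by rewrite mulrDr; lra.
rewrite RintegralD// !RintegralZl// dcutoff_Rintegral//.
rewrite mulrN1 opprK.
have : K * \int[mu]_(t in `[0, +oo[) (- dcutoff b n t * (t - b) ^+ 2) <= e / 2.
  apply: (@le_trans _ _ (K * (e / 2 / (K + 1)))).
    by rewrite ler_wpM2l// (le_trans (ler_norm _)).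
  by rewrite mulrA ler_pdivrMr//; nra.
by lra.
Qed.

End cutoff.

Section linear_decay.
Context (R : realType).
Local Notation mu := (@lebesgue_measure R).
Implicit Types (x y b t : R).

Lemma continuous_itv_integrable (c : R -> R) (a b : R) : continuous c ->
  mu.-integrable `[a, b] (EFin \o c).
Proof.
move=> cc; apply: continuous_compact_integrable; first exact: segment_compact.
exact: continuous_subspaceT.
Qed.

Lemma is_der_primitive (c : R -> R) (a x : R) : continuous c -> a < x ->
  is_derive x 1 (fun x => \int[mu]_(t in `[a, x]) c t) (c x).
Proof.
move=> cc ax; have x1 : x < x + 1 by rewrite ltrDl.
have [h1 h2] := continuous_FTC1_closed x1 (continuous_itv_integrable a (x + 1) cc)
  ax (cc x).
by split; [exact: h1|rewrite -derive1E].
Qed.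

Lemma primitive_norm_le (c : R -> R) (M b : R) : continuous c -> 0 < b ->
  (forall t, `|c t| <= M) -> `|\int[mu]_(t in `[0, b]) c t| <= M * b.
Proof.
move=> cc b0 cM.
have -> : M * b = \int[mu]_(t in `[0, b]) (fun=> M) t.
  by rewrite Rintegral_cst//= lebesgue_measure_itv/= lte_fin b0 -EFinB subr0.
apply: le_normr_Rintegral_dominated => //.
- by apply: measurable_funTS; exact: continuous_measurable_fun.
- by apply: continuous_itv_integrable; exact: cont_cst.
Qed.

Lemma is_der0_eq (f : R -> R) (a b : R) : a <= b ->
  (forall x, a <= x -> is_derive x 1 f 0) -> f a = f b.
Proof.
move=> ab df; have h1 x : x \in `]a, b[ -> is_derive x 1 f ((fun=> 0) x).
  by rewrite in_itv/= => /andP[ax _]; apply: df; exact: ltW.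
have h2 : {within `[a, b], continuous f}.
  apply: continuous_in_subspaceT => x /set_mem/=; rewrite in_itv/= => /andP[ax _].
  exact: is_der_cont (df x ax).
have [c _] := MVT_segment ab h1 h2.
by rewrite mul0r => /eqP; rewrite subr_eq0 => /eqP.
Qed.

(** The equation is given for b > 0 only. There c b exp (q b) has zero derivative; its constant
    value and c 0 = k are both obtained by following b = 1 / (n + 1) to 0. *)
Lemma linear_integral_equation (c : R -> R) (k q M : R) : continuous c ->
  (forall t, `|c t| <= M) ->
  (forall b, 0 < b -> c b = k - q * \int[mu]_(t in `[0, b]) c t) ->
  forall b, 0 <= b -> c b = k * expR (- (q * b)).
Proof.
move=> cc cM hc.
pose g x := (k - q * \int[mu]_(t in `[0, x]) c t) * expR (q * x).
have dg x : 0 < x -> is_derive x 1 g 0.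
  move=> x0.
  have h1 := is_derB (is_der_cst k x) (is_derZ q (is_der_primitive cc x0)).
  have h2 := is_der_expR (is_derZ q (is_der_id x)).
  apply: (is_der_eq (is_derM h1 h2)); rewrite -(hc _ x0); ring.
have gE x : 0 < x -> g x = c x * expR (q * x) by move=> x0; rewrite /g -hc.
have cst x y : 0 < x -> x <= y -> g x = g y.
  by move=> x0 xy; apply: (is_der0_eq xy) => z xz; apply: dg; exact: lt_le_trans xz.
have n0 (n : nat) : 0 < (n.+1%:R^-1 : R) by rewrite invr_gt0.
have n1 : n.+1%:R^-1 @[n --> \oo] --> (0 : R) by exact: cvg_harmonic.
have gcont : continuous (fun x => c x * expR (q * x)).
  apply: contM => //; apply: cont_expR; apply: contM; first exact: cont_cst.
  by move=> t; exact: cvg_id.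
have cn : c n.+1%:R^-1 @[n --> \oo] --> c 0 by apply: cvg_comp n1 (cc 0).
have gn : g n.+1%:R^-1 @[n --> \oo] --> c 0.
  under eq_fun do rewrite gE//.
  have := cvg_comp _ _ n1 (gcont 0); rewrite mulr0 expR0 mulr1; exact.
have c0 : c 0 = k.
  have h : c n.+1%:R^-1 @[n --> \oo] --> k.
    apply/cvgrPdist_le => e e0.
    have h : (`|q| * M) * n.+1%:R^-1 @[n --> \oo] --> (0 : R).
      rewrite -[X in _ --> X](mulr0 (`|q| * M)).
      by apply: cvgM; [exact: cvg_cst|exact: n1].
    have /cvgrPdist_le/(_ _ e0) := h.
    apply: filterS => n; rewrite sub0r normrN => hn.
    rewrite hc// opprB addrCA subrr addr0 normrM.
    rewrite (le_trans _ hn)// (le_trans _ (ler_norm _))// -mulrA ler_wpM2l//.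
    exact: primitive_norm_le.
  exact: (cvg_unique _ cn h).
have gk b : 0 < b -> g b = k.
  move=> b0; have h : g n.+1%:R^-1 @[n --> \oo] --> g b.
    apply: cvg_near_cst.
    have /cvgrPdist_lt/(_ _ b0) := n1.
    apply: filterS => n; rewrite sub0r normrN ger0_norm// => nb.
    by apply: cst => //; exact: ltW.
  by have := cvg_unique _ h gn; rewrite c0; exact.
move=> b; rewrite le_eqVlt => /orP[/eqP<-|b0].
  by rewrite mulr0 oppr0 expR0 mulr1.
by rewrite -(gk _ b0) gE// -mulrA -expRD subrr expR0 mulr1.
Qed.

End linear_decay.

(** * Uniqueness for the heat equation *)

Section heat_uniqueness.
Context (R : realType) (N : nat).
Local Notation V := 'rV[R]_N.
Local Notation W := (R * V)%type.
Local Notation leb := (@lebesgue_measure R).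

Lemma dotv_delta (x : V) i : dotv x (delta_mx ord0 i) = x ord0 i.
Proof.
rewrite /dotv (bigD1 i)//= mxE !eqxx mulr1 big1 ?addr0// => j ji.
by rewrite mxE (negbTE ji) andbF mulr0.
Qed.

Lemma dir_der_dotv (xi : V) (p v : W) :
  is_derive p v (fun q : W => dotv xi q.2) (dotv xi v.2).
Proof.
apply/is_derive_lineP.
have h := is_der_dotv xi 1 p.2 v.2 0.
under eq_fun do rewrite -[dotv _ _]mul1r.
by apply: (is_der_eq h); rewrite mul1r.
Qed.

Lemma dir_der_dotvv (p v : W) :
  is_derive p v (fun q : W => dotv q.2 q.2) (2 * dotv p.2 v.2).
Proof.
apply/is_derive_lineP.
have E s : dotv (p + s *: v).2 (p + s *: v).2 =
    dotv p.2 p.2 + (s * (2 * dotv p.2 v.2) + s * s * dotv v.2 v.2).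
  by rewrite /= !(dotvDl, dotvDr, dotvZl, dotvZr) (dotvC v.2 p.2); ring.
under eq_fun do rewrite E.
have h := is_derD (is_der_cst (dotv p.2 p.2) (0 : R)) (is_derD
  (is_derM (is_der_id 0) (is_der_cst (2 * dotv p.2 v.2) 0))
  (is_derM (is_derM (is_der_id 0) (is_der_id 0)) (is_der_cst (dotv v.2 v.2) 0))).
by apply: (is_der_eq h); ring.
Qed.

Lemma dir_der_time (g dg : R -> R) (p v : W) :
  is_derive p.1 1 g (dg p.1) -> is_derive p v (fun q : W => g q.1) (v.1 * dg p.1).
Proof.
move=> hg; apply/is_derive_lineP.
have h := is_derD (is_der_cst p.1 (0 : R)) (is_derM (is_der_id 0) (is_der_cst v.1 0)).
have hg' : is_derive (p.1 + 0 * v.1) 1 g (dg p.1) by rewrite mul0r addr0.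
have := @is_der_comp _ g (fun s => p.1 + s * v.1) 0 _ _ hg' h.
by move=> h'; apply: (is_der_eq h'); ring.
Qed.

Variables (xi : V) (a : R).
Implicit Types (x : V) (e b t s : R).

Let theta x := dotv xi x + a.
Let damp e x := expR (- (e * dotv x x)).
Let h e x := cos (theta x) * damp e x.
Let dh e j x := (- (xi ord0 j * sin (theta x)) - 2 * e * x ord0 j * cos (theta x))
  * damp e x.
Let ddh e i j x :=
  (- (xi ord0 i * xi ord0 j) * cos (theta x)
   + 2 * e * (x ord0 i * xi ord0 j + x ord0 j * xi ord0 i) * sin (theta x)
   - 2 * e * (i == j)%:R * cos (theta x)
   + 4 * (e ^+ 2 * x ord0 i * x ord0 j) * cos (theta x)) * damp e x.

Let dir_theta (p : W) i :
  is_derive p (dir R (Some i)) (fun q : W => theta q.2) (xi ord0 i).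
Proof.
apply: (dir_der_eq (dir_derD (dir_der_dotv xi p _) (dir_der_cst p _ a))).
by rewrite addr0 dotv_delta.
Qed.

Let dir_damp e (p : W) i : is_derive p (dir R (Some i)) (fun q : W => damp e q.2)
  (- (2 * e * p.2 ord0 i) * damp e p.2).
Proof.
have h1 := dir_der_expR (dir_derN (dir_derM (dir_der_cst p _ e) (dir_der_dotvv p (dir R (Some i))))).
apply: (dir_der_eq h1); rewrite /= dotv_delta /damp; ring.
Qed.

Let dir_coord (p : W) i j :
  is_derive p (dir R (Some i)) (fun q : W => q.2 ord0 j) (i == j)%:R.
Proof.
apply: (dir_der_eq (dir_der_coord p _ j)).
by rewrite /= mxE eqxx eq_sym.
Qed.

Let dir_h e (p : W) j :
  is_derive p (dir R (Some j)) (fun q : W => h e q.2) (dh e j p.2).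
Proof.
apply: (dir_der_eq (dir_derM (dir_der_cos (dir_theta p j)) (dir_damp e p j))).
by rewrite /dh; ring.
Qed.

Let dir_dh e (p : W) i j :
  is_derive p (dir R (Some i)) (fun q : W => dh e j q.2) (ddh e i j p.2).
Proof.
have h1 := dir_derN (dir_derM (dir_der_cst p _ (xi ord0 j)) (dir_der_sin (dir_theta p i))).
have h2 := dir_derM (dir_der_cst p _ (2 * e)) (dir_coord p i j).
have h3 := dir_derN (dir_derM h2 (dir_der_cos (dir_theta p i))).
apply: (dir_der_eq (dir_derM (dir_derD h1 h3) (dir_damp e p i))).
by rewrite /ddh; ring.
Qed.

(* Once e tends to 0, testing with phi gives the weak form in time of
   c' = - (qform A xi / 2) c for the characteristic function c. *)
Let phi b n e (p : W) := cutoff b n p.1 * h e p.2.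

Let dir_phi b n (g dg : V -> R) (p : W) i :
  is_derive p (dir R (Some i)) (fun q : W => g q.2) (dg p.2) ->
  is_derive p (dir R (Some i)) (fun q : W => cutoff b n q.1 * g q.2)
    (cutoff b n p.1 * dg p.2).
Proof.
move=> hg; have h1 := dir_der_time (dir R (Some i)) (is_der_cutoff b n p.1).
by apply: (dir_der_eq (dir_derM h1 hg)); rewrite /= mul0r mul0r add0r.
Qed.

Let partial_phi b n e j :
  partial (Some j) (phi b n e) = fun p => cutoff b n p.1 * dh e j p.2.
Proof. by apply/funext => p; have [] := dir_phi b n (dir_h e p j). Qed.

Let partial2_phi b n e i j :
  partial (Some i) (partial (Some j) (phi b n e)) =
  fun p => cutoff b n p.1 * ddh e i j p.2.
Proof.
by rewrite partial_phi; apply/funext => p; have [] := dir_phi b n (dir_dh e p i j).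
Qed.

Let partial_time_phi b n e :
  partial None (phi b n e) = fun p => dcutoff b n p.1 * h e p.2.
Proof.
apply/funext => p.
have h1 := dir_der_time (dir R (None : option 'I_N)) (is_der_cutoff b n p.1).
have h2 : is_derive p (dir R (None : option 'I_N)) (fun q : W => h e q.2) 0.
  apply/is_derive_lineP; rewrite /=.
  under eq_fun do rewrite scaler0 addr0.
  exact: is_der_cst.
have [_ h3] := dir_derM h1 h2; rewrite /partial /phi h3.
by rewrite /= mul1r mulr0 addr0.
Qed.

Let schwartz_phi b n e : 0 < b -> 0 < e -> schwartz (phi b n e).
Proof.
move=> b0 e0.
have bV : 0 < b^-1 by rewrite invr_gt0.
(* The half comes from (u + w)^2 <= 2 (u^2 + w^2). The constant 1 subtracted in [coer] comes from s
   - 1 <= s^(n+1), applied to the exponent of the cutoff. *)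
pose dl := Num.min (b^-1 ^+ 2) e / 2.
have mb : Num.min (b^-1 ^+ 2) e <= b^-1 ^+ 2 by rewrite ge_min lexx.
have me : Num.min (b^-1 ^+ 2) e <= e by rewrite ge_min lexx orbT.
have m0 : 0 < Num.min (b^-1 ^+ 2) e by rewrite lt_min e0 exprn_gt0.
have dl0 : 0 < dl by rewrite /dl divr_gt0.
have dotW : polyW (fun p : W => dotv p.2 p.2).
  by apply: polyW_sum => i; apply: polyWM; exact: polyW_coord.
have hth : polyW (fun p : W => theta p.2).
  apply: polyWD; last exact: polyW_cst.
  by apply: polyW_sum => i; apply: polyWM; [exact: polyW_cst|exact: polyW_coord].
have hpsi : polyW (fun p : W => ((p.1 * b^-1) ^+ 2) ^+ n.+1 + e * dotv p.2 p.2).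
  apply: polyWD; last by apply: polyWM => //; exact: polyW_cst.
  by do 2 apply: polyWX; apply: polyWM; [exact: polyW_fst|exact: polyW_cst].
have coer (p : W) : dl * (`|p.1| + enorm p.2) ^+ 2 - 1 <=
    ((p.1 * b^-1) ^+ 2) ^+ n.+1 + e * dotv p.2 p.2.
  have h1 := sqr_le_exprn n (sqr_ge0 (p.1 * b^-1)).
  rewrite -enorm_sqr; rewrite exprMn in h1 *.
  have := real_normK (num_real p.1).
  move: h1; rewrite -exprMn; move: (`|p.1|) (enorm p.2) => u w h1 hu.
  have h2 : dl * (u + w) ^+ 2 <= 2 * dl * (u ^+ 2 + w ^+ 2).
    by have := sqr_ge0 (u - w); nra.
  have h3 : 2 * dl = Num.min (b^-1 ^+ 2) e by rewrite /dl; field.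
  have h4 : 2 * dl * u ^+ 2 <= (p.1 * b^-1) ^+ 2.
    by rewrite h3 exprMn -hu mulrC ler_wpM2l// sqr_ge0.
  have h5 : 2 * dl * w ^+ 2 <= e * w ^+ 2 by rewrite h3 ler_wpM2r// sqr_ge0.
  by rewrite mulrDr in h2; lra.
have -> : phi b n e = (fun p : W => cos (theta p.2) *
    expR (- (((p.1 * b^-1) ^+ 2) ^+ n.+1 + e * dotv p.2 p.2))).
  apply/funext => p; rewrite /phi /h /damp /cutoff opprD expRD; ring.
exact: (schwartz_damped hth hpsi dl0 coer).
Qed.

Let damp_le e x : 0 <= e -> damp e x * (1 + e * dotv x x) <= 1.
Proof.
move=> e0; rewrite /damp expRN mulrC ler_pdivrMr ?expR_gt0// mul1r.
exact: expR_ge1Dx.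
Qed.

Let damp_ge0 e x : 0 <= damp e x. Proof. exact: expR_ge0. Qed.

Let norm_trig_le (z : R) : `|cos z| <= 1 /\ `|sin z| <= 1.
Proof. by rewrite !ler_norml cos_geN1 cos_le1 sin_geN1 sin_le1. Qed.

Let h_bound e x : 0 <= e -> `|h e x| <= 1.
Proof.
move=> e0; rewrite normrM (ger0_norm (damp_ge0 _ _)).
have [c1 _] := norm_trig_le (theta x).
by rewrite -[leRHS]mul1r ler_pM// -expR0 ler_expR oppr_le0 mulr_ge0// dotv_ge0.
Qed.

(** Uniformity in e allows e to tend to 0 under the integral. The factors e x_i and e^2 x_i x_j are
    unbounded in x, but with e <= 1 they are dominated by 1 + e |x|^2, which the damping compensates
    by [damp_le]. *)
Let ddh_bound i j : exists C, forall e x, 0 <= e -> e <= 1 -> `|ddh e i j x| <= C.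
Proof.
exists (`|xi ord0 i * xi ord0 j| + 2 * `|xi ord0 j| + 2 * `|xi ord0 i| + 2 + 4).
move=> e x e0 e1.
have [] := norm_trig_le (theta x); rewrite /ddh.
move: (cos _) (sin _) => c s hc hs.
have g0 := damp_ge0 e x; have gle := damp_le x e0.
have u0 := dotv_ge0 x; have hi := dotv_ge_coord x i; have hj := dotv_ge_coord x j.
move: (damp e x) (dotv x x) g0 gle u0 hi hj => g u g0 gle u0.
move: (x ord0 i) (x ord0 j) (xi ord0 i) (xi ord0 j) => y z k l hy hz.
have eu : 0 <= e * u by exact: mulr_ge0.
have g1 : g <= 1 by nra.
have sc w : w ^+ 2 <= u -> `|e * w| * g <= 1.
  move=> hw; rewrite (le_trans _ gle)// mulrC ler_wpM2l//.
  rewrite ler_norml; have := sqr_ge0 (w - 1); have := sqr_ge0 (w + 1).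
  by move=> *; apply/andP; split; nra.
have yz : `|e ^+ 2 * y * z| * g <= 1.
  rewrite (le_trans _ gle)// mulrC ler_wpM2l//.
  have h1 : `|y * z| <= u.
    rewrite ler_norml; have := sqr_ge0 (y - z); have := sqr_ge0 (y + z).
    by move=> *; apply/andP; split; nra.
  rewrite -mulrA normrM ger0_norm ?sqr_ge0//.
  rewrite (@le_trans _ _ (e * u))//; last by rewrite lerDr.
  by apply: ler_pM => //; [exact: sqr_ge0|rewrite expr2; nra].
have -> : (- (k * l) * c + 2 * e * (y * l + z * k) * s - 2 * e * (i == j)%:R * c
    + 4 * (e ^+ 2 * y * z) * c) * g =
  (- (k * l)) * (c * g) + (2 * l) * s * (e * y * g) + (2 * k) * s * (e * z * g)
   + (- 2) * ((e * (i == j)%:R) * (c * g)) + 4 * c * (e ^+ 2 * y * z * g) by ring.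
have cg : `|c * g| <= 1 by rewrite normrM (ger0_norm g0) -[leRHS]mul1r ler_pM.
have add (r r' w w' : R) : `|r| <= w -> `|r'| <= w' -> `|r + r'| <= w + w'.
  by move=> hr hr'; rewrite (le_trans (ler_normD _ _))// lerD.
have mul (r r' w : R) : `|r| <= w -> `|r'| <= 1 -> `|r * r'| <= w.
  by move=> hr hr'; rewrite normrM -[leRHS]mulr1 ler_pM.
have two (r r' : R) : `|r'| <= 1 -> `|2 * r * r'| <= 2 * `|r|.
  by apply: mul; rewrite normrM ger0_norm.
have gw w : w ^+ 2 <= u -> `|e * w * g| <= 1.
  by move=> hw; rewrite normrM (ger0_norm g0) sc.
refine (add _ _ _ _ (add _ _ _ _ (add _ _ _ _ (add _ _ _ _ _ _) _) _) _).
- by apply: mul; rewrite ?normrN.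
- by apply: mul; [exact: two|exact: gw].
- by apply: mul; [exact: two|exact: gw].
- refine (mul _ _ _ _ _); first by rewrite normrN ger0_norm.
  refine (mul _ _ _ _ cg); rewrite ger0_norm ?mulr_ge0//.
  by case: eqVneq => _; rewrite ?mulr1 ?mulr0.
- refine (mul _ _ _ _ _); last by rewrite normrM (ger0_norm g0).
  by refine (mul _ _ _ _ hc); rewrite ger0_norm.
Qed.

Let theta_continuous : continuous theta.
Proof. exact: phase_continuous. Qed.

Let damp_continuous e : continuous (damp e).
Proof.
apply: cont_expR; apply: contN; apply: contM; first exact: cont_cst.
by apply: dotv_continuous => i; exact: coord_continuous_rV.
Qed.

Let h_Cb e : 0 <= e -> Cb (h e).
Proof.
move=> e0; apply: (@Cb_bound _ _ _ 1); last by move=> x; exact: h_bound.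
by apply: contM; [apply: cont_cos|exact: damp_continuous].
Qed.

Let ddh_Cb e i j : 0 <= e -> e <= 1 -> Cb (ddh e i j).
Proof.
move=> e0 e1; have [C hC] := ddh_bound i j.
apply: (@Cb_bound _ _ _ C); last by move=> x; exact: hC.
have cc : continuous (fun x => cos (theta x)) by exact: cont_cos.
have cs : continuous (fun x => sin (theta x)) by exact: cont_sin.
have cx k : continuous (fun x : V => x ord0 k) by exact: coord_continuous_rV.
have ck (k : R) : continuous (fun _ : V => k) by exact: cont_cst.
apply: contM; last exact: damp_continuous.
apply: contD; last by apply: contM => //; apply: contM => //; apply: contM => //; exact: contM.
apply: contD; last by apply: contN; apply: contM.
apply: contD; first exact: contM.
apply: contM => //; apply: contM => //.
by apply: contD; apply: contM.
Qed.

Let ddh_damping_continuous i j x : continuous (fun e => ddh e i j x).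
Proof.
have ce : continuous (fun e : R => e) by move=> e; exact: cvg_id.
have ck (k : R) : continuous (fun _ : R => k) by exact: cont_cst.
apply: contM; last by apply: cont_expR; apply: contN; apply: contM.
apply: contD; last first.
  apply: contM => //; apply: contM => //; apply: contM => //; apply: contM => //.
  by apply: contM.
apply: contD; last by apply: contN; apply: contM => //; apply: contM => //; exact: contM.
by apply: contD => //; apply: contM => //; apply: contM => //; exact: contM.
Qed.

Let h_cvg x : h n.+1%:R^-1 x @[n --> \oo] --> cos (theta x).
Proof.
have c : continuous (fun e => h e x).
  apply: contM; first exact: cont_cst.
  apply: cont_expR; apply: contN; apply: contM; last exact: cont_cst.
  by move=> e; exact: cvg_id.
have := cvg_comp _ _ (@cvg_harmonic R) (c 0).
by rewrite /h /damp mul0r oppr0 expR0 mulr1; exact.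
Qed.

Variables (A : 'M[R]_N) (Pi : R -> probability V R).
Hypotheses (cPi : narrow_continuous `[0, +oo[ Pi) (hPi : heat_solution A Pi).

(* Pi t is unspecified for t < 0; the absolute value makes c continuous on R. *)
Let c t := \int[Pi `|t|]_x cos (theta x).
Let K e x := 2^-1 * \sum_i \sum_j A i j * ddh e i j x.

Let K_Cb e : 0 <= e -> e <= 1 -> Cb (K e).
Proof.
by move=> e0 e1; apply: CbZ; apply: Cb_sum => i; apply: Cb_sum => j; apply: CbZ; exact: ddh_Cb.
Qed.

Let K_bound : exists C, forall e x, 0 <= e -> e <= 1 -> `|K e x| <= C.
Proof.
have [C hC] := choice (fun ij : 'I_N * 'I_N => ddh_bound ij.1 ij.2).
exists (2^-1 * \sum_i \sum_j `|A i j| * C (i, j)) => e x e0 e1.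
rewrite normrM ger0_norm ?invr_ge0// ler_wpM2l ?invr_ge0//.
rewrite (le_trans (ler_norm_sum _ _ _))//; apply: ler_sum => i _.
rewrite (le_trans (ler_norm_sum _ _ _))//; apply: ler_sum => j _.
by rewrite normrM ler_wpM2l//; exact: (hC (i, j)).
Qed.

(** [ddh] is continuous in e and every term carrying a factor e vanishes at e = 0; only the two
    derivatives that fall on the cosine remain. *)
Let K_cvg x : K n.+1%:R^-1 x @[n --> \oo] --> - (qform A xi / 2) * cos (theta x).
Proof.
have -> : - (qform A xi / 2) * cos (theta x) =
    2^-1 * \sum_i \sum_j A i j * (- (xi ord0 i * xi ord0 j) * cos (theta x)).
  have -> : - (qform A xi / 2) * cos (theta x) =
    2^-1 * (- cos (theta x) * qform A xi) by ring.
  rewrite /qform mulr_sumr; congr (_ * _); apply: eq_bigr => i _.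
  by rewrite !mulr_sumr; apply: eq_bigr => j _; ring.
have cK : continuous (fun e => K e x).
  apply: contM; first exact: cont_cst.
  apply: cont_sum => i; apply: cont_sum => j; apply: contM; first exact: cont_cst.
  exact: ddh_damping_continuous.
suff E : K 0 x = 2^-1 * \sum_i \sum_j A i j * (- (xi ord0 i * xi ord0 j) * cos (theta x)).
  by rewrite -E; exact: (cvg_comp _ _ (@cvg_harmonic R) (cK 0)).
rewrite /K; congr (_ * _).
apply: eq_bigr => i _; apply: eq_bigr => j _; congr (_ * _).
by rewrite /ddh /damp mul0r oppr0 expR0 expr0n/= !(mulr0, mul0r) subr0 !addr0 mulr1.
Qed.

Let inner_E b n e t : 0 < b -> 0 < e -> e <= 1 ->
  \int[Pi t]_x (partial None (phi b n e) (t, x)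
    + 2^-1 * divergence (fun q => A *m grad (phi b n e) q) (t, x)) =
  dcutoff b n t * \int[Pi t]_x h e x + cutoff b n t * \int[Pi t]_x K e x.
Proof.
move=> b0 e0 e1; have hC := h_Cb (ltW e0); have kC := K_Cb (ltW e0) e1.
rewrite -!RintegralZl//; [|exact: Cb_integrable..].
rewrite -RintegralD//; [|by apply: Cb_integrable; exact: CbZ..].
apply: eq_Rintegral => x _; rewrite divergence_schwartz; last exact: schwartz_phi.
rewrite partial_time_phi /= /K; congr (_ + _).
rewrite mulrCA; congr (_ * _); rewrite mulr_sumr; apply: eq_bigr => i _.
rewrite mulr_sumr; apply: eq_bigr => j _.
by rewrite partial2_phi /=; ring.
Qed.

Let c_continuous : continuous c.
Proof.
by apply: (@within_norm_continuous _ (fun t => \int[Pi t]_x cos (theta x))); apply: cPi; exact: Cb_cos.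
Qed.

(** The heat equation is tested with [phi b n e] for e = 1 / (m + 1), and m tends to infinity: first
    inside the integrals over space, then in time under the majorant (1 + t^2)^-1. The right-hand
    side comes from phi (0, 0) = cos a. *)
Let cutoff_identity b n : 0 < b ->
  \int[leb]_(t in `[0, +oo[) (dcutoff b n t * c t - cutoff b n t * (qform A xi / 2 * c t))
  = - cos a.
Proof.
move=> b0; pose e_ (m : nat) : R := m.+1%:R^-1.
have e0 m : 0 < e_ m by rewrite invr_gt0.
have e1 m : e_ m <= 1 by rewrite invf_le1// ler1n.
pose I m t := dcutoff b n t * \int[Pi `|t|]_x h (e_ m) x
  + cutoff b n t * \int[Pi `|t|]_x K (e_ m) x.
have II m : \int[leb]_(t in `[0, +oo[) I m t = - cos a.
  have dot0 (y : V) : dotv y 0 = 0.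
    by rewrite /dotv big1// => i _; rewrite mxE mulr0.
  have phi0 : phi b n (e_ m) (0, 0) = cos a.
    rewrite /phi /h /damp /theta /= /cutoff !dot0 mul0r expr0n/= expr0n/= oppr0 expR0.
    by rewrite mul1r mulr0 oppr0 expR0 mulr1 add0r.
  have := hPi (schwartz_phi n b0 (e0 m)); rewrite phi0.
  move=> <-; apply: eq_Rintegral => t /set_mem/=; rewrite in_itv/= andbT => t0.
  by rewrite [RHS]inner_E// /I ger0_norm.
have [C1 hC1] := dcutoff_decay n 2 b0; have [C2 hC2] := cutoff_decay 2 b0.
have [CK hCK] := K_bound.
have lim : \int[leb]_(t in `[0, +oo[) I m t @[m --> \oo] -->
    \int[leb]_(t in `[0, +oo[) (dcutoff b n t * c t - cutoff b n t * (qform A xi / 2 * c t)).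
  apply: (@Rintegral_dominated_cvg _ _ _ leb _ _ _
    (fun t => (C1 + C2 * `|CK|) * (1 + t ^+ 2)^-1)).
  - exact: measurable_itv.
  - move=> m; apply: measurable_funTS; apply: continuous_measurable_fun.
    apply: contD; apply: contM.
    + exact: dcutoff_continuous.
    + apply: (@within_norm_continuous _ (fun t => \int[Pi t]_x h (e_ m) x)).
      by apply: cPi; apply: h_Cb; exact: ltW.
    + exact: cutoff_continuous.
    + apply: (@within_norm_continuous _ (fun t => \int[Pi t]_x K (e_ m) x)).
      by apply: cPi; apply: K_Cb => //; exact: ltW.
  - move=> t _; rewrite -mulrN.
    apply: cvgD; apply: cvgM; try exact: cvg_cst.
      apply: (@Rintegral_dominated_cvg _ _ _ (Pi `|t|) setT _ _ (fun=> 1)); first exact: measurableT.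
      + by move=> m; apply: Cb_measurable; apply: h_Cb; exact: ltW.
      + by move=> x _; exact: h_cvg.
      + by apply: (@Cb_integrable _ _ (Pi `|t|) (fun=> 1)); exact: Cb_cst.
      + by move=> m x _; apply: h_bound; exact: ltW.
    have -> : - (qform A xi / 2 * c t) =
        \int[Pi `|t|]_x (- (qform A xi / 2) * cos (theta x)).
      by rewrite RintegralZl ?mulNr//; apply: Cb_integrable; exact: Cb_cos.
    apply: (@Rintegral_dominated_cvg _ _ _ (Pi `|t|) setT _ _ (fun=> CK)); first exact: measurableT.
    + by move=> m; apply: Cb_measurable; apply: K_Cb => //; exact: ltW.
    + by move=> x _; exact: K_cvg.
    + by apply: (@Cb_integrable _ _ (Pi `|t|) (fun=> CK)); exact: Cb_cst.
    + by move=> m x _; apply: hCK => //; exact: ltW.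
  - exact: integrable_oneDsqrV.
  - move=> m t; rewrite /= in_itv/= andbT => t0.
    rewrite mulrDl (le_trans (ler_normD _ _))// lerD//.
      rewrite normrM; have h1 : `|\int[Pi `|t|]_x h (e_ m) x| <= 1.
        apply: prob_norm_le; first by apply: Cb_measurable; apply: h_Cb; exact: ltW.
        by move=> x; apply: h_bound; exact: ltW.
      apply: (@le_trans _ _ `|dcutoff b n t|); first by rewrite ler_piMr.
      by apply: le_oneDsqrV => //; exact: hC1.
    rewrite normrM mulrAC; apply: ler_pM => //.
      by apply: (@le_oneDsqrV _ (cutoff b n)) => //; rewrite ger0_norm ?cutoff_ge0 ?hC2.
    apply: (le_trans _ (ler_norm _)); apply: prob_norm_le.
      by apply: Cb_measurable; apply: K_Cb => //; exact: ltW.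
    by move=> x; apply: hCK => //; exact: ltW.
have lim' : \int[leb]_(t in `[0, +oo[) I m t @[m --> \oo] --> - cos a.
  by under eq_fun do rewrite II; exact: cvg_cst.
exact: (cvg_unique _ lim lim').
Qed.

(** In the cutoff identity n now tends to infinity: the term with [dcutoff] tends to - c b, the
    other one to an integral over [0, b]. What results is a linear integral equation for c, with
    initial value cos a. *)
Theorem heat_solution_characteristic t : 0 <= t ->
  \int[Pi t]_x cos (dotv xi x + a) = cos a * expR (- (qform A xi / 2 * t)).
Proof.
move=> t0; set q := qform A xi / 2.
have c1 s : `|c s| <= 1.
  apply: prob_norm_le; first by apply: Cb_measurable; exact: Cb_cos.
  by move=> x; have [] := norm_trig_le (theta x).
suff H : forall b, 0 < b -> c b = cos a - q * \int[leb]_(s in `[0, b]) c s.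
  have := linear_integral_equation c_continuous c1 H t0.
  by rewrite /c ger0_norm.
move=> b b0.
have h1 := cutoff_concentrates b0 c_continuous c1.
have cq : continuous (fun s => q * c s) by apply: contM => //; exact: cont_cst.
have qb s : 0 <= s -> `|q * c s| <= `|q| * (1 + s).
  move=> s0; rewrite normrM ler_wpM2l// (le_trans (c1 s))// lerDl//.
have h2 := cutoff_Rintegral_cvg b0 cq qb.
have h3 : \int[leb]_(t in `[0, +oo[) (dcutoff b n t * c t) -
    \int[leb]_(t in `[0, +oo[) (cutoff b n t * (q * c t)) @[n --> \oo] -->
    - c b - \int[leb]_(t in `[0, b]) (q * c t) by apply: cvgB.
have h4 : \int[leb]_(t in `[0, +oo[) (dcutoff b n t * c t) -
    \int[leb]_(t in `[0, +oo[) (cutoff b n t * (q * c t)) @[n --> \oo] --> - cos a.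
  have E n : \int[leb]_(t in `[0, +oo[) (dcutoff b n t * c t) -
    \int[leb]_(t in `[0, +oo[) (cutoff b n t * (q * c t)) = - cos a.
    have [C1 hC1] := dcutoff_decay n 2 b0; have [C2 hC2] := cutoff_decay 2 b0.
    rewrite -RintegralB ?cutoff_identity//.
    - apply: (@continuous_Rintegrable0y _ _ C1).
        by apply: contM => //; exact: dcutoff_continuous.
      move=> s s0; rewrite normrM (@le_trans _ _ `|dcutoff b n s|) ?ler_piMr//.
      by apply: le_oneDsqrV => //; exact: hC1.
    - apply: (@continuous_Rintegrable0y _ _ (C2 * `|q|)).
        by apply: contM => //; exact: cutoff_continuous.
      move=> s s0; rewrite normrM [leRHS]mulrAC; apply: ler_pM => //.
        by apply: (@le_oneDsqrV _ (cutoff b n)) => //; rewrite ger0_norm ?cutoff_ge0 ?hC2.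
      by rewrite normrM -[leRHS]mulr1 ler_wpM2l.
  by under eq_fun do rewrite E; exact: cvg_cst.
have e : - c b - \int[leb]_(t in `[0, b]) (q * c t) = - cos a.
  exact: (cvg_unique _ h3 h4).
rewrite RintegralZl in e; [|by []|exact: continuous_itv_integrable].
by lra.
Qed.

End heat_uniqueness.

Section heat_unique.
Context (R : realType) (N : nat).
Local Notation V := 'rV[R]_N.

Theorem heat_solution_unique (A : 'M[R]_N) (Pi Pi' : R -> probability V R) :
  narrow_continuous `[0, +oo[ Pi -> heat_solution A Pi ->
  narrow_continuous `[0, +oo[ Pi' -> heat_solution A Pi' ->
  forall t : R, 0 <= t -> Pi' t ≡μ Pi t.
Proof.
move=> cP hP cP' hP' t t0; apply: characteristic_unique => xi.
  have h1 := heat_solution_characteristic xi 0 cP hP t0.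
  have h2 := heat_solution_characteristic xi 0 cP' hP' t0.
  under eq_Rintegral do rewrite -[dotv _ _]addr0.
  by under [RHS]eq_Rintegral do rewrite -[dotv _ _]addr0; rewrite h1 h2.
have h1 := heat_solution_characteristic xi (- (pi / 2)) cP hP t0.
have h2 := heat_solution_characteristic xi (- (pi / 2)) cP' hP' t0.
under eq_Rintegral do rewrite -cosBpihalf.
by under [RHS]eq_Rintegral do rewrite -cosBpihalf; rewrite h1 h2.
Qed.

End heat_unique.

(** * The delay equation *)

Section trigonometric_bounds.
Context (R : realType).
Implicit Types u x : R.

Lemma norm_sin_le u : `|sin u| <= `|u|.
Proof.
have h x : is_derive x 1 (@sin R) (cos x) by exact: is_derive_sin.
have := @MVT_abs R sin cos u 0 1 h.
rewrite sin0 subr0 mulr0 subr0 mul1r; apply=> x _.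
by rewrite subr0 ler_norml cos_geN1 cos_le1.
Qed.

(** The parameter e lets one mean value argument give both the linear bound (e = 1) and the
    quadratic one (e = |u|). The following bounds feed on each other in the same way; only their
    orders matter, not the constants. *)
Lemma norm_cosB1 u (e : R) : (forall x, `|x| <= `|u| -> `|sin x| <= e) ->
  `|cos u - 1| <= e * `|u|.
Proof.
move=> he; have h x : is_derive x 1 (@cos R) (- sin x) by exact: is_derive_cos.
have := @MVT_abs R cos (fun x => - sin x) u 0 e h.
by rewrite cos0 mulr0 subr0; apply=> x hx; rewrite subr0 normrN; exact: he.
Qed.

Lemma norm_cosB1_le u : `|cos u - 1| <= `|u|.
Proof.
rewrite -[leRHS]mul1r; apply: norm_cosB1 => x _.
by rewrite ler_norml sin_geN1 sin_le1.
Qed.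

Lemma norm_cosB1_sqr u : `|cos u - 1| <= u ^+ 2.
Proof.
rewrite -real_normK ?num_real// expr2; apply: norm_cosB1 => x.
exact: le_trans (norm_sin_le _).
Qed.

Lemma norm_sinB u (e : R) : (forall x, `|x| <= `|u| -> `|cos x - 1| <= e) ->
  `|sin u - u| <= e * `|u|.
Proof.
move=> he; have h x : is_derive x 1 (@sin R) (cos x) by exact: is_derive_sin.
by have := @MVT_abs R sin cos u 1 e h he; rewrite sin0 subr0 mulr1.
Qed.

Lemma norm_sinB_sqr u : `|sin u - u| <= u ^+ 2.
Proof.
rewrite -real_normK ?num_real// expr2; apply: norm_sinB => x.
exact: le_trans (norm_cosB1_le _).
Qed.

Lemma norm_sinB_cube u : `|sin u - u| <= `|u| ^+ 3.
Proof.
rewrite exprSr; apply: norm_sinB => x hx.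
rewrite (le_trans (norm_cosB1_sqr _))// -real_normK ?num_real//.
by rewrite lerXn2r// nnegrE.
Qed.

Lemma norm_cos_taylor2 u : `|cos u - 1 + u ^+ 2 / 2| <= u ^+ 4.
Proof.
have h x : is_derive x 1 (fun x => cos x + x ^+ 2 / 2) (x - sin x).
  have h1 := is_derM (is_der_exprn 2 x) (is_der_cst 2^-1 x).
  have h2 : is_derive x 1 (@cos R) (- sin x) by exact: is_derive_cos.
  apply: (is_der_eq (is_derD h2 h1)).
  by rewrite /= expr1 mulr0 addr0; field.
have := @MVT_abs R (fun x => cos x + x ^+ 2 / 2) (fun x => x - sin x) u 0 (`|u| ^+ 3) h.
rewrite cos0 expr0n/= mul0r addr0 mulr0 subr0 addrAC -exprSr.
have -> : `|u| ^+ 4 = u ^+ 4 by rewrite (exprM _ 2 2) real_normK ?num_real// -exprM.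
apply=> x hx; rewrite subr0 distrC (le_trans (norm_sinB_cube _))//.
by rewrite lerXn2r// nnegrE.
Qed.

End trigonometric_bounds.

Section comparison.
Context (R : realType).
Implicit Types (s t x y : R).

(** Meant for a maximum attained at the right end of a window, where f can be compared with its
    values on the left only. *)
Lemma derive_ge_left (f : R -> R) (b d c l : R) : is_derive b 1 f d -> l < b ->
  (forall s, l <= s -> s <= b -> f s - f b <= c * (s - b)) -> c <= d.
Proof.
move=> /is_derP hd lb hf; rewrite leNgt; apply/negP => dc.
have e0 : 0 < (c - d) / 2 by lra.
have /nbhs_ballP[r /= r0 hr] := hd _ e0.
pose k := Num.min (r / 2) (b - l).
have k0 : 0 < k by rewrite /k lt_min; apply/andP; split; lra.
have kr : k <= r / 2 by rewrite /k ge_min lexx.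
have kl : k <= b - l by rewrite /k ge_min lexx orbT.
have kE : b - k - b = - k by lra.
have := hr (b - k); rewrite /ball/= kE opprB addrCA subrr addr0 normrN gtr0_norm//.
move=> /(_ ltac:(lra)); have := hf (b - k); rewrite kE.
move=> /(_ ltac:(lra) ltac:(lra)) h1; rewrite ler_norml => /andP[h2 _]; nra.
Qed.

Lemma le_of_derive_ge0 (f df : R -> R) (a b : R) : a <= b ->
  (forall x, a < x -> x < b -> is_derive x 1 f (df x)) ->
  {within `[a, b], continuous f} ->
  (forall x, a < x -> x < b -> 0 <= df x) -> f a <= f b.
Proof.
rewrite le_eqVlt => /orP[/eqP->//|ab] hd cf h0.
have hd' x : x \in `]a, b[ -> is_derive x 1 f (df x).
  by rewrite in_itv/= => /andP[]; exact: hd.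
have [c] := MVT ab hd' cf; rewrite in_itv/= => /andP[ac cb] e.
by rewrite -subr_ge0 e mulr_ge0 ?h0// subr_ge0 ltW.
Qed.

(** Variation of constants: D x - (M / be) exp (- be x) - f(x) exp (l (x - b)) is non-decreasing on
    [a, b], since the exponential weight is at most 1 there. Applying this to f and to - f gives the
    two sides of the bound. *)
Lemma linear_comparison (f df : R -> R) (l D M be a b : R) : 0 <= l -> 0 < be ->
  0 <= M -> a <= b -> (forall x, a <= x -> {for x, continuous f}) ->
  (forall x, a < x -> x < b -> is_derive x 1 f (df x)) ->
  (forall x, a < x -> x < b -> `|df x + l * f x| <= D + M * expR (- (be * x))) ->
  0 <= D ->
  `|f b - f a * expR (- (l * (b - a)))| <= D * (b - a) + M / be * expR (- (be * a)).
Proof.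
move=> l0 be0 M0 ab cf hd hD D0.
have cE (k c : R) : continuous (fun x => expR (k * (x - c))).
  apply: cont_expR; apply: contM; first exact: cont_cst.
  by apply: contB; [move=> x; exact: cvg_id|exact: cont_cst].
have dE (k c x : R) : is_derive x 1 (fun x => expR (k * (x - c))) (k * expR (k * (x - c))).
  have h := is_derZ k (is_derB (is_der_id x) (is_der_cst c x)).
  by apply: (is_der_eq (is_der_expR h)); rewrite subr0 mulr1.
have key (f' df' : R -> R) : (forall x, a <= x -> {for x, continuous f'}) ->
  (forall x, a < x -> x < b -> is_derive x 1 f' (df' x)) ->
  (forall x, a < x -> x < b -> `|df' x + l * f' x| <= D + M * expR (- (be * x))) ->
  f' b - f' a * expR (- (l * (b - a))) <= D * (b - a) + M / be * expR (- (be * a)).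
  move=> cf' hd' hD'.
  pose g x := D * x - M / be * expR (- be * (x - 0)) - f' x * expR (l * (x - b)).
  have dg x : a < x -> x < b -> is_derive x 1 g
     (D + M * expR (- be * (x - 0)) - (df' x + l * f' x) * expR (l * (x - b))).
    move=> ax xb; have h1 := is_derZ D (is_der_id x).
    have h2 := is_derZ (M / be) (dE (- be) 0 x).
    have h3 := is_derM (hd' x ax xb) (dE l b x).
    apply: (is_der_eq (is_derB (is_derB h1 h2) h3)).
    have := lt0r_neq0 be0; move: (expR _) (expR _) => u v be1; field.
    exact: be1.
  have cg : {within `[a, b], continuous g}.
    apply: continuous_in_subspaceT => x /set_mem/=; rewrite in_itv/= => /andP[ax _].
    apply: cvgB; last by apply: cvgM; [exact: cf'|exact: cE].
    apply: cvgB; apply: cvgM; try exact: cvg_cst; first exact: cvg_id.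
    exact: cE.
  have g0 x : a < x -> x < b ->
    0 <= D + M * expR (- be * (x - 0)) - (df' x + l * f' x) * expR (l * (x - b)).
    move=> ax xb; have hx := hD' x ax xb; rewrite subr0 mulNr subr_ge0.
    have e1 : expR (l * (x - b)) <= 1.
      by rewrite -expR0 ler_expR; apply: mulr_ge0_le0 => //; lra.
    have e2 := expR_ge0 (l * (x - b)).
    move: hx; rewrite ler_norml => /andP[_ hx].
    apply: (le_trans (ler_wpM2r e2 hx)).
    by rewrite ler_piMr// addr_ge0// mulr_ge0// expR_ge0.
  have := le_of_derive_ge0 ab dg cg g0.
  rewrite /g !subr0 subrr mulr0 expR0 mulr1.
  have -> : l * (a - b) = - (l * (b - a)) by ring.
  have -> : - be * a = - (be * a) by ring.
  have MX : 0 <= M / be * expR (- be * b).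
    by rewrite mulr_ge0 ?expR_ge0// divr_ge0// ltW.
  by rewrite mulrBr; lra.
rewrite ler_norml; apply/andP; split; last exact: key.
have := key (fun x => - f x) (fun x => - df x).
move=> /(_ (fun x ax => cvgN (cf x ax)) (fun x ax xb => is_derN (hd x ax xb))).
move=> H; suff : - f b - - f a * expR (- (l * (b - a))) <=
    D * (b - a) + M / be * expR (- (be * a)) by lra.
by apply: H => x ax xb; rewrite mulrN -opprD normrN; exact: hD.
Qed.

End comparison.

(** * Contraction of the oscillation *)

Section delay_functional.
Context (R : realType) d (Om : measurableType d) (P : probability Om R).
Variables (th : Om -> R) (al : R -> Om -> R) (A : R).
Hypotheses (mth : measurable_fun setT th) (th_itv : forall p, -1 <= th p <= 0).
Hypotheses (mal : forall t, measurable_fun setT (al t))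
  (al_itv : forall t p, 0 <= al t p <= A).
Implicit Types (y h : R -> R) (s t e : R) (p : Om).

Let A0 : 0 <= A.
Proof. by have /andP[a b] := al_itv 0 point; exact: le_trans b. Qed.

Lemma prob_le (f : Om -> R) (B M : R) : measurable_fun setT f ->
  (forall p, `|f p| <= M) -> (forall p, f p <= B) -> \int[P]_p f p <= B.
Proof.
move=> mf fM fB; rewrite -[leRHS](Rintegral_pcst P); apply: le_Rintegral => //.
  by apply: (@bounded_integrable _ _ _ P setT f M).
by apply: (@bounded_integrable _ _ _ P setT (fun=> B) `|B|).
Qed.

Lemma measurable_lag y t : continuous y -> measurable_fun setT (fun p => y (t + th p)).
Proof.
by move=> cy; apply: measurable_cont_comp => //; apply: measurable_funD.
Qed.

Definition delay_ode y h := forall t, 0 < t ->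
  is_derive t 1 y (\int[P]_p (al t p * (y (t + th p) - y t)) + h t).

Section oscillation.
Variables (y h : R -> R) (e : R).
Hypotheses (cy : continuous y) (y1 : forall t, `|y t| <= 1).
Hypothesis (hy : delay_ode y h).
Hypothesis (he : forall t, 0 < t -> h t < e).

Let ybd t s : `|y t - y s| <= 2.
Proof. by rewrite (le_trans (ler_normB _ _))//; have := y1 t; have := y1 s; lra. Qed.

Let lag_bound t p : `|al t p * (y (t + th p) - y t)| <= A * 2.
Proof.
have /andP[a0 aA] := al_itv t p.
by rewrite normrM ler_pM// ger0_norm.
Qed.

Let mlag t : measurable_fun setT (fun p => al t p * (y (t + th p) - y t)).
Proof. by apply: measurable_funM => //; apply: measurable_funB => //; exact: measurable_lag. Qed.

(** A maximum principle: if y minus a ramp of slope e had its maximum at some b > t, the derivative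
    of y at b would be at least e; but there all lagged values are at most y b, so the equation
    gives a derivative at most h b < e. *)
Lemma delay_window_upper (t Mx : R) : 0 <= t -> 0 <= e ->
  (forall s, t - 1 <= s <= t -> y s <= Mx) ->
  forall s, t <= s <= t + 1 -> y s <= Mx + e.
Proof.
move=> t0 e0 hM s /andP[ts st].
(* The ramp is non-decreasing and zero before t: G (b + th p) <= G b therefore implies y (b + th p)
   <= y b, whichever side of t the lagged time falls on. *)
pose G s := y s - e * Num.max (s - t) 0.
have cG : continuous G.
  apply: contB => //; apply: contM; first exact: cont_cst.
  have cst : continuous (fun s => s - t).
    by apply: contB; [move=> z; exact: cvg_id|exact: cont_cst].
  by move=> x; apply: (@continuous_max _ _ (fun s => s - t) (fun=> 0)); [exact: cst|exact: cst_continuous].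
have tt : t - 1 <= t + 1 by lra.
have [b] := EVT_max tt (continuous_subspaceT cG); rewrite in_itv/= => /andP[b1 b2] hb.
have Gs : G s <= G b by apply: hb; rewrite in_itv/=; lra.
have GE x : t <= x -> G x = y x - e * (x - t) by move=> tx; rewrite /G max_l//; lra.
have [bt|tb] := leP b t.
  move: Gs; rewrite (GE s)// /G max_r; last by lra.
  have hes : e * (s - t) <= e by rewrite ler_piMr//; lra.
  by have := hM b; rewrite b1 bt => /(_ isT); lra.
exfalso.
have b0 : 0 < b by lra.
have h1 := derive_ge_left (hy b0) tb (c := e).
have h2 x : t <= x -> x <= b -> y x - y b <= e * (x - b).
  move=> tx xb; have : G x <= G b by apply: hb; rewrite in_itv/=; lra.
  by rewrite !GE//; [lra|exact: ltW].
have h3 : \int[P]_p (al b p * (y (b + th p) - y b)) <= 0.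
  apply: (@prob_le _ _ (A * 2)) => // p.
  have /andP[a0 _] := al_itv b p; have /andP[hp1 hp2] := th_itv p.
  apply: mulr_ge0_le0 => //.
  have : G (b + th p) <= G b by apply: hb; rewrite in_itv/=; lra.
  rewrite (GE b (ltW tb)) /G.
  have h3 : e * th p <= 0 by rewrite mulr_ge0_le0.
  have h4 : 0 <= e * (b - t) by rewrite mulr_ge0//; lra.
  by case: (leP (b + th p - t) 0) => _; lra.
by have := h1 h2; have := he b0; lra.
Qed.

(* On [t, t + 1] the gap Mx + e - y to the maximum of the previous window
   decays at rate at most A. *)
Lemma delay_window_contract (t Mx : R) : 0 <= t -> 0 <= e ->
  (forall s, t - 1 <= s <= t -> y s <= Mx) ->
  forall s, t <= s <= t + 1 -> y s <= Mx + 2 * e - (Mx - y t) * expR (- A).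
Proof.
move=> t0 e0 hM s /andP[ts st].
have hw x : t - 1 <= x <= t + 1 -> y x <= Mx + e.
  move=> /andP[x1 x2]; have [xt|tx] := leP x t.
    by have := hM x; rewrite x1 xt => /(_ isT); lra.
  by apply: (delay_window_upper t0 e0 hM); rewrite x2 ltW.
(* All values on the two windows are at most Mx + e, so y' <= A (Mx + e - y) + e. The correction e
   (x - t) absorbs the term e, the exponential absorbs the rate A, and k is non-decreasing. *)
pose k x := (Mx + e - y x + e * (x - t)) * expR (A * (x - t)).
pose I x := \int[P]_p (al x p * (y (x + th p) - y x)).
have dk x : t < x -> x < s -> is_derive x 1 k
    ((- (I x + h x) + e + A * (Mx + e - y x + e * (x - t))) * expR (A * (x - t))).
  move=> tx xs; have x0 : 0 < x by lra.
  have h1 := is_derB (is_der_cst (Mx + e) x) (hy x0).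
  have h2 := is_derB (is_der_id x) (is_der_cst t x).
  have h3 := is_derM (is_derD h1 (is_derZ e h2)) (is_der_expR (is_derZ A h2)).
  by apply: (is_der_eq h3); rewrite -/(I x); ring.
have ck : {within `[t, s], continuous k}.
  apply: continuous_subspaceT.
  have cxt : continuous (fun x : R => x - t).
    by apply: contB; [move=> z; exact: cvg_id|exact: cont_cst].
  apply: contM; last by apply: cont_expR; apply: contM => //; exact: cont_cst.
  apply: contD; last by apply: contM => //; exact: cont_cst.
  by apply: contB => //; exact: cont_cst.
have k0 x : t < x -> x < s ->
    0 <= (- (I x + h x) + e + A * (Mx + e - y x + e * (x - t))) * expR (A * (x - t)).
  move=> tx xs; rewrite mulr_ge0 ?expR_ge0//; have x0 : 0 < x by lra.
  have hx := he x0.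
  have yx : y x <= Mx + e by apply: hw; lra.
  have hI : I x <= A * (Mx + e - y x).
    apply: (@prob_le _ _ (A * 2)) => // p.
    have /andP[a0 aA] := al_itv x p; have /andP[hp1 hp2] := th_itv p.
    have hyl : y (x + th p) <= Mx + e by apply: hw; lra.
    by nra.
  have Ae : 0 <= A * (e * (x - t)) by rewrite !mulr_ge0//; lra.
  by rewrite mulrDr; lra.
have := le_of_derive_ge0 ts dk ck k0.
rewrite /k subrr !mulr0 expR0 mulr1 addr0 => hk.
have E1 := expR_gt0 (- (A * (s - t))).
have : (Mx + e - y t) * expR (- (A * (s - t))) <= Mx + e - y s + e * (s - t).
  by rewrite expRN ler_pdivrMr ?expR_gt0.
have E2 : expR (- A) <= expR (- (A * (s - t))).
  by rewrite ler_expR lerN2; have := A0; nra.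
have yt : y t <= Mx by apply: hM; lra.
have := expR_ge0 (- A); nra.
Qed.

End oscillation.

Lemma delay_odeN y h : continuous y -> (forall t, `|y t| <= 1) ->
  delay_ode y h -> delay_ode (fun t => - y t) (fun t => - h t).
Proof.
move=> cy y1 hy t t0; apply: (is_der_eq (is_derN (hy t t0))).
rewrite opprD; congr (_ + _); rewrite -mulN1r -RintegralZl//.
  by apply: eq_Rintegral => p _; ring.
apply: (@bounded_integrable _ _ _ P setT _ (A * 2)) => // [|p _].
  by apply: measurable_funM => //; apply: measurable_funB => //; exact: measurable_lag.
have /andP[a0 aA] := al_itv t p.
rewrite normrM; apply: ler_pM => //; first by rewrite ger0_norm.
rewrite (le_trans (ler_normB _ _))//.
by have := y1 t; have := y1 (t + th p); lra.
Qed.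

(** The window contraction is applied to y and to - y. The gaps from y (t - 1) to the maximum and to
    the minimum of the previous window add up to its oscillation, so the oscillation is multiplied
    by 1 - exp (- A) and increased by 4 e. The value 4 e exp A is the fixed point of this recursion,
    and 2 is the initial oscillation. *)
Lemma delay_oscillation y h e : continuous y -> (forall t, `|y t| <= 1) ->
  delay_ode y h -> 0 <= e -> (forall t, 0 < t -> `|h t| < e) ->
  forall (n : nat) t, n%:R <= t -> forall s s', t - 1 <= s <= t -> t - 1 <= s' <= t ->
  `|y s - y s'| <= 2 * (1 - expR (- A)) ^+ n + 4 * e * expR A.
Proof.
move=> cy y1 hy e0 he; elim=> [|n ih] t nt.
  move=> s s' _ _; rewrite expr0 mulr1 (le_trans (ler_normB _ _))//.
  have E : 0 <= 4 * e * expR A by rewrite !mulr_ge0// expR_ge0.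
  by have := y1 s; have := y1 s'; lra.
have nt' : n%:R <= t - 1 by rewrite -(natr1 n) in nt; lra.
have t10 : 0 <= t - 1 by exact: le_trans nt'.
have tt : t - 1 - 1 <= t - 1 by lra.
have [a] := EVT_max tt (continuous_subspaceT cy); rewrite in_itv/= => ha ma.
have [b] := EVT_min tt (continuous_subspaceT cy); rewrite in_itv/= => hb mb.
have hab := ih _ nt' _ _ ha hb.
have hy' := delay_odeN cy y1 hy.
have cy' : continuous (fun t => - y t) by exact: contN.
have y1' t' : `|- y t'| <= 1 by rewrite normrN.
have he1 t' : 0 < t' -> h t' < e by move=> /he; rewrite ltr_norml => /andP[].
have he2 t' : 0 < t' -> - h t' < e by move=> /he; rewrite ltr_norml => /andP[]; lra.
have up := @delay_window_contract y h e cy y1 hy he1 (t - 1) (y a) t10 e0.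
have lo := @delay_window_contract _ _ e cy' y1' hy' he2 (t - 1) (- y b) t10 e0.
rewrite subrK in up lo.
have {}up := up (fun s hs => ma s hs).
have {}lo : forall s, t - 1 <= s <= t ->
    - y s <= - y b + 2 * e - (- y b - - y (t - 1)) * expR (- A).
  by apply: lo => s hs; rewrite lerN2; apply: mb.
have wlog s s' : t - 1 <= s <= t -> t - 1 <= s' <= t ->
    y s - y s' <= 2 * (1 - expR (- A)) ^+ n.+1 + 4 * e * expR A.
  move=> hs hs'; have h1 := up s hs; have h2 := lo s' hs'.
  have h3 : y a - y b <= 2 * (1 - expR (- A)) ^+ n + 4 * e * expR A.
    by rewrite (le_trans (ler_norm _)).
  have EA : expR A * expR (- A) = 1 by rewrite expRxMexpNx_1.
  have E1 : expR (- A) <= 1 by rewrite -expR0 ler_expR oppr_le0.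
  have h4 := ler_wpM2l (_ : 0 <= 1 - expR (- A)) h3.
  have {}h4 := h4 ltac:(lra).
  have -> : 2 * (1 - expR (- A)) ^+ n.+1 + 4 * e * expR A =
    (1 - expR (- A)) * (2 * (1 - expR (- A)) ^+ n + 4 * e * expR A) + 4 * e.
    rewrite exprS; transitivity (2 * ((1 - expR (- A)) * (1 - expR (- A)) ^+ n)
      + 4 * e * expR A - 4 * e * (expR A * expR (- A)) + 4 * e); last by ring.
    by rewrite EA; ring.
  by lra.
by move=> s s' hs hs'; rewrite ler_norml; have := wlog s s' hs hs'; have := wlog s' s hs' hs; lra.
Qed.

End delay_functional.

(** * Estimate at a fixed frequency *)

Section delay_estimate.
Context (R : realType) d (Om : measurableType d) (P : probability Om R).
Local Notation mu := (@lebesgue_measure R).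
Variables (th : Om -> R) (al : R -> Om -> R) (ali w : Om -> R) (A M be ka : R).
Variables (C S : R -> R).
Hypotheses (mth : measurable_fun setT th) (th_itv : forall p, -1 <= th p <= 0).
Hypotheses (mal : forall t, measurable_fun setT (al t))
  (al_itv : forall t p, 0 <= al t p <= A).
Hypotheses (mali : measurable_fun setT ali) (ali_itv : forall p, 0 <= ali p <= A).
Hypotheses (M0 : 0 <= M) (be0 : 0 < be).
Hypothesis al_ali : forall t p, 0 <= t -> `|al t p - ali p| <= M * expR (- (be * t)).
Hypotheses (mw : measurable_fun setT w) (iw : P.-integrable setT (EFin \o w)).
Hypothesis ka_eq : ka = \int[P]_p (ali p * w p).
Hypotheses (cC : continuous C) (cS : continuous S).
Hypotheses (C1 : forall t, `|C t| <= 1) (S1 : forall t, `|S t| <= 1).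
Implicit Types (s t x e : R) (p : Om) (n : nat).

(** With Phi = C + i S, this is the real part of exp (i w) Phi (t + th) - Phi t. In the same way ka
    S is the real part of - i ka Phi, the contribution of the moving frame. *)
Let X t p := cos (w p) * C (t + th p) - sin (w p) * S (t + th p) - C t.

Hypothesis dC : forall t, 0 < t ->
  is_derive t 1 C (\int[P]_p (al t p * X t p) + ka * S t).

(** [E1] measures the size of the frequency. The integral of ali (1 - exp (i w) + i w) has real part
    [pp] and imaginary part - [rr]. *)
Let E1 := \int[P]_p `|w p|.
Let Gm := 1 + \int[P]_p (- th p * ali p).
Let pp := \int[P]_p (ali p * (1 - cos (w p))).
Let rr := \int[P]_p (ali p * (sin (w p) - w p)).

Let A0 : 0 <= A. Proof. by have /andP[a b] := ali_itv point; exact: le_trans b. Qed.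

Let bint (f : Om -> R) (B : R) : measurable_fun setT f -> (forall p, `|f p| <= B) ->
  P.-integrable setT (EFin \o f).
Proof. by move=> mf fB; apply: (@bounded_integrable _ _ _ P setT f B). Qed.

Let iabsw : P.-integrable setT (EFin \o (fun p => `|w p|)).
Proof. exact: integrable_norm. Qed.

Let E10 : 0 <= E1. Proof. exact: Rintegral_ge0. Qed.

Let mcos : measurable_fun setT (fun p => cos (w p)).
Proof. by apply: measurable_cont_comp => //; exact: continuous_cos. Qed.

Let msin : measurable_fun setT (fun p => sin (w p)).
Proof. by apply: measurable_cont_comp => //; exact: continuous_sin. Qed.

Let mX t : measurable_fun setT (X t).
Proof.
by apply: measurable_funB => //; apply: measurable_funB; apply: measurable_funM => //;
  exact: measurable_lag.
Qed.

Let cs1 p : `|cos (w p)| <= 1. Proof. by rewrite ler_norml cos_geN1 cos_le1. Qed.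
Let sn1 p : `|sin (w p)| <= 1. Proof. by rewrite ler_norml sin_geN1 sin_le1. Qed.

Let mul1 (a b B : R) : `|a| <= 1 -> `|b| <= B -> `|a * b| <= B.
Proof. by move=> ha hb; rewrite normrM -[leRHS]mul1r ler_pM. Qed.

Let X3 t p : `|X t p| <= 3.
Proof.
have h1 := mul1 (cs1 p) (C1 (t + th p)); have h2 := mul1 (sn1 p) (S1 (t + th p)).
rewrite (le_trans (ler_normB _ _))//.
have := ler_normB (cos (w p) * C (t + th p)) (sin (w p) * S (t + th p)).
by have := C1 t; lra.
Qed.

Let alA t p (u B : R) : `|u| <= B -> `|al t p * u| <= A * B.
Proof.
have /andP[a0 aA] := al_itv t p.
by move=> uB; rewrite normrM ler_pM// ger0_norm.
Qed.

Let aliA p (u B : R) : `|u| <= B -> `|ali p * u| <= A * B.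
Proof.
have /andP[a0 aA] := ali_itv p.
by move=> uB; rewrite normrM ler_pM// ger0_norm.
Qed.

Let dominated (f : Om -> R) (a b : R) : measurable_fun setT f ->
  (forall p, `|f p| <= a + b * `|w p|) -> `|\int[P]_p f p| <= a + b * E1.
Proof.
move=> mf hf; have i1 : P.-integrable setT (EFin \o (fun=> a)) by exact: (@bint _ `|a|).
have i2 : P.-integrable setT (EFin \o (fun p => b * `|w p|)).
  exact: (integrableZl measurableT b iabsw).
have -> : a + b * E1 = \int[P]_p (a + b * `|w p|).
  by rewrite RintegralD// Rintegral_pcst RintegralZl.
apply: le_normr_Rintegral_dominated => //.
exact: (integrableD measurableT i1 i2).
Qed.

Let ka_le : `|ka| <= A * E1.
Proof.
rewrite ka_eq -[leRHS]add0r; apply: dominated; first exact: measurable_funM.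
by move=> p; rewrite add0r; exact: aliA.
Qed.

Variable dl : R.
Hypothesis dl0 : 0 < dl.
(** The perturbation in the equation of C is at most 2 A E1 from the rotation by w, plus A E1 from
    [ka]. The term [dl] makes the inequality strict, as the maximum principle demands. *)
Let ep := 3 * A * E1 + dl.
Let osc n := 2 * (1 - expR (- A)) ^+ n + 4 * ep * expR A.

Let AE : 0 <= A * E1. Proof. exact: mulr_ge0. Qed.
Let ep0 : 0 < ep. Proof. by have := AE; move: dl0; rewrite /ep; lra. Qed.

(** The rotation by w and the term with S are treated as a forcing of order E1 in the delay equation
    at zero frequency, to which the contraction applies. *)
Let C_osc n t : n%:R <= t -> forall s s', t - 1 <= s <= t -> t - 1 <= s' <= t ->
  `|C s - C s'| <= osc n.
Proof.
pose h t := \int[P]_p (al t p * ((cos (w p) - 1) * C (t + th p)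
  - sin (w p) * S (t + th p))) + ka * S t.
have mh t' : measurable_fun setT (fun p => al t' p * ((cos (w p) - 1) * C (t' + th p)
  - sin (w p) * S (t' + th p))).
  apply: measurable_funM => //; apply: measurable_funB; apply: measurable_funM => //;
    try exact: measurable_lag.
  exact: measurable_funB.
have hb t' p : `|(cos (w p) - 1) * C (t' + th p) - sin (w p) * S (t' + th p)| <= 2 * `|w p|.
  rewrite (le_trans (ler_normB _ _))//.
  have h1 : `|(cos (w p) - 1) * C (t' + th p)| <= `|w p|.
    by rewrite mulrC; apply: mul1 => //; exact: norm_cosB1_le.
  have h2 : `|sin (w p) * S (t' + th p)| <= `|w p|.
    by rewrite mulrC; apply: mul1 => //; exact: norm_sin_le.
  by lra.
apply: (@delay_oscillation _ _ _ P th al A mth th_itv mal al_itv C h) => //.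
- move=> t' t'0; apply: (is_der_eq (dC t'0)); rewrite /h addrA; congr (_ + _).
  have mL : measurable_fun setT (fun p => al t' p * (C (t' + th p) - C t')).
    by apply: measurable_funM => //; apply: measurable_funB => //; exact: measurable_lag.
  rewrite -RintegralD//.
  - by apply: eq_Rintegral => p _; rewrite /X; ring.
  - apply: (@bint _ (A * 2)) => // p; apply: alA.
    by rewrite (le_trans (ler_normB _ _))//; have := C1 (t' + th p); have := C1 t'; lra.
  - apply: (@bint _ (A * 4)) => // p; apply: alA.
    have h3 := hb t' p; rewrite (le_trans (ler_normB _ _))//.
    have h1 : `|cos (w p) - 1| <= 2.
      by rewrite (le_trans (ler_normB _ _))//; have := cs1 p; rewrite normr1; lra.
    have h2 : `|(cos (w p) - 1) * C (t' + th p)| <= 2 by rewrite mulrC; exact: mul1.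
    by have := mul1 (sn1 p) (S1 (t' + th p)); lra.
- exact: ltW.
- move=> t' t'0; rewrite /h (le_lt_trans (ler_normD _ _))//.
  have h1 : `|\int[P]_p (al t' p * ((cos (w p) - 1) * C (t' + th p)
      - sin (w p) * S (t' + th p)))| <= 0 + (A * 2) * E1.
    apply: dominated => // p; rewrite add0r -mulrA; exact: alA.
  have h2 : `|ka * S t'| <= A * E1 by rewrite mulrC; exact: mul1.
  by move: dl0; rewrite /ep; lra.
Qed.

(* Lags reach down to t - 1 > -2 for t > -1. *)
Let prim (c : R -> R) x := \int[mu]_(t in `[-2, x]) c t.

Let prim_mvt (c : R -> R) x y : continuous c -> -2 < x -> x <= y ->
  exists2 z, x <= z <= y & prim c y - prim c x = c z * (y - x).
Proof.
move=> cc x2 xy.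
have h1 z : x <= z -> is_derive z 1 (prim c) (c z).
  by move=> xz; apply: is_der_primitive => //; exact: lt_le_trans xz.
have h2 z : z \in `]x, y[ -> is_derive z 1 (prim c) (c z).
  by rewrite in_itv/= => /andP[xz _]; apply: h1; exact: ltW.
have h3 : {within `[x, y], continuous (prim c)}.
  apply: continuous_in_subspaceT => z /set_mem/=; rewrite in_itv/= => /andP[xz _].
  exact: is_der_cont (h1 z xz).
by have [z hz e] := MVT_segment xy h2 h3; exists z => //; rewrite in_itv/= in hz.
Qed.

Let prim_lag (c : R -> R) t p : continuous c -> -1 < t ->
  exists2 z, t - 1 <= z <= t & prim c t - prim c (t + th p) = c z * - th p.
Proof.
move=> cc t1; have /andP[h1 h2] := th_itv p.
have a1 : -2 < t + th p by lra.
have a2 : t + th p <= t by lra.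
have [z /andP[z1 z2] ->] := prim_mvt cc a1 a2.
by exists z; [lra|congr (_ * _); ring].
Qed.

Let prim_le1 (c : R -> R) t p : continuous c -> (forall t, `|c t| <= 1) -> -1 < t ->
  `|prim c t - prim c (t + th p)| <= 1.
Proof.
move=> cc c1 t1; have [z _ ->] := prim_lag p cc t1.
apply: mul1 => //; rewrite normrN ler_norml; have := th_itv p; lra.
Qed.

Let mprim (c : R -> R) t : continuous c -> -1 < t ->
  measurable_fun setT (fun p => prim c t - prim c (t + th p)).
Proof.
move=> cc t1; apply: measurable_funB => //.
have mI : measurable (`]-2%R, +oo[ : set (measurableTypeR R)) by exact: measurable_itv.
apply: (@measurable_comp _ _ _ _ _ _ (`]-2%R, +oo[ : set (measurableTypeR R)) (prim c)) => //.
- move=> _ [p _ <-] /=; rewrite in_itv/= andbT; have := th_itv p; lra.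
- apply: subspace_continuous_measurable_fun => //.
  apply: continuous_in_subspaceT => z /set_mem/=; rewrite in_itv/= andbT => z2.
  exact: is_der_cont (is_der_primitive cc z2).
- exact: measurable_funD.
Qed.

(** The real part of ali exp (i w) times the integral of C + i S over [t + th, t]. *)
Let F t p := ali p * (cos (w p) * (prim C t - prim C (t + th p))
  - sin (w p) * (prim S t - prim S (t + th p))).
Let Y t p := ali p * (cos (w p) * (C t - C (t + th p)) - sin (w p) * (S t - S (t + th p))).
(* The derivative of J contains C and S only at time t, up to the error Z that
   comes from al - ali. *)
Let J t := C t + \int[P]_p F t p.

Let mF t : -1 < t -> measurable_fun setT (F t).
Proof.
by move=> t1; apply: measurable_funM => //; apply: measurable_funB; apply: measurable_funM => //;
  exact: mprim.
Qed.

Let iF t : -1 < t -> P.-integrable setT (EFin \o F t).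
Proof.
move=> t1; apply: (@bint _ (A * 2)); first exact: mF.
move=> p; apply: aliA; rewrite (le_trans (ler_normB _ _))//.
have h1 := mul1 (cs1 p) (prim_le1 p cC C1 t1).
by have h2 := mul1 (sn1 p) (prim_le1 p cS S1 t1); lra.
Qed.

Let mY t : measurable_fun setT (Y t).
Proof.
by apply: measurable_funM => //; apply: measurable_funB; apply: measurable_funM => //;
  apply: measurable_funB => //; exact: measurable_lag.
Qed.

Let Y4 t p : `|Y t p| <= A * 4.
Proof.
apply: aliA; rewrite (le_trans (ler_normB _ _))//.
have h1 : `|C t - C (t + th p)| <= 2.
  by rewrite (le_trans (ler_normB _ _))//; have := C1 t; have := C1 (t + th p); lra.
have h2 : `|S t - S (t + th p)| <= 2.
  by rewrite (le_trans (ler_normB _ _))//; have := S1 t; have := S1 (t + th p); lra.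
by have := mul1 (cs1 p) h1; have := mul1 (sn1 p) h2; lra.
Qed.

Let dF t : -1 < t -> is_derive t 1 (fun t => \int[P]_p F t p) (\int[P]_p Y t p).
Proof.
move=> t1; have tt : -1 < t < t + 1 by lra.
apply: (@is_der_integral _ _ _ P setT F Y (fun=> A * 4) t (-1) (t + 1)) => //.
- by move=> x /andP[x1 _]; exact: iF.
- move=> x p /andP[x1 _] _; have := th_itv p => /andP[h1 _].
  have hx : -2 < x by lra.
  have hl : -2 < x + th p by lra.
  have dP (c : R -> R) : continuous c ->
      is_derive x 1 (fun x => prim c x - prim c (x + th p)) (c x - c (x + th p)).
    move=> cc; apply: is_derB; first exact: is_der_primitive.
    by apply: is_der_shift; exact: is_der_primitive.
  by apply: is_derZ; apply: is_derB; apply: is_derZ; exact: dP.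
- by apply: (@bint _ `|A * 4|).
Qed.

Let Z t p := (al t p - ali p) * X t p.

(** Once [al] is replaced by [ali], at the price of [Z], the lagged terms of C' and of [Y] cancel.
    By [ka_eq] the term ka S removes the linear part of sin w, which leaves the defect sin w - w in
    [rr]. *)
Let dJ t : 0 < t -> is_derive t 1 J (\int[P]_p Z t p - C t * pp - S t * rr).
Proof.
move=> t0; have t1 : -1 < t by lra.
apply: (is_der_eq (is_derD (dC t0) (dF t1))).
have iZ : P.-integrable setT (EFin \o Z t).
  apply: (@bint _ (M * expR (- (be * t)) * 3)).
    by apply: measurable_funM => //; exact: measurable_funB.
  by move=> p; rewrite normrM ler_pM//; exact: al_ali (ltW t0).
have iY : P.-integrable setT (EFin \o Y t) by exact: (@bint _ (A * 4)).
have ip : P.-integrable setT (EFin \o (fun p => ali p * (1 - cos (w p)))).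
  apply: (@bint _ (A * 2)).
    by apply: measurable_funM => //; exact: measurable_funB.
  move=> p; apply: aliA; rewrite (le_trans (ler_normB _ _))// normr1.
  by have := cs1 p; lra.
have iA : P.-integrable setT (EFin \o (fun p => ali p * w p)).
  apply: (dominated_Rintegrable measurableT _ (integrableZl measurableT A iabsw)).
    exact: measurable_funM.
  by move=> p _; exact: aliA.
have ir : P.-integrable setT (EFin \o (fun p => ali p * (sin (w p) - w p))).
  apply: (dominated_Rintegrable measurableT _ (integrableZl measurableT (A * 2) iabsw)).
    by apply: measurable_funM => //; exact: measurable_funB.
  move=> p _; rewrite /= -mulrA; apply: aliA; rewrite (le_trans (ler_normB _ _))//.
  by have := norm_sin_le (w p); lra.
have i1 := integrableZl measurableT (C t) ip.
have i2 := integrableZl measurableT (S t) ir.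
have i3 := integrableZl measurableT (S t) iA.
have j1 := integrableB measurableT iZ i1.
have j2 := integrableB measurableT j1 i2.
have j3 := integrableB measurableT j2 i3.
have -> : \int[P]_p (al t p * X t p) =
    \int[P]_p (Z t p - C t * (ali p * (1 - cos (w p)))
      - S t * (ali p * (sin (w p) - w p)) - S t * (ali p * w p) - Y t p).
  by apply: eq_Rintegral => p _; rewrite /Z /Y /X; ring.
rewrite (RintegralB measurableT j3 iY) (RintegralB measurableT j2 i3).
rewrite (RintegralB measurableT j1 i2) (RintegralB measurableT iZ i1).
rewrite !RintegralZl// -ka_eq -/pp -/rr; ring.
Qed.

(** The mean value theorem writes the integral of C over the lag as C z times - th, with z in the
    last window. Replacing C z by C t costs the oscillation, and replacing exp (i w) by 1 costs 2
    |w|. *)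
Let J_close n t : n%:R <= t -> `|J t - Gm * C t| <= A * osc n + 2 * A * E1.
Proof.
move=> nt; have t1 : -1 < t by have := ler0n R n; lra.
have mth' : measurable_fun setT (fun p => - th p * ali p).
  by apply: measurable_funM => //; exact: measurableT_comp.
have ith : P.-integrable setT (EFin \o (fun p => - th p * ali p)).
  apply: (@bint _ (A * 1)) => // p; rewrite mulrC; apply: aliA.
  by rewrite normrN ler_norml; have := th_itv p; lra.
have -> : J t - Gm * C t = \int[P]_p (F t p - C t * (- th p * ali p)).
  rewrite RintegralB//; [|exact: iF|exact: (integrableZl measurableT (C t) ith)].
  by rewrite RintegralZl// /J /Gm; ring.
apply: dominated.
  by apply: measurable_funB; [exact: mF|exact: measurable_funM].
move=> p; have [z hz ez] := prim_lag p cC t1.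
have tt : t - 1 <= t <= t by rewrite lexx andbT; lra.
have oz := C_osc nt hz tt.
have -> : F t p - C t * (- th p * ali p) = ali p * ((cos (w p) - 1) * (C z * - th p)
   - sin (w p) * (prim S t - prim S (t + th p)) + (- th p) * (C z - C t)).
  by rewrite /F ez; ring.
have -> : A * osc n + 2 * A * `|w p| = A * (`|w p| + `|w p| + osc n) by ring.
apply: aliA; rewrite (le_trans (ler_normD _ _))//.
have th1 : `|- th p| <= 1 by rewrite normrN ler_norml; have := th_itv p; lra.
apply: lerD; last exact: mul1.
rewrite (le_trans (ler_normB _ _))//; apply: lerD; rewrite mulrC; apply: mul1.
- by rewrite mulrC; apply: mul1.
- exact: norm_cosB1_le.
- exact: prim_le1.
- exact: norm_sin_le.
Qed.

Let err n := A * osc n + 2 * A * E1.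

Let triangle (g c c' j j' ex r K L : R) : ex <= 1 -> 0 <= ex ->
  `|j - g * c| <= r -> `|j' - g * c'| <= r -> `|j - j' * ex| <= K + L ->
  `|g * c - g * c' * ex| <= 2 * r + K + L.
Proof.
move=> e1 e0 h1 h2; rewrite !ler_norml => /andP[h3 h4].
move: h1 h2; rewrite !ler_norml => /andP[h1 h1'] /andP[h2 h2'].
have r0 : 0 <= r by lra.
have h5 : (j' - g * c') * ex <= r by nra.
have h6 : - r <= (j' - g * c') * ex by nra.
by apply/andP; split; lra.
Qed.

(** [linear_comparison] is applied to J on [n, t] with rate pp / Gm. Writing C as J / Gm in J' costs
    (pp / Gm) [err n], and converting J back at both ends costs 2 [err n]. The factor 3 is the bound
    of |X| in [Z]. *)
Theorem delay_estimate n t : n%:R <= t ->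
  `|Gm * C t - Gm * C n%:R * expR (- (pp / Gm * (t - n%:R)))| <=
  2 * err n + (pp / Gm * err n + `|rr|) * (t - n%:R) + 3 * M / be * expR (- (be * n%:R)).
Proof.
move=> nt; have n0 : 0 <= n%:R :> R by exact: ler0n.
have pp0 : 0 <= pp.
  apply: Rintegral_ge0 => p _; have /andP[a0 _] := ali_itv p.
  by rewrite mulr_ge0// subr_ge0 cos_le1.
have Gm0 : 1 <= Gm.
  rewrite lerDl; apply: Rintegral_ge0 => p _; have /andP[a0 _] := ali_itv p.
  by rewrite mulr_ge0//; have := th_itv p; lra.
have la0 : 0 <= pp / Gm by rewrite divr_ge0//; lra.
have e0 : 0 <= err n by exact: le_trans (J_close (lexx n%:R)).
have M3 : 0 <= 3 * M by rewrite mulr_ge0.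
have D0 : 0 <= pp / Gm * err n + `|rr| by rewrite addr_ge0// mulr_ge0.
have cJ x : n%:R <= x -> {for x, continuous J}.
  move=> nx; apply: cvgD; first exact: cC.
  by apply: (is_der_cont (dF _)); lra.
have dJ' x : n%:R < x -> x < t -> is_derive x 1 J (\int[P]_p Z x p - C x * pp - S x * rr).
  by move=> nx _; apply: dJ; lra.
have hD x : n%:R < x -> x < t ->
    `|\int[P]_p Z x p - C x * pp - S x * rr + pp / Gm * J x| <=
    (pp / Gm * err n + `|rr|) + 3 * M * expR (- (be * x)).
  move=> nx _; have x0 : 0 <= x by lra.
  have -> : \int[P]_p Z x p - C x * pp - S x * rr + pp / Gm * J x =
      pp / Gm * (J x - Gm * C x) - S x * rr + \int[P]_p Z x p.
    by field; lra.
  rewrite (le_trans (ler_normD _ _))//; apply: lerD; last first.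
    apply: prob_norm_le.
      by apply: measurable_funM => //; exact: measurable_funB.
    move=> p; have -> : 3 * M * expR (- (be * x)) = M * expR (- (be * x)) * 3 by ring.
    by rewrite /Z normrM ler_pM//; exact: al_ali.
  rewrite (le_trans (ler_normB _ _))//; apply: lerD; last exact: mul1.
  by rewrite normrM ger0_norm// ler_wpM2l// J_close// ltW.
have H := linear_comparison la0 be0 M3 nt cJ dJ' hD D0.
have e1 : expR (- (pp / Gm * (t - n%:R))) <= 1.
  by rewrite -[leRHS]expR0 ler_expR oppr_le0; apply: mulr_ge0 => //; rewrite subr_ge0.
exact: (triangle e1 (expR_ge0 _) (J_close nt) (J_close (lexx n%:R)) H).
Qed.

End delay_estimate.

(** * Diffusive limit along a sequence of times *)

Section delay_limit.
Context (R : realType) d (Om : measurableType d) (P : probability Om R).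
Variables (th : Om -> R) (al : R -> Om -> R) (ali v : Om -> R) (A M be : R).
Hypotheses (mth : measurable_fun setT th) (th_itv : forall p, -1 <= th p <= 0).
Hypotheses (mal : forall t, measurable_fun setT (al t))
  (al_itv : forall t p, 0 <= al t p <= A).
Hypotheses (mali : measurable_fun setT ali) (ali_itv : forall p, 0 <= ali p <= A).
Hypotheses (M0 : 0 <= M) (be0 : 0 < be).
Hypothesis al_ali : forall (t : R) p, 0 <= t -> `|al t p - ali p| <= M * expR (- (be * t)).
Hypotheses (mv : measurable_fun setT v) (iv : P.-integrable setT (EFin \o v))
  (iv2 : P.-integrable setT (EFin \o (fun p => v p ^+ 2))).
Variables (x_ T_ : nat -> R).
Hypotheses (x0 : x_ k @[k --> \oo] --> (0 : R)) (x_ge0 : forall k, 0 <= x_ k).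
Hypotheses (Ty : T_ k @[k --> \oo] --> +oo).
Hypotheses (Tx_itv : forall k, 0 <= T_ k * x_ k ^+ 2 <= 1).
Hypotheses (Tx_cvg : T_ k * x_ k ^+ 2 @[k --> \oo] --> (1 : R)).
Implicit Types (p : Om) (k n : nat).

Let T_ge (c : R) : \forall k \near \oo, c <= T_ k.
Proof. by move: c; exact/cvgryPge. Qed.

Let A0 : 0 <= A. Proof. by have /andP[a b] := ali_itv point; exact: le_trans b. Qed.

Let iAv2 : P.-integrable setT (EFin \o (fun p => A * v p ^+ 2)).
Proof. exact: (integrableZl measurableT A iv2). Qed.

Let mphase (f : R -> R) k : continuous f -> measurable_fun setT (fun p => f (x_ k * v p)).
Proof. by move=> cf; apply: measurable_cont_comp => //; exact: measurable_funM. Qed.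

Let Tsqr k p (u c : R) : `|u| <= (x_ k * v p) ^+ 2 -> 0 <= c <= A ->
  `|T_ k * (c * u)| <= A * v p ^+ 2.
Proof.
move=> hu /andP[c0 cA]; have /andP[tx0 tx1] := Tx_itv k.
have [T0|T0] := leP 0 (T_ k).
  have h1 : `|T_ k * (c * u)| <= T_ k * (A * (x_ k * v p) ^+ 2).
    rewrite normrM (ger0_norm T0) ler_wpM2l// normrM (ger0_norm c0).
    by apply: ler_pM.
  apply: (le_trans h1).
  have -> : T_ k * (A * (x_ k * v p) ^+ 2) = (T_ k * x_ k ^+ 2) * (A * v p ^+ 2) by ring.
  by rewrite ler_piMl// mulr_ge0// sqr_ge0.
(* A negative T_ k is possible for small k; then T_ k * x_ k ^+ 2 >= 0 forces x_ k = 0 and the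
   quantity vanishes. *)
have x2 : x_ k ^+ 2 = 0.
  by apply/eqP; rewrite eq_le sqr_ge0 andbT -(nmulr_rge0 _ T0).
have u0 : u = 0.
  by apply/eqP; rewrite -normr_le0 (le_trans hu)// exprMn x2 mul0r.
by rewrite u0 !mulr0 normr0 mulr_ge0// sqr_ge0.
Qed.

Let x2_cvg (c : R) : x_ k ^+ 2 * c @[k --> \oo] --> (0 : R).
Proof.
have h : x_ k * x_ k * c @[k --> \oo] --> (0 * 0 * c : R).
  by apply: cvgM; [exact: cvgM|exact: cvg_cst].
by rewrite !mul0r in h.
Qed.

(** Pointwise T (1 - cos (x v)) tends to v^2 / 2 because T x^2 tends to 1, the Taylor remainder
    being at most x^2 v^4. The majorant A v^2 is integrable by the second moment. *)
Lemma cos_deficit_cvg :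
  T_ k * \int[P]_p (ali p * (1 - cos (x_ k * v p))) @[k --> \oo] -->
  \int[P]_p (ali p * (v p ^+ 2 / 2)).
Proof.
have hb k p : `|1 - cos (x_ k * v p)| <= (x_ k * v p) ^+ 2.
  by rewrite distrC; exact: norm_cosB1_sqr.
have mc k : measurable_fun setT (fun p => ali p * (1 - cos (x_ k * v p))).
  apply: measurable_funM => //; apply: measurable_funB => //.
  by apply: mphase; exact: continuous_cos.
have i k : P.-integrable setT (EFin \o (fun p => ali p * (1 - cos (x_ k * v p)))).
  apply: (@bounded_integrable _ _ _ P setT _ (A * 2)) => // p _.
  have /andP[a0 aA] := ali_itv p; rewrite normrM; apply: ler_pM => //; first by rewrite ger0_norm.
  by rewrite ler_norml; have := cos_geN1 (x_ k * v p); have := cos_le1 (x_ k * v p); lra.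
have -> : (fun k => T_ k * \int[P]_p (ali p * (1 - cos (x_ k * v p)))) =
    (fun k => \int[P]_p (T_ k * (ali p * (1 - cos (x_ k * v p))))).
  by apply/funext => k; rewrite RintegralZl//; exact: i.
apply: (@Rintegral_dominated_cvg _ _ _ P setT _ _ (fun p => A * v p ^+ 2)) => //.
- by move=> k; exact: measurable_funM.
- move=> p _; set w := v p.
  have E k : T_ k * (ali p * (1 - cos (x_ k * w))) =
      ali p * ((T_ k * x_ k ^+ 2) * (w ^+ 2 / 2)) -
      ali p * (T_ k * (cos (x_ k * w) - 1 + (x_ k * w) ^+ 2 / 2)) by field.
  under eq_fun do rewrite E.
  suff h : ali p * (T_ k * x_ k ^+ 2 * (w ^+ 2 / 2)) -
      ali p * (T_ k * (cos (x_ k * w) - 1 + (x_ k * w) ^+ 2 / 2)) @[k --> \oo] -->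
      ali p * (1 * (w ^+ 2 / 2)) - ali p * 0 by rewrite mul1r mulr0 subr0 in h.
  apply: cvgB; apply: cvgM; try exact: cvg_cst.
    by apply: cvgM => //; exact: cvg_cst.
  apply/norm_cvg0P; apply: (@squeeze_cvgr _ _ _ _ (fun=> 0) (fun k => x_ k ^+ 2 * w ^+ 4)).
  + apply: filterS (T_ge 0) => k Tk; rewrite normr_ge0/= normrM (ger0_norm Tk).
    have /andP[tx0 tx1] := Tx_itv k.
    rewrite (le_trans (ler_wpM2l Tk (norm_cos_taylor2 _)))//.
    have -> : T_ k * (x_ k * w) ^+ 4 = (T_ k * x_ k ^+ 2) * (x_ k ^+ 2 * w ^+ 4) by ring.
    by rewrite ler_piMl// mulr_ge0 ?sqr_ge0// (exprM w 2 2) sqr_ge0.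
  + exact: cvg_cst.
  + exact: x2_cvg.
- by move=> k p _; exact: Tsqr.
Qed.

(** Two bounds on |sin u - u| are combined: |u|^3 gives the pointwise limit 0, with a factor x to
    spare, and u^2 gives a majorant that needs only the second moment. *)
Lemma sin_defect_cvg :
  T_ k * \int[P]_p (ali p * (sin (x_ k * v p) - x_ k * v p)) @[k --> \oo] --> (0 : R).
Proof.
have mc k : measurable_fun setT (fun p => ali p * (sin (x_ k * v p) - x_ k * v p)).
  apply: measurable_funM => //; apply: measurable_funB.
    by apply: mphase; exact: continuous_sin.
  exact: measurable_funM.
have i k : P.-integrable setT (EFin \o (fun p => ali p * (sin (x_ k * v p) - x_ k * v p))).
  have i1 := integrableZl measurableT (A * (2 * x_ k)) (integrable_norm iv).
  apply: (dominated_Rintegrable measurableT _ i1) => // p _ /=.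
  have /andP[a0 aA] := ali_itv p; rewrite normrM -mulrA; apply: ler_pM => //; first by rewrite ger0_norm.
  rewrite (le_trans (ler_normB _ _))//; have := norm_sin_le (x_ k * v p).
  by rewrite normrM (ger0_norm (x_ge0 k)); lra.
have -> : (fun k => T_ k * \int[P]_p (ali p * (sin (x_ k * v p) - x_ k * v p))) =
    (fun k => \int[P]_p (T_ k * (ali p * (sin (x_ k * v p) - x_ k * v p)))).
  by apply/funext => k; rewrite RintegralZl//; exact: i.
rewrite -[X in _ --> X](Rintegral_pcst P).
apply: (@Rintegral_dominated_cvg _ _ _ P setT _ _ (fun p => A * v p ^+ 2)) => //.
- by move=> k; exact: measurable_funM.
- move=> p _; set w := v p; apply/norm_cvg0P.
  apply: (@squeeze_cvgr _ _ _ _ (fun=> 0) (fun k => x_ k * (A * `|w| ^+ 3))).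
  + apply: filterS (T_ge 0) => k Tk; rewrite normr_ge0/= normrM (ger0_norm Tk).
    have /andP[a0 aA] := ali_itv p; have /andP[tx0 tx1] := Tx_itv k.
    rewrite normrM (ger0_norm a0) (@le_trans _ _ (T_ k * (A * `|x_ k * w| ^+ 3)))//.
      by rewrite ler_wpM2l// ler_pM// norm_sinB_cube.
    rewrite normrM (ger0_norm (x_ge0 k)).
    have -> : T_ k * (A * (x_ k * `|w|) ^+ 3) =
      (T_ k * x_ k ^+ 2) * (x_ k * (A * `|w| ^+ 3)) by ring.
    by rewrite ler_piMl// !mulr_ge0// exprn_ge0.
  + exact: cvg_cst.
  + have h : x_ k * (A * `|w| ^+ 3) @[k --> \oo] --> (0 * (A * `|w| ^+ 3) : R).
      by apply: cvgM => //; exact: cvg_cst.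
    by rewrite mul0r in h.
- by move=> k p _; apply: Tsqr => //; exact: norm_sinB_sqr.
Qed.

Variables (C_ S_ : nat -> R -> R) (c0 : R).
Hypotheses (cC : forall k, continuous (C_ k)) (cS : forall k, continuous (S_ k)).
Hypotheses (C1 : forall k t, `|C_ k t| <= 1) (S1 : forall k t, `|S_ k t| <= 1).
Hypothesis dC : forall k (t : R), 0 < t ->
  is_derive t 1 (C_ k) (\int[P]_p (al t p * (cos (x_ k * v p) * C_ k (t + th p)
    - sin (x_ k * v p) * S_ k (t + th p) - C_ k t))
    + \int[P]_p (ali p * (x_ k * v p)) * S_ k t).
Hypothesis C_init : forall n, C_ k n%:R @[k --> \oo] --> c0.

Let Gm := 1 + \int[P]_p (- th p * ali p).
Let L := \int[P]_p (ali p * (v p ^+ 2 / 2)) / Gm.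

(** With n fixed, pp T tends to L Gm, rr T and E1 tend to 0, and C_ k n tends to c0. The estimate
    thus bounds the limiting distance by [B n], which only keeps the contraction factor to the power
    n and exp (- be n); then n tends to infinity. *)
Theorem delay_limit : C_ k (T_ k) @[k --> \oo] --> c0 * expR (- L).
Proof.
have Gm0 : 1 <= Gm.
  rewrite lerDl; apply: Rintegral_ge0 => p _; have /andP[a0 _] := ali_itv p.
  by rewrite mulr_ge0//; have := th_itv p; lra.
pose E1 k := \int[P]_p `|x_ k * v p|.
pose pp k := \int[P]_p (ali p * (1 - cos (x_ k * v p))).
pose rr k := \int[P]_p (ali p * (sin (x_ k * v p) - x_ k * v p)).
(* The slack that makes the bound on the forcing strict has to disappear in the limit. *)
pose dl k : R := k.+1%:R^-1.
pose err n k := A * (2 * (1 - expR (- A)) ^+ n + 4 * (3 * A * E1 k + dl k) * expR A)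
  + 2 * A * E1 k.
have est n k : n%:R <= T_ k ->
    `|Gm * C_ k (T_ k) - Gm * C_ k n%:R * expR (- (pp k / Gm * (T_ k - n%:R)))| <=
    2 * err n k + (pp k / Gm * err n k + `|rr k|) * (T_ k - n%:R)
     + 3 * M / be * expR (- (be * n%:R)).
  have mw : measurable_fun setT (fun p => x_ k * v p) by exact: measurable_funM.
  have iw : P.-integrable setT (EFin \o (fun p => x_ k * v p)).
    exact: (integrableZl measurableT (x_ k) iv).
  have dl0 : 0 < dl k by rewrite invr_gt0.
  move=> Tk; have H := delay_estimate mth th_itv mal al_itv mali ali_itv M0 be0 al_ali
    mw iw erefl (@cC k) (@cS k) (C1 k) (S1 k) (dC k) dl0 Tk.
  exact: H.
have cst (c : R) : c @[_ --> (\oo : set_system nat)] --> c by exact: cvg_cst.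
have E1_0 : E1 k @[k --> \oo] --> (0 : R).
  have -> : E1 = (fun k => x_ k * \int[P]_p `|v p|).
    apply/funext => k; rewrite /E1 -RintegralZl//; last exact: integrable_norm.
    by apply: eq_Rintegral => p _; rewrite normrM (ger0_norm (x_ge0 k)).
  have h : x_ k * \int[P]_p `|v p| @[k --> \oo] --> (0 * \int[P]_p `|v p| : R).
    exact: cvgM.
  by rewrite mul0r in h.
have dl_0 : dl k @[k --> \oo] --> (0 : R) by exact: cvg_harmonic.
have Tinv : (T_ k)^-1 @[k --> \oo] --> (0 : R).
  apply/cvgrPdist_le => e e0; apply: filterS (T_ge e^-1) => k Tk.
  have Tk0 : 0 < T_ k by apply: lt_le_trans Tk; rewrite invr_gt0.
  by rewrite sub0r normrN gtr0_norm ?invr_gt0// -(invrK e) lef_pV2// posrE invr_gt0.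
(* Starting at time n instead of 0 is harmless because n / T_ k tends to 0. *)
have shift (u : nat -> R) (l : R) n : T_ k * u k @[k --> \oo] --> l ->
    u k * (T_ k - n%:R) @[k --> \oo] --> l.
  move=> hu; have h : (T_ k * u k) * (1 - n%:R * (T_ k)^-1) @[k --> \oo] -->
      l * (1 - n%:R * 0).
    by apply: cvgM => //; apply: cvgB => //; exact: cvgM.
  rewrite mulr0 subr0 mulr1 in h; apply: cvg_trans h; apply: near_eq_cvg.
  apply: filterS (T_ge 1) => k Tk; field; lra.
have ppT n : pp k / Gm * (T_ k - n%:R) @[k --> \oo] --> L.
  apply: (shift (fun k => pp k / Gm)).
  under eq_fun do rewrite mulrA.
  by apply: cvgM => //; exact: cos_deficit_cvg.
have rrT n : `|rr k| * (T_ k - n%:R) @[k --> \oo] --> (0 : R).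
  apply: (shift (fun k => `|rr k|)).
  have h : `|T_ k * rr k| @[k --> \oo] --> (0 : R) by exact: (norm_cvg0P _).2 sin_defect_cvg.
  apply: cvg_trans h; apply: near_eq_cvg.
  by apply: filterS (T_ge 0) => k Tk; rewrite normrM (ger0_norm Tk).
pose z n := 2 * A * (1 - expR (- A)) ^+ n.
have errz n : err n k @[k --> \oo] --> z n.
  have h : err n k @[k --> \oo] -->
    A * (2 * (1 - expR (- A)) ^+ n + 4 * (3 * A * 0 + 0) * expR A) + 2 * A * 0.
    have h1 : 3 * A * E1 k + dl k @[k --> \oo] --> 3 * A * 0 + 0.
      by apply: cvgD; [apply: cvgM; [exact: cst|exact: E1_0]|exact: dl_0].
    have h2 : 4 * (3 * A * E1 k + dl k) * expR A @[k --> \oo] -->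
        4 * (3 * A * 0 + 0) * expR A.
      by apply: cvgM; [apply: cvgM; [exact: cst|exact: h1]|exact: cst].
    apply: cvgD; apply: cvgM; [exact: cst|apply: cvgD|exact: cst|exact: E1_0].
      exact: cst.
    exact: h2.
  rewrite (_ : z n = A * (2 * (1 - expR (- A)) ^+ n + 4 * (3 * A * 0 + 0) * expR A) + 2 * A * 0) //.
  by rewrite /z; ring.
pose B n := 2 * z n + (L * z n + 0) + 3 * M / be * expR (- (be * n%:R)).
have estB n : 2 * err n k + (pp k / Gm * err n k + `|rr k|) * (T_ k - n%:R)
     + 3 * M / be * expR (- (be * n%:R)) @[k --> \oo] --> B n.
  have -> : (fun k => 2 * err n k + (pp k / Gm * err n k + `|rr k|) * (T_ k - n%:R)
     + 3 * M / be * expR (- (be * n%:R))) =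
   (fun k => 2 * err n k + ((pp k / Gm * (T_ k - n%:R)) * err n k
     + `|rr k| * (T_ k - n%:R)) + 3 * M / be * expR (- (be * n%:R))).
    by apply/funext => k; ring.
  apply: cvgD => //; apply: cvgD; first exact: cvgM.
  by apply: cvgD => //; apply: cvgM.
have z0 : z n @[n --> \oo] --> (0 : R).
  have h : z n @[n --> \oo] --> 2 * A * 0.
    apply: cvgM => //; apply: cvg_expr.
    have := expR_gt0 (- A); have : expR (- A) <= 1 by rewrite -[leRHS]expR0 ler_expR oppr_le0.
    by rewrite ltr_norml; lra.
  by rewrite mulr0 in h.
have ebn0 : expR (- (be * n%:R)) @[n --> \oo] --> (0 : R).
  have -> : (fun n : nat => expR (- (be * n%:R))) = (fun n => expR (- be) ^+ n).
    by apply/funext => n; rewrite -expRM_natl; congr expR; ring.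
  by apply: cvg_expr; rewrite ger0_norm ?expR_ge0// -expR0 ltr_expR oppr_lt0.
have B0 : B n @[n --> \oo] --> (0 : R).
  have h : B n @[n --> \oo] --> 2 * 0 + (L * 0 + 0) + 3 * M / be * 0.
    by apply: cvgD; [apply: cvgD; [exact: cvgM|apply: cvgD => //; exact: cvgM]|exact: cvgM].
  by rewrite !(mulr0, addr0) in h.
have lim n : Gm * C_ k n%:R * expR (- (pp k / Gm * (T_ k - n%:R))) @[k --> \oo] -->
    Gm * c0 * expR (- L).
  apply: cvgM; first exact: cvgM.
  apply: (@cvg_comp _ _ _ (fun k => - (pp k / Gm * (T_ k - n%:R))) expR).
    by apply: cvgN; exact: ppT.
  exact: continuous_expR.
have GC : Gm * C_ k (T_ k) @[k --> \oo] --> Gm * c0 * expR (- L).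
  apply/cvgrPdist_le => e e0; have e3 : 0 < e / 3 by lra.
  have /cvgrPdist_le/(_ _ e3)[n0 _ /(_ n0 (leqnn _))] := B0; set n := n0.
  rewrite sub0r normrN => hBn.
  have /cvgrPdist_le/(_ _ e3) h1 := estB n; have /cvgrPdist_le/(_ _ e3) h2 := lim n.
  near=> k.
  have Tk : n%:R <= T_ k by near: k; exact: T_ge.
  have hk := est n k Tk.
  have h1k : `|B n - (2 * err n k + (pp k / Gm * err n k + `|rr k|) * (T_ k - n%:R)
     + 3 * M / be * expR (- (be * n%:R)))| <= e / 3 by near: k; exact: h1.
  have h2k : `|Gm * c0 * expR (- L) -
     Gm * C_ k n%:R * expR (- (pp k / Gm * (T_ k - n%:R)))| <= e / 3 by near: k; exact: h2.
  rewrite ler_norml in hBn; rewrite ler_norml in hk; rewrite ler_norml in h1k.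
  by rewrite ler_norml in h2k; rewrite ler_norml; lra.
have -> : (fun k => C_ k (T_ k)) = (fun k => Gm^-1 * (Gm * C_ k (T_ k))).
  by apply/funext => k; rewrite mulKf//; lra.
have -> : c0 * expR (- L) = Gm^-1 * (Gm * c0 * expR (- L)).
  by rewrite -mulrA mulKf//; lra.
exact: cvgM.
Unshelve. all: by end_near. Qed.

End delay_limit.

Section clipping.
Context (R : realType).
Implicit Types (x t : R).

(* Clipping the delay to [-1, 0] turns integrals over the strip into integrals
   over the whole space. *)
Definition clip x : R := Num.max (-1) (Num.min 0 x).

Lemma clip_itv x : -1 <= clip x <= 0.
Proof.
rewrite /clip le_max lexx/= ge_max ge_min lexx/= andbT; lra.
Qed.

Lemma clip_in x : clip x \in `[-1, 0].
Proof. by rewrite in_itv/= clip_itv. Qed.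

Lemma clip_id x : -1 <= x <= 0 -> clip x = x.
Proof. by move=> /andP[x1 x0]; rewrite /clip min_r// max_r. Qed.

Lemma cont_max (T : topologicalType) (f g : T -> R) :
  continuous f -> continuous g -> continuous (fun y => Num.max (f y) (g y)).
Proof. by move=> cf cg y; apply: continuous_max; [exact: cf|exact: cg]. Qed.

Lemma cont_min (T : topologicalType) (f g : T -> R) :
  continuous f -> continuous g -> continuous (fun y => Num.min (f y) (g y)).
Proof. by move=> cf cg y; apply: continuous_min; [exact: cf|exact: cg]. Qed.

Lemma clip_continuous : continuous clip.
Proof.
apply: (@cont_max R (fun=> -1)); first exact: cont_cst.
by apply: cont_min; [exact: cont_cst|move=> x; exact: cvg_id].
Qed.

End clipping.

Section strip_integral.
Context (R : realType) (N : nat).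
Local Notation W := (R * 'rV[R]_N)%type.
Variable Q : probability W R.
Hypothesis Q1 : Q (@strip R N) = 1%E.

Lemma measurable_strip : measurable (@strip R N : set W).
Proof. by apply: measurableX => //; exact: measurable_itv. Qed.

(** The complement of the strip is negligible, so f may be replaced by any integrable g that agrees
    with it on the strip. *)
Lemma strip_Rintegral (f g : W -> R) : Q.-integrable setT (EFin \o g) ->
  (forall p, @strip R N p -> f p = g p) ->
  \int[Q]_(p in @strip R N) f p = \int[Q]_p g p.
Proof.
move=> ig fg.
transitivity (\int[Q]_(p in @strip R N) g p).
  by apply: eq_Rintegral => p /set_mem; exact: fg.
rewrite /Rintegral; congr fine.
have mS := measurable_strip.
have N0 : Q (~` @strip R N) = 0%E by rewrite probability_setC// Q1 subee.
rewrite [RHS](negligible_integral (measurableC mS) measurableT ig N0).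
by rewrite setTD setCK.
Qed.

End strip_integral.

(** * Characteristic function of the solution *)

Section delay_characteristic.
Context (R : realType) (N : nat).
Local Notation V := 'rV[R]_N.
Local Notation W := (R * V)%type.
Local Notation S := (@strip R N).
Variables (alpha : R -> R -> R) (alpha_inf : R -> R) (Q : probability W R).
Variables (u0 mu : R -> probability V R).
Hypotheses (hr : rate_assumption alpha alpha_inf) (hj : jump_assumption Q).
Hypothesis (hmu : delay_solution alpha Q u0 mu).
Implicit Types (t a : R) (p : W).

Let th p := clip p.1.
(** [alpha] is controlled only for t >= 0 and delays in [-1, 0]. Retracting both arguments gives
    rates that are measurable and bounded for all t and p, and that agree with [alpha] where the
    equation uses it. *)
Let al t p := alpha (Num.max t 0) (th p).
Let ali p := alpha_inf (th p).

Let th_itv p : -1 <= th p <= 0. Proof. exact: clip_itv. Qed.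

Let mth : measurable_fun setT th.
Proof. by apply: measurable_cont_comp => //; exact: clip_continuous. Qed.

Let al_continuous t : continuous (fun x => alpha (Num.max t 0) (clip x)).
Proof.
have [_ _ ca _ _] := hr.
pose g (x : R) := (Num.max t 0, clip x).
have cg : continuous g.
  move=> x; have h1 : (fun _ : R => Num.max t 0) y @[y --> x] --> Num.max t 0 by exact: cvg_cst.
  exact: (cvg_pair h1 (@clip_continuous _ x)).
apply: (within_comp_continuous (g := g) ca cg) => x.
by split; rewrite /= in_itv/= ?andbT ?clip_itv// le_max lexx orbT.
Qed.

Let ali_continuous : continuous (fun x => alpha_inf (clip x)).
Proof.
have [_ _ _ [_ ca] _] := hr.
apply: (within_comp_continuous ca); first exact: clip_continuous.
by move=> x; rewrite /= clip_in.
Qed.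

Let mal t : measurable_fun setT (al t).
Proof. exact: (measurable_cont_comp (@al_continuous t) measurable_fst). Qed.

Let mali : measurable_fun setT ali.
Proof. exact: (measurable_cont_comp ali_continuous measurable_fst). Qed.

Let rate_bounds : exists A M be : R, [/\ 0 <= M, 0 < be,
  forall t p, 0 <= al t p <= A, forall p, 0 <= ali p <= A &
  forall t p, 0 <= t -> `|al t p - ali p| <= M * expR (- (be * t))].
Proof.
have [pos [B [_ hB]] _ [posi _] [M [be [M0 be0 hM]]]] := hr.
have {}hB t th' : 0 <= t -> -1 <= th' <= 0 -> `|alpha t th'| <= B + 1.
  move=> t0 hth; have := hB (B + 1); rewrite ltrDl ltr01 => /(_ isT (t, th')); apply.
  by split; rewrite /= in_itv/= ?andbT.
have dist t p : 0 <= t -> `|al t p - ali p| <= M * expR (- (be * t)).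
  move=> t0; rewrite /al max_l// -mulNr; apply: hM => //; exact: clip_in.
have mt0 t : 0 <= Num.max t 0 by rewrite le_max lexx orbT.
have ali0 p : 0 <= ali p by apply: ltW; apply: posi; exact: clip_in.
have al0 t p : 0 <= al t p by apply: ltW; apply: pos => //; exact: clip_in.
have alB t p : al t p <= B + 1.
  by rewrite (le_trans (ler_norm _))//; apply: hB => //; exact: clip_itv.
(* B + 1 bounds [al]; adding M covers [ali] as well, through the exponential estimate at t = 0. *)
exists (B + 1 + M), M, be; split => //.
- exact: ltW.
- by move=> t p; rewrite al0/= (le_trans (alB t p))// lerDl ltW.
- move=> p; rewrite ali0/=; have := dist 0 p (lexx _).
  rewrite mulr0 oppr0 expR0 mulr1 ler_norml => /andP[h _].
  by have := alB 0 p; lra.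
Qed.

Let bint (f : W -> R) (B : R) : measurable_fun setT f -> (forall p, `|f p| <= B) ->
  Q.-integrable setT (EFin \o f).
Proof. by move=> mf fB; apply: (@bounded_integrable _ _ _ Q setT f B). Qed.

Let clip_strip p : S p -> th p = p.1.
Proof. by move=> [/= h _]; apply: clip_id; rewrite in_itv/= in h. Qed.

Let al_bint t (f : W -> R) (B : R) : measurable_fun setT f -> (forall p, `|f p| <= B) ->
  Q.-integrable setT (EFin \o (fun p => al t p * f p)).
Proof.
move=> mf fB; have [A [_ [_ [_ _ alA _ _]]]] := rate_bounds.
apply: (@bint _ (A * B)); first exact: measurable_funM.
move=> p; have /andP[a0 aA] := alA t p.
by rewrite normrM; apply: ler_pM => //; rewrite ger0_norm.
Qed.

(* Solutions are only specified on [-1, oo). *)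
Let clipm t := Num.max t (-1).

Let mean_continuous f : Cb f -> continuous (fun t => \int[mu (clipm t)]_x f x).
Proof.
have [cmu _ _] := hmu => cf.
apply: (@within_comp_continuous _ _ _ _ clipm (fun t => \int[mu t]_x f x) (cmu f cf)).
  by apply: cont_max; [move=> x; exact: cvg_id|exact: cont_cst].
by move=> t; rewrite /= in_itv/= le_max lexx orbT.
Qed.

Section fixed_frequency.
Variable xi : V.

Let c t := \int[mu (clipm t)]_x cos (dotv xi x).
Let s t := \int[mu (clipm t)]_x sin (dotv xi x).
Let u p := dotv xi p.2.

Let Cb_c : Cb (fun x => cos (dotv xi x)). Proof. exact/Cb_cos/dotvl_continuous. Qed.
Let Cb_s : Cb (fun x => sin (dotv xi x)). Proof. exact/Cb_sin/dotvl_continuous. Qed.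

Let cos1 (z : R) : `|cos z| <= 1. Proof. by rewrite ler_norml cos_geN1 cos_le1. Qed.
Let sin1 (z : R) : `|sin z| <= 1. Proof. by rewrite ler_norml sin_geN1 sin_le1. Qed.

Let c1 t : `|c t| <= 1.
Proof. by apply: prob_norm_le => [|x]; [by apply: Cb_measurable; exact: Cb_c|exact: cos1]. Qed.
Let s1 t : `|s t| <= 1.
Proof. by apply: prob_norm_le => [|x]; [by apply: Cb_measurable; exact: Cb_s|exact: sin1]. Qed.

Let cc : continuous c. Proof. exact: mean_continuous. Qed.
Let cs : continuous s. Proof. exact: mean_continuous. Qed.

Let mu_ : measurable_fun setT u.
Proof. by apply: measurable_dotv; [exact: measurable_cst|exact: measurable_snd]. Qed.

Let mcosu : measurable_fun setT (fun p => cos (u p)).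
Proof. by apply: measurable_cont_comp => //; exact: continuous_cos. Qed.
Let msinu : measurable_fun setT (fun p => sin (u p)).
Proof. by apply: measurable_cont_comp => //; exact: continuous_sin. Qed.

(** Restates the delay equation without the strip. The function g stands for the mean of f after a
    jump; an everywhere measurable and bounded formula is asked for, equal to that mean on the
    strip. *)
Let der (f : V -> R) (g : R -> W -> R) t : Cb f -> 0 < t ->
  (forall p, S p -> \int[mu (t + p.1)]_x f (x + p.2) = g t p) ->
  measurable_fun setT (g t) -> (exists B, forall p, `|g t p| <= B) ->
  is_derive t 1 (fun t => \int[mu (clipm t)]_x f x)
    (\int[Q]_p (al t p * (g t p - \int[mu (clipm t)]_x f x))).
Proof.
move=> cf t0 hg mg [B gB]; have [_ _ /(_ f cf)[df _ hf]] := hmu.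
have mE : \forall y \near t, (fun t => \int[mu t]_x f x) y =
    (fun t => \int[mu (clipm t)]_x f x) y.
  apply: filterS (lt_nbhsr t0) => y y0; rewrite /clipm max_l//; lra.
apply: (near_eq_is_derive mE); split; first exact: df.
rewrite -derive1E hf// /delay_rhs.
have [Q1 _] := hj.
have mtE : Num.max t 0 = t by rewrite max_l// ltW.
have ig := al_bint t mg gB.
have ial : Q.-integrable setT (EFin \o al t).
  have [A [_ [_ [_ _ alA _ _]]]] := rate_bounds.
  by apply: (@bint _ A) => // p; have /andP[a0 aA] := alA t p; rewrite ger0_norm.
rewrite (strip_Rintegral Q1 ig); last by move=> p Sp; rewrite /al mtE clip_strip// hg.
rewrite (strip_Rintegral Q1 ial); last by move=> p Sp; rewrite /al mtE clip_strip.
have ct : clipm t = t by rewrite /clipm max_l//; lra.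
rewrite ct -RintegralZl// -RintegralB//; last exact: (integrableZl measurableT _ ial).
by apply: eq_Rintegral => p _; ring.
Qed.

Let lagE p t : 0 < t -> S p -> clipm (t + th p) = t + p.1.
Proof.
move=> t0 Sp; rewrite clip_strip// /clipm max_l//.
by move: Sp => [/=]; rewrite in_itv/= => /andP[h _] _; lra.
Qed.

Let trig_mean (m : probability V R) (z b : R) :
  \int[m]_x (cos z * cos (dotv xi x) - sin z * sin (dotv xi x)) =
  cos z * \int[m]_x cos (dotv xi x) - sin z * \int[m]_x sin (dotv xi x).
Proof.
rewrite -!RintegralZl//; [|exact: Cb_integrable..].
by rewrite RintegralB//; apply: Cb_integrable; exact: CbZ.
Qed.

Let dc t : 0 < t -> is_derive t 1 c
  (\int[Q]_p (al t p * (cos (u p) * c (t + th p) - sin (u p) * s (t + th p) - c t))).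
Proof.
move=> t0.
apply: (@der _ (fun t p => cos (u p) * c (t + th p) - sin (u p) * s (t + th p))) => //.
- move=> p Sp; rewrite /c /s lagE// -trig_mean//.
  by apply: eq_Rintegral => x _; rewrite dotvDr cosD /u; ring.
- by apply: measurable_funB; apply: measurable_funM => //;
    exact: (measurable_lag mth).
- exists 2 => p; rewrite (le_trans (ler_normB _ _))// !normrM.
  have h1 := ler_pM (normr_ge0 _) (normr_ge0 _) (cos1 (u p)) (c1 (t + th p)).
  have h2 := ler_pM (normr_ge0 _) (normr_ge0 _) (sin1 (u p)) (s1 (t + th p)).
  by move: h1 h2; lra.
Qed.

Let ds t : 0 < t -> is_derive t 1 s
  (\int[Q]_p (al t p * (sin (u p) * c (t + th p) + cos (u p) * s (t + th p) - s t))).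
Proof.
move=> t0.
apply: (@der _ (fun t p => sin (u p) * c (t + th p) + cos (u p) * s (t + th p))) => //.
- move=> p Sp; rewrite /c /s lagE//.
  rewrite -!RintegralZl//; [|exact: Cb_integrable..].
  rewrite -RintegralD//; [|by apply: Cb_integrable; exact: CbZ..].
  by apply: eq_Rintegral => x _; rewrite dotvDr sinD /u; ring.
- by apply: measurable_funD; apply: measurable_funM => //;
    exact: (measurable_lag mth).
- exists 2 => p; rewrite (le_trans (ler_normD _ _))// !normrM.
  have h1 := ler_pM (normr_ge0 _) (normr_ge0 _) (sin1 (u p)) (c1 (t + th p)).
  have h2 := ler_pM (normr_ge0 _) (normr_ge0 _) (cos1 (u p)) (s1 (t + th p)).
  by move: h1 h2; lra.
Qed.

Variables (K : V) (a : R).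

(* Real and imaginary parts, rotated by the phase a, of the characteristic
   function in the frame moving with velocity K. *)
Definition moving_cos t := \int[mu (clipm t)]_x cos (dotv xi x + (a - dotv xi K * t)).
Definition moving_sin t := \int[mu (clipm t)]_x sin (dotv xi x + (a - dotv xi K * t)).

Let ph t := a - dotv xi K * t.

Let moving_cosE : moving_cos = fun t => cos (ph t) * c t - sin (ph t) * s t.
Proof.
apply/funext => t; rewrite /c /s -trig_mean//.
by apply: eq_Rintegral => x _; rewrite cosD; ring.
Qed.

Let moving_sinE : moving_sin = fun t => sin (ph t) * c t + cos (ph t) * s t.
Proof.
apply/funext => t; rewrite /c /s.
rewrite -!RintegralZl//; [|exact: Cb_integrable..].
rewrite -RintegralD//; [|by apply: Cb_integrable; exact: CbZ..].
by apply: eq_Rintegral => x _; rewrite sinD; ring.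
Qed.

Let ph_continuous : continuous ph.
Proof.
apply: contB; first exact: cont_cst.
by apply: contM; [exact: cont_cst|move=> t; exact: cvg_id].
Qed.

Lemma moving_cos_continuous : continuous moving_cos.
Proof.
by rewrite moving_cosE; apply: contB; apply: contM => //; [exact: cont_cos|exact: cont_sin].
Qed.

Lemma moving_sin_continuous : continuous moving_sin.
Proof.
by rewrite moving_sinE; apply: contD; apply: contM => //; [exact: cont_sin|exact: cont_cos].
Qed.

Lemma moving_cos_le1 t : `|moving_cos t| <= 1.
Proof.
apply: prob_norm_le => [|x]; last exact: cos1.
by apply: Cb_measurable; exact: Cb_cos_phase.
Qed.

Lemma moving_sin_le1 t : `|moving_sin t| <= 1.
Proof.
apply: prob_norm_le => [|x]; last exact: sin1.
by apply: Cb_measurable; apply: Cb_sin; exact: phase_continuous.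
Qed.

(** The phase a - t xi.K differs from its lagged value by th xi.K, and this difference is absorbed
    by replacing the jump z with z + th K. The derivative of the phase itself gives the last
    term. *)
Lemma is_der_moving_cos t : 0 < t -> is_derive t 1 moving_cos
  (\int[Q]_p (al t p * (cos (dotv xi (p.2 + th p *: K)) * moving_cos (t + th p)
    - sin (dotv xi (p.2 + th p *: K)) * moving_sin (t + th p) - moving_cos t))
   + dotv xi K * moving_sin t).
Proof.
move=> t0.
have dph : is_derive t 1 ph (- dotv xi K).
  apply: (is_der_eq (is_derB (is_der_cst a t) (is_derZ (dotv xi K) (is_der_id t)))).
  by ring.
have h := is_derB (is_derM (is_der_cos dph) (dc t0)) (is_derM (is_der_sin dph) (ds t0)).
rewrite moving_cosE moving_sinE; apply: (is_der_eq h).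
set I1 := \int[Q]_p _; set I2 := \int[Q]_p (al t p * (_ + _ - _)).
have i1 : Q.-integrable setT (EFin \o (fun p => al t p *
    (cos (u p) * c (t + th p) - sin (u p) * s (t + th p) - c t))).
  apply: (@al_bint t _ 3).
    apply: measurable_funB => //; apply: measurable_funB; apply: measurable_funM => //;
    exact: (measurable_lag mth).
  move=> p; rewrite (le_trans (ler_normB _ _))//.
  have h1 := ler_normB (cos (u p) * c (t + th p)) (sin (u p) * s (t + th p)).
  have h2 := ler_pM (normr_ge0 _) (normr_ge0 _) (cos1 (u p)) (c1 (t + th p)).
  have h3 := ler_pM (normr_ge0 _) (normr_ge0 _) (sin1 (u p)) (s1 (t + th p)).
  by move: h1; rewrite !normrM; have := c1 t; move: h2 h3; lra.
have i2 : Q.-integrable setT (EFin \o (fun p => al t p *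
    (sin (u p) * c (t + th p) + cos (u p) * s (t + th p) - s t))).
  apply: (@al_bint t _ 3).
    apply: measurable_funB => //; apply: measurable_funD; apply: measurable_funM => //;
    exact: (measurable_lag mth).
  move=> p; rewrite (le_trans (ler_normB _ _))//.
  have h1 := ler_normD (sin (u p) * c (t + th p)) (cos (u p) * s (t + th p)).
  have h2 := ler_pM (normr_ge0 _) (normr_ge0 _) (sin1 (u p)) (c1 (t + th p)).
  have h3 := ler_pM (normr_ge0 _) (normr_ge0 _) (cos1 (u p)) (s1 (t + th p)).
  by move: h1; rewrite !normrM; have := s1 t; move: h2 h3; lra.
set J := \int[Q]_p _.
have -> : J = cos (ph t) * I1 - sin (ph t) * I2.
  rewrite -!RintegralZl// -RintegralB//; last 2 first.
  - exact: (integrableZl measurableT _ i1).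
  - exact: (integrableZl measurableT _ i2).
  apply: eq_Rintegral => p _.
  have -> : dotv xi (p.2 + th p *: K) = u p + th p * dotv xi K.
    by rewrite dotvDr dotvZr.
  have e1 : cos (u p + th p * dotv xi K) * cos (ph (t + th p)) -
      sin (u p + th p * dotv xi K) * sin (ph (t + th p)) = cos (u p + ph t).
    by rewrite -cosD; congr cos; rewrite /ph; ring.
  have e2 : sin (u p + th p * dotv xi K) * cos (ph (t + th p)) +
      cos (u p + th p * dotv xi K) * sin (ph (t + th p)) = sin (u p + ph t).
    by rewrite -sinD; congr sin; rewrite /ph; ring.
  transitivity (al t p * ((cos (u p + ph t)) * c (t + th p)
     - sin (u p + ph t) * s (t + th p) - (cos (ph t) * c t - sin (ph t) * s t))).
    by rewrite -e1 -e2; ring.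
  by rewrite cosD sinD; ring.
by ring.
Qed.

End fixed_frequency.

Let K := delay_drift Q alpha_inf.
Let Gm := delay_Gamma Q alpha_inf.
Let D0 := delay_diffusion Q alpha_inf K.
Let v (eta : V) p := dotv eta (p.2 + th p *: K).

Let mv eta : measurable_fun setT (v eta).
Proof.
apply: measurable_dotv; first exact: measurable_cst.
apply: measurable_rV => i; under eq_fun do rewrite !mxE.
apply: measurable_funD; last exact: measurable_funM.
exact: (measurableT_comp (measurable_coord i) measurable_snd).
Qed.

Let ienorm2 : Q.-integrable setT (EFin \o (fun p => enorm p.2 ^+ 2)).
Proof. by have [_ h] := hj; exact: Lfun2_integrable_sqr h. Qed.

Let icst (b : R) : Q.-integrable setT (EFin \o (fun=> b)).
Proof. exact: (@bint _ `|b|). Qed.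

Let iv2 eta : Q.-integrable setT (EFin \o (fun p => v eta p ^+ 2)).
Proof.
pose b := \sum_i `|eta ord0 i| * (1 + `|K ord0 i|).
have b0 : 0 <= b by apply: sumr_ge0 => i _; rewrite mulr_ge0// addr_ge0.
have vb p : `|v eta p| <= b * (1 + enorm p.2).
  rewrite /v /dotv mulr_suml (le_trans (ler_norm_sum _ _ _))//.
  apply: ler_sum => i _; rewrite mxE [X in _ + X]mxE normrM -mulrA ler_wpM2l//.
  rewrite (le_trans (ler_normD _ _))// normrM.
  have h1 := coord_le_enorm p.2 i; have h2 := enorm_ge0 p.2.
  have h3 : `|th p| * `|K ord0 i| <= `|K ord0 i|.
    by rewrite ler_piMl// ler_norml; have := th_itv p; lra.
  have h4 := normr_ge0 (K ord0 i).
  have h5 := mulr_ge0 h4 h2.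
  by rewrite mulrDl mul1r mulrDr mulr1; lra.
have i1 := integrableZl measurableT (2 * b ^+ 2) (integrableD measurableT (icst 1) ienorm2).
apply: (dominated_Rintegrable measurableT _ i1).
  by under eq_fun do rewrite expr2; exact: measurable_funM.
move=> p _ /=; rewrite normrX.
have h := vb p; have h0 := normr_ge0 (v eta p); have e0 := enorm_ge0 p.2.
have h1 : `|v eta p| ^+ 2 <= (b * (1 + enorm p.2)) ^+ 2.
  by rewrite lerXn2r// nnegrE mulr_ge0// addr_ge0.
rewrite (le_trans h1)//; move: (enorm p.2) => e.
have -> : 2 * b ^+ 2 * (1 + e ^+ 2) = b ^+ 2 * (2 * (1 + e ^+ 2)) by ring.
by rewrite exprMn; apply: ler_wpM2l; [exact: sqr_ge0|have := sqr_ge0 (1 - e); lra].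
Qed.

Let iv eta : Q.-integrable setT (EFin \o v eta).
Proof.
apply: (dominated_Rintegrable measurableT _ (integrableD measurableT (icst 1) (iv2 eta))) => //.
move=> p _ /=; rewrite -(real_normK (num_real (v eta p))).
by move: `|v eta p| => e; have := sqr_ge0 (e - 1); have := sqr_ge0 e; lra.
Qed.

Let ali_int (f : W -> R) : Q.-integrable setT (EFin \o f) ->
  Q.-integrable setT (EFin \o (fun p => ali p * f p)).
Proof.
move=> fi; have [A [_ [_ [_ _ _ aliA _]]]] := rate_bounds.
have mf : measurable_fun setT f by apply/measurable_EFinP; exact: measurable_int fi.
have i1 := integrableZl measurableT A (integrable_norm fi).
apply: (dominated_Rintegrable measurableT _ i1); first exact: measurable_funM.
move=> p _ /=; have /andP[a0 aA] := aliA p.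
by rewrite normrM ler_pM// ger0_norm.
Qed.

Let Gamma_clip : Gm = \int[Q]_p (- th p * ali p).
Proof.
have [Q1 _] := hj; apply: (strip_Rintegral Q1).
  under eq_fun do rewrite mulrC; apply: ali_int.
  apply: (@bint _ 1); first exact: measurableT_comp.
  by move=> p; rewrite normrN ler_norml; have := th_itv p; lra.
by move=> p Sp; rewrite /ali clip_strip.
Qed.

Let Gm_ge0 : 0 <= Gm.
Proof.
rewrite Gamma_clip; have [A [_ [_ [_ _ _ aliA _]]]] := rate_bounds.
apply: Rintegral_ge0 => p _; have /andP[a0 _] := aliA p.
by rewrite mulr_ge0//; have := th_itv p; lra.
Qed.

Let icoord i : Q.-integrable setT (EFin \o (fun p : W => p.2 ord0 i)).
Proof.
apply: (dominated_Rintegrable measurableT _ (integrableD measurableT (icst 1) ienorm2)).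
  exact: (measurableT_comp (measurable_coord i) measurable_snd).
move=> p _ /=; have h1 := coord_le_enorm p.2 i; rewrite (le_trans h1)//.
by move: (enorm p.2) => e; have := sqr_ge0 (e - 1); have := sqr_ge0 e; lra.
Qed.

Let drift_coord i : \int[Q]_p (ali p * p.2 ord0 i) = (1 + Gm) * K ord0 i.
Proof.
have [Q1 _] := hj; rewrite !mxE -/Gm mulVKf; last by have := Gm_ge0; lra.
symmetry; apply: (strip_Rintegral Q1); first exact: ali_int.
by move=> p Sp; rewrite /ali clip_strip.
Qed.

(** This identity explains K: the mean of alpha_inf z is (1 + Gamma) K by definition, that of
    alpha_inf theta K is - Gamma K, and their sum is K. It supplies the value of [ka] required at
    every frequency. *)
Let drift_mean eta : \int[Q]_p (ali p * v eta p) = dotv eta K.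
Proof.
have ith : Q.-integrable setT (EFin \o (fun p => - th p * ali p)).
  under eq_fun do rewrite mulrC; apply: ali_int.
  apply: (@bint _ 1); first exact: measurableT_comp.
  by move=> p; rewrite normrN ler_norml; have := th_itv p; lra.
have iz i : Q.-integrable setT (EFin \o (fun p => eta ord0 i * (ali p * p.2 ord0 i))).
  exact: (integrableZl measurableT _ (ali_int (icoord i))).
have isum : Q.-integrable setT
    (EFin \o (fun p => \sum_i eta ord0 i * (ali p * p.2 ord0 i))).
  have -> : EFin \o (fun p => \sum_i eta ord0 i * (ali p * p.2 ord0 i)) =
      (fun p => \sum_i (eta ord0 i * (ali p * p.2 ord0 i))%:E)%E.
    by apply/funext => p; rewrite /= sumEFin.
  by apply: integrable_sum => // i _; exact: iz.
transitivity (\int[Q]_p (\sum_i eta ord0 i * (ali p * p.2 ord0 i)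
    - dotv eta K * (- th p * ali p))).
  apply: eq_Rintegral => p _; rewrite /v dotvDr dotvZr mulrDr /dotv mulr_sumr.
  rewrite mulNr mulrN opprK; congr (_ + _); last by ring.
  by apply: eq_bigr => i _; ring.
rewrite RintegralB//; last exact: (integrableZl measurableT _ ith).
rewrite RintegralZl// -Gamma_clip Rintegral_sum//.
have E i : \int[Q]_p (eta ord0 i * (ali p * p.2 ord0 i)) =
    eta ord0 i * ((1 + Gm) * K ord0 i).
  by rewrite RintegralZl// ?drift_coord//; exact: (ali_int (icoord i)).
under eq_bigr do rewrite E.
have -> : \sum_i eta ord0 i * ((1 + Gm) * K ord0 i) = (1 + Gm) * dotv eta K.
  by rewrite /dotv mulr_sumr; apply: eq_bigr => i _; ring.
ring.
Qed.

Let diffusion_integrable j k : Q.-integrable setT (EFin \o (fun p =>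
  ali p * ((p.2 + th p *: K) ord0 j * (p.2 + th p *: K) ord0 k))).
Proof.
have vE i p : v (delta_mx ord0 i) p = (p.2 + th p *: K) ord0 i.
  by rewrite /v dotvC dotv_delta.
apply: ali_int; have i1 := integrableD measurableT (iv2 (delta_mx ord0 j)) (iv2 (delta_mx ord0 k)).
apply: (dominated_Rintegrable measurableT _ i1).
  by under eq_fun do rewrite -!vE; exact: measurable_funM.
move=> p _ /=; rewrite -!vE; move: (v _ p) (v _ p) => y z.
rewrite ler_norml; have := sqr_ge0 (y - z); have := sqr_ge0 (y + z).
by have := sqr_ge0 y; have := sqr_ge0 z; move=> *; apply/andP; split; nra.
Qed.

Let diffusion_coord j k : D0 j k = \int[Q]_p
  (ali p * ((p.2 + th p *: K) ord0 j * (p.2 + th p *: K) ord0 k)).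
Proof.
have [Q1 _] := hj; rewrite mxE; apply: (strip_Rintegral Q1).
  exact: diffusion_integrable.
by move=> p Sp; rewrite /ali clip_strip// mxE big_ord1 mxE.
Qed.

Let diffusion_qform eta : qform D0 eta = \int[Q]_p (ali p * v eta p ^+ 2).
Proof.
rewrite /qform; transitivity (\int[Q]_p (\sum_j \sum_k (eta ord0 j * eta ord0 k) *
    (ali p * ((p.2 + th p *: K) ord0 j * (p.2 + th p *: K) ord0 k)))).
  have i1 j k := integrableZl measurableT (eta ord0 j * eta ord0 k) (diffusion_integrable j k).
  rewrite Rintegral_sum//; last first.
    move=> j; have -> : EFin \o (fun p => \sum_k (eta ord0 j * eta ord0 k) *
      (ali p * ((p.2 + th p *: K) ord0 j * (p.2 + th p *: K) ord0 k))) =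
      (fun p => \sum_k ((eta ord0 j * eta ord0 k) *
      (ali p * ((p.2 + th p *: K) ord0 j * (p.2 + th p *: K) ord0 k)))%:E)%E.
      by apply/funext => p; rewrite /= sumEFin.
    by apply: integrable_sum => // k _; exact: i1.
  apply: eq_bigr => j _; rewrite Rintegral_sum//; last by move=> k; exact: i1.
  rewrite mulr_sumr; apply: eq_bigr => k _.
  by rewrite RintegralZl// diffusion_coord; ring.
apply: eq_Rintegral => p _; rewrite expr2 {1}/v /dotv mulr_suml mulr_sumr.
apply: eq_bigr => j _; rewrite /v /dotv mulr_sumr mulr_sumr.
by apply: eq_bigr => k _; ring.
Qed.

Lemma delay_diffusion_sym : D0^T = D0.
Proof.
apply/matrixP => j k; rewrite mxE !diffusion_coord.
by apply: eq_Rintegral => p _; congr (_ * _); rewrite mulrC.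
Qed.

Lemma delay_diffusion_ge0 (eta : V) : 0 <= (eta *m D0 *m eta^T) ord0 ord0.
Proof.
rewrite qformE diffusion_qform; have [A [_ [_ [_ _ _ aliA _]]]] := rate_bounds.
apply: Rintegral_ge0 => p _; have /andP[a0 _] := aliA p.
by rewrite mulr_ge0// sqr_ge0.
Qed.

Lemma delay_Gamma_ge0 : 0 <= Gm. Proof. exact: Gm_ge0. Qed.

(** At time T and frequency eta / sqrt T, the moving cosine is exactly the cosine of the rescaled
    variable, so [delay_limit] applies with x_ k = 1 / sqrt (T_ k). *)
Lemma delay_characteristic_cvg (T_ : nat -> R) (eta : V) a :
  T_ k @[k --> \oo] --> +oo ->
  \int[mu (T_ k)]_x cos (dotv eta ((Num.sqrt (T_ k))^-1 *: (x - T_ k *: K)) + a)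
    @[k --> \oo] --> cos a * expR (- (qform ((1 + Gm)^-1 *: D0) eta / 2)).
Proof.
move=> Ty; pose x_ k := (Num.sqrt (T_ k))^-1.
have T_ge (b : R) : \forall k \near \oo, b <= T_ k by move: b; exact/cvgryPge.
have x_ge0 k : 0 <= x_ k by rewrite invr_ge0 sqrtr_ge0.
have Tx k : 0 < T_ k -> T_ k * x_ k ^+ 2 = 1.
  by move=> Tk; rewrite /x_ exprVn sqr_sqrtr ?ltW// divff// gt_eqF.
have Tx_itv k : 0 <= T_ k * x_ k ^+ 2 <= 1.
  have [Tk|Tk] := ltP 0 (T_ k); first by rewrite Tx// ler01 lexx.
  (* For T_ k <= 0 the square root is 0 and so is its inverse, which keeps the product in [0, 1]. *)
  by rewrite /x_ ler0_sqrtr// invr0 expr0n/= mulr0 lexx ler01.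
have Tx_cvg : T_ k * x_ k ^+ 2 @[k --> \oo] --> (1 : R).
  by apply: cvg_near_cst; apply: filterS (T_ge 1) => k Tk; apply: Tx; lra.
have x0 : x_ k @[k --> \oo] --> (0 : R).
  apply/cvgrPdist_le => e e0; apply: filterS (T_ge (e ^-1 ^+ 2)) => k Tk.
  have eV : 0 < e^-1 by rewrite invr_gt0.
  rewrite sub0r normrN ger0_norm// -(invrK e) lef_pV2 ?posrE//; last first.
    by rewrite sqrtr_gt0 (lt_le_trans _ Tk)// exprn_gt0.
  by rewrite -(ger0_norm (ltW eV)) -sqrtr_sqr ler_wsqrtr.
have [A [M [be [M0 be0 alA aliA al_ali]]]] := rate_bounds.
pose C_ k := moving_cos (x_ k *: eta) K a; pose S_ k := moving_sin (x_ k *: eta) K a.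
have vE k p : dotv (x_ k *: eta) (p.2 + th p *: K) = x_ k * v eta p by rewrite dotvZl.
have dC k t : 0 < t -> is_derive t 1 (C_ k) (\int[Q]_p (al t p * (cos (x_ k * v eta p) * C_ k (t + th p)
    - sin (x_ k * v eta p) * S_ k (t + th p) - C_ k t))
    + \int[Q]_p (ali p * (x_ k * v eta p)) * S_ k t).
  move=> t0; apply: (is_der_eq (is_der_moving_cos (x_ k *: eta) K a t0)).
  congr (_ + _ * _); first by apply: eq_Rintegral => p _; rewrite -!vE.
  by rewrite -drift_mean; apply: eq_Rintegral => p _; rewrite -vE.
(* At a fixed time the frequency tends to 0, so the law of mu n disappears from the limit and only
   the phase is left. *)
have C_init n : C_ k n%:R @[k --> \oo] --> cos a.
  rewrite -[X in _ --> X](Rintegral_pcst (mu (clipm n%:R))).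
  apply: (@Rintegral_dominated_cvg _ _ _ (mu (clipm n%:R)) setT _ _ (fun=> 1)).
  - exact: measurableT.
  - by move=> k; apply: Cb_measurable; exact: Cb_cos_phase.
  - move=> y _.
    have h : dotv (x_ k *: eta) y + (a - dotv (x_ k *: eta) K * n%:R) @[k --> \oo] --> a.
      have -> : (fun k => dotv (x_ k *: eta) y + (a - dotv (x_ k *: eta) K * n%:R)) =
        (fun k => x_ k * (dotv eta y - dotv eta K * n%:R) + a).
        by apply/funext => k; rewrite !dotvZl; ring.
      have h : x_ k * (dotv eta y - dotv eta K * n%:R) + a @[k --> \oo] -->
          0 * (dotv eta y - dotv eta K * n%:R) + a.
        by apply: cvgD; [apply: cvgM => //; exact: cvg_cst|exact: cvg_cst].
      by rewrite mul0r add0r in h.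
    by apply: cvg_comp h _; exact: continuous_cos.
  - by apply: (@Cb_integrable _ _ (mu (clipm n%:R)) (fun=> 1)); exact: Cb_cst.
  - by move=> k y _; rewrite ler_norml cos_geN1 cos_le1.
have lim := delay_limit mth th_itv mal alA mali aliA M0 be0 al_ali (mv eta) (iv eta)
  (iv2 eta) x0 x_ge0 Ty Tx_itv Tx_cvg
  (fun k => @moving_cos_continuous (x_ k *: eta) K a)
  (fun k => @moving_sin_continuous (x_ k *: eta) K a)
  (fun k => @moving_cos_le1 (x_ k *: eta) K a)
  (fun k => @moving_sin_le1 (x_ k *: eta) K a) dC C_init.
have -> : qform ((1 + Gm)^-1 *: D0) eta / 2 =
    \int[Q]_p (ali p * (v eta p ^+ 2 / 2)) / (1 + \int[Q]_p (- th p * ali p)).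
  rewrite -Gamma_clip.
  have -> : \int[Q]_p (ali p * (v eta p ^+ 2 / 2)) = 2^-1 * qform D0 eta.
    rewrite diffusion_qform -RintegralZl//; last exact: ali_int.
    by apply: eq_Rintegral => p _; ring.
  have -> : qform ((1 + Gm)^-1 *: D0) eta = (1 + Gm)^-1 * qform D0 eta.
    rewrite /qform mulr_sumr; apply: eq_bigr => j _.
    rewrite [RHS]mulrCA; congr (_ * _); rewrite mulr_sumr.
    by apply: eq_bigr => k _; rewrite mxE mulrA.
  by ring.
apply: cvg_trans lim; apply: near_eq_cvg.
apply: filterS (T_ge 0) => k Tk.
rewrite /C_ /moving_cos /clipm max_l; last by lra.
apply: eq_Rintegral => y _; congr cos.
have E (z b : R) (y' K' : V) : dotv (z *: eta) y' + (a - dotv (z *: eta) K' * b) =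
    dotv eta (z *: (y' - b *: K')) + a.
  by rewrite dotvZr dotvDr dotvNr dotvZr !dotvZl; ring.
exact: E.
Qed.

End delay_characteristic.

Theorem theorem2 (R : realType) (N : nat) (N_ge1 : (1 <= N)%N)
  (alpha : R -> R -> R) (alpha_inf : R -> R)
  (Q : probability (R * 'rV[R]_N)%type R)
  (u0 mu : R -> probability 'rV[R]_N R) :
  rate_assumption alpha alpha_inf ->
  jump_assumption Q ->
  narrow_continuous `[-1, 0] u0 ->
  delay_solution alpha Q u0 mu ->
  exists (K : 'rV[R]_N) (pi : probability 'rV[R]_N R),
    let Gamma := delay_Gamma Q alpha_inf in
    let D0 := delay_diffusion Q alpha_inf K in
    [/\ K = delay_drift Q alpha_inf,
        D0^T = D0 /\ (forall v : 'rV[R]_N, 0 <= (v *m D0 *m v^T) ord0 ord0),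
        zero_mean pi,
        forall f : 'rV[R]_N -> R, Cb f ->
          \int[mu t]_x f ((Num.sqrt t)^-1 *: (x - t *: K)) @[t --> +oo]
            --> \int[pi]_x f x &
        exists Pi : R -> probability 'rV[R]_N R,
          [/\ narrow_continuous `[0, +oo[ Pi,
              heat_solution ((1 + Gamma)^-1 *: D0) Pi,
              (forall Pi' : R -> probability 'rV[R]_N R,
                 narrow_continuous `[0, +oo[ Pi' ->
                 heat_solution ((1 + Gamma)^-1 *: D0) Pi' ->
                 forall t : R, 0 <= t -> Pi' t ≡μ Pi t) &
              pi ≡μ Pi 1]].
Proof.
move=> hr hj hu0 hmu.
pose K := delay_drift Q alpha_inf.
pose A := (1 + delay_Gamma Q alpha_inf)^-1 *: delay_diffusion Q alpha_inf K.
have D_sym := delay_diffusion_sym hr hj.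
have D_ge0 := delay_diffusion_ge0 hr hj.
have G_ge0 := delay_Gamma_ge0 hr hj.
have A_sym : A^T = A by rewrite /A linearZ/= D_sym.
have A_ge0 (v : 'rV[R]_N) : 0 <= (v *m A *m v^T) ord0 ord0.
  rewrite /A -scalemxAr -scalemxAl mxE mulr_ge0// invr_ge0; lra.
have [s hs] := psd_factor A_sym A_ge0.
have [G hG] := gaussian_exists s; rewrite -hs in hG.
(* The limit law is taken to be G itself; it is the heat law at time 1 because sqrt 1 = 1. *)
have Pi1 f : Cb f -> \int[G]_x f x = \int[heat_law G 1]_x f x.
  move=> cf; rewrite heat_law_integral//; apply: eq_Rintegral => x _.
  by rewrite sqrtr1 scale1r.
have hPi := heat_law_solution hG A_sym.
have cPi := @heat_law_narrow_continuous _ _ G `[0, +oo[.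
exists K, G; split => //.
- exact: gaussian_zero_mean hG.
(* The continuity theorem concerns sequences, hence the passage to an arbitrary sequence of times
   tending to infinity. *)
- move=> f cf; apply/cvg_pinftyP => T_ Ty.
  have mphi t : measurable_fun setT (fun x : 'rV[R]_N => (Num.sqrt t)^-1 *: (x - t *: K)).
    apply: measurable_rV => i; under eq_fun do rewrite mxE mxE.
    by apply: measurable_funM => //; apply: measurable_funD => //; exact: measurable_coord.
  pose p_ k := law (mu (T_ k)) (mphi (T_ k)).
  have pE g k : Cb g -> \int[p_ k]_x g x =
      \int[mu (T_ k)]_x g ((Num.sqrt (T_ k))^-1 *: (x - T_ k *: K)).
    move=> cg; have mg := Cb_measurable cg.
    apply: Rintegral_law => //; have /CbP[_ [B gB]] := cg.
    apply: (@bounded_integrable _ _ _ (mu (T_ k)) setT _ B) => //.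
      exact: (measurableT_comp mg (mphi (T_ k))).
    by move=> x _; exact: gB.
  have key xi a := @delay_characteristic_cvg _ _ _ _ _ _ _ hr hj hmu T_ xi a Ty.
  have lim : \int[p_ k]_x f x @[k --> \oo] --> \int[G]_x f x.
    apply: narrow_cvg_of_characteristic => // xi.
      rewrite (gaussian_cos0 xi hG).
      have h := key xi 0; rewrite cos0 mul1r in h.
      apply: cvg_trans h; apply: near_eq_cvg; apply: nearW => m.
      rewrite pE; last by apply: Cb_cos; exact: dotvl_continuous.
      by apply: eq_Rintegral => x _; rewrite addr0.
    rewrite (gaussian_sin xi hG).
    (* The phase - pi / 2 turns the cosine into a sine, and the limit 0 agrees with the symmetry of
       the Gaussian. *)
    have h := key xi (- (pi / 2)); rewrite cosN cos_pihalf mul0r in h.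
    apply: cvg_trans h; apply: near_eq_cvg; apply: nearW => m.
    rewrite pE; last by apply: Cb_sin; exact: dotvl_continuous.
    by apply: eq_Rintegral => x _; rewrite -cosBpihalf.
  by under eq_fun do rewrite -pE//.
- exists (heat_law G); split => //.
  + by move=> Pi' cPi' hPi' t t0; exact: (heat_solution_unique cPi hPi cPi' hPi').
  + exact: prob_eq_Cb.
Qed.
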